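(* Let $d_l,d_\phi,c_l,c_\phi:[1,\infty)\to(0,\infty)$ be regularly varying functions with nonpositive indices, with $d_\phi\le1$ and $d_l\asymp1\asymp d_\phi$ locally. Denote $\delta_l:=-\operatorname{ind}d_l$, $\delta_\phi:=-\operatorname{ind}d_\phi$, $\gamma_l:=-\operatorname{ind}c_l$, $\gamma_\phi:=-\operatorname{ind}c_\phi$, and $$D(t):=\frac1{d_l(t)d_\phi(t)},\quad\delta:=\operatorname{ind}D=\delta_l+\delta_\phi,\qquad C(t):=\frac1{(c_l(t)c_\phi(t))^{1/2}},\quad\gamma:=\operatorname{ind}C=\frac{\gamma_l+\gamma_\phi}2.$$ Let $k(R),h(R),\mathfrak g(t,R)$ be built from $d_l,d_\phi$ as in the context, and set $$\mathfrak B(t,R):=\max\Big\{\mathfrak g(t,R),\frac R{C(t)}\Big\},\qquad\mathfrak B(R):=\inf_{t\ge1}\mathfrak B(t,R).$$ Assume that $\delta>0$, that $C$ is $\asymp$ on $[1,\infty)$ to a nondecreasing function, and that $\lim_{t\to\infty}C(t)=\infty$. Then the following hold, all estimates of $\mathfrak B(R)$ being for sufficiently large $R$. (A) Assume $D(t)\lesssim tC(t)$. Choose $\alpha\ge4\sup_{t\ge1}\frac{D(t)}{tC(t)}$ and set $f(t):=tC(t)\log\big[\alpha\frac{tC(t)}{D(t)}\big]$. Then an asymptotic inverse $f^-$ of $f$ exists, and with $\tau(R):=f^-(\frac1\alpha R)$ we have $$\mathfrak B(R)\asymp\mathfrak B(\tau(R),R)\asymp\frac R{C(f^-(R))}.$$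 The function on the right is regularly varying with index $\frac1{1+\gamma}$. If $\delta<1+\gamma$, then $f(t)\asymp tC(t)\log t$ for sufficiently large $t$, and $\mathfrak B(R)$ is, up to $\asymp$, independent of $d_l$ and $d_\phi$. (B) Assume $tC(t)\lesssim D(t)$, $\int_1^\infty D(s)^{-1/2}ds<\infty$, and, if $(\delta_l,\delta_\phi,\gamma)=(1,1,0)$, that $\frac{d_\phi}{d_l}$ is bounded or $\asymp$ to a monotone function. Then $$k(R)\lesssim\mathfrak B(R)\lesssim R^{\frac12}\int_{k(R)}^\infty D(s)^{-\frac12}ds.$$ Both bounds are regularly varying with index $\frac1\delta$. If $\delta>2$, then $\asymp$ holds throughout, and $\mathfrak B(R)$ is, up to $\asymp$, independent of $c_l$ and $c_\phi$. (C) Assume $\frac1{d_l(t)}\lesssim tC(t)\lesssim D(t)$, $\int_1^\infty D(s)^{-1/2}ds=\infty$, and $(\delta,\gamma)\ne(2,0)$. Set $f_0(t):=\frac{t^2C(t)^2}{D(t)}$ and $f_1(t):=\big(C(t)\int_1^tD(s)^{-1/2}ds\big)^2$. Then asymptotic inverses $f_0^-,f_1^-$ exist, and with $\tau(R):=\min\{\max\{f_1^-(R),k(R)\},h(R)\}$ we have $$\frac R{C(f_0^-(R))}\lesssim\mathfrak B(R)\lesssim\mathfrak B(\tau(R),R)\lesssim\frac R{C(f_1^-(R))}.$$ Both outer bounds are regularly varying with index $\frac{2-\delta+\gamma}{2-\delta+2\gamma}$. If $\delta<2$, then $\asymp$ holds throughout. (D) Assume $tC(t)\lesssim\frac1{d_l(t)}$,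 $\int_1^\infty D(s)^{-1/2}ds=\infty$, and $\int_1^\infty d_l(s)ds<\infty$. Then $\frac{d_\phi}{d_l}$ is unbounded and $$R\,h(R)\,d_l(h(R))\lesssim\mathfrak B(R)\lesssim R^{\frac12}\int_1^{h(R)}D(s)^{-\frac12}ds+R\int_{h(R)}^\infty d_l(s)ds.$$ If $\delta_l>\delta_\phi$, then both bounds are regularly varying with index $\frac{1-\delta_\phi}{\delta_l-\delta_\phi}$. If $\delta<2$ and $\delta_l>1$, then $\asymp$ holds throughout.
   Context: Comparison notation: $f\lesssim g$ means $f\le c\,g$ on the whole common domain for some constant $c>0$ (''for sufficiently large $x$'': on some $[x_0,\infty)$); $f\asymp g$ means $f\lesssim g$ and $g\lesssim f$; ''locally'' means on every compact subset; $f\sim g$ means $\lim f/g=1$. Regular variation: a measurable $a:[1,\infty)\to(0,\infty)$ is regularly varying with index $\operatorname{ind}a=\alpha\in\mathbb R$ if $\lim_{r\to\infty}a(\lambda r)/a(r)=\lambda^\alpha$ for all $\lambda>0$. For regularly varying $a$ with positive index, an asymptotic inverse $a^-$ is a regularly varying function with $a(a^-(x))\sim a^-(a(x))\sim x$ (unique up to $\sim$), e.g. $a^-(x)=\sup\{t\in[1,\infty):a(t)<x\}$. Only behaviour for large arguments matters. Functions built from $d_l,d_\phi$: $$k(R):=\sup\Big\{t\in[1,\infty):\sup_{1\le s\le t}\frac{2}{R\,d_l(s)d_\phi(s)}\le1\Big\},\qquad h(R):=\sup\Big\{t\in[1,\infty):\sup_{1\le s\le t}\frac{d_\phi(s)}{R\,d_l(s)}\le1\Big\}$$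 (values in $[1,\infty]$, $k(R)\le h(R)$) for $R\ge\frac2{d_l(1)d_\phi(1)}$, and $$g(t,R):=\begin{cases}\log\big(R\,d_l(t)d_\phi(t)\big)&1\le t<k(R),\\ R^{1/2}(d_l(t)d_\phi(t))^{1/2}&k(R)\le t<h(R),\\ R\,d_l(t)&h(R)\le t,\end{cases}\qquad \mathfrak g(t,R):=\int_1^tg(s,R)\,ds.$$ ''$\mathfrak B(R)$ is up to $\asymp$ independent of $d_l$ and $d_\phi$'' means: for fixed $c_l,c_\phi$, any two admissible pairs $(d_l,d_\phi)$ satisfying the hypotheses of that part give functions $\mathfrak B(R)$ that are $\asymp$ for sufficiently large $R$; analogously for ''independent of $c_l$ and $c_\phi$'' with $d_l,d_\phi$ fixed. *)

(* Defs.v *)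
From HB Require Import structures.
From mathcomp Require Import all_boot all_order all_algebra.
From mathcomp Require Import all_classical all_reals all_analysis.

Set Implicit Arguments.
Unset Strict Implicit.
Unset Printing Implicit Defensive.

Import Order.TTheory GRing.Theory Num.Theory.
Import numFieldNormedType.Exports.

Local Open Scope classical_set_scope.
Local Open Scope ring_scope.

(* Functions on [1, oo[ are total functions [R -> R] of which only the values
   on [1, oo[ are constrained.  The real parameter called "R" in the
   mathematics is written [r], since [R] is the type of real numbers. *)

Section Comparison.
Context {R : realType}.
Implicit Types (A : set R) (f g a b : R -> R).

Definition lesssim_on A f g : Prop :=
  exists2 c : R, 0 < c & forall x, A x -> f x <= c * g x.

Definition asymp_on A f g : Prop := lesssim_on A f g /\ lesssim_on A g f.

Definition lesssim_oo f g : Prop := exists x0 : R, lesssim_on `[x0, +oo[ f g.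

Definition asymp_oo f g : Prop := lesssim_oo f g /\ lesssim_oo g f.

Definition sim_oo f g : Prop := f x / g x @[x --> +oo] --> (1 : R).

Definition locally_asymp_one f : Prop :=
  forall K : set R, compact K -> K `<=` `[1, +oo[ -> asymp_on K f (fun=> 1).

Definition nondecreasing_ge1 f : Prop :=
  {in `[1, +oo[ &, {homo f : s t / s <= t}}.

Definition nonincreasing_ge1 f : Prop :=
  {in `[1, +oo[ &, {homo f : s t / s <= t >-> t <= s}}.

(* "Measurable" is Borel measurability, the sigma-algebra carried by [R]. *)
Definition regularly_varying_from (x0 : R) a (alpha : R) : Prop :=
  [/\ measurable_fun `[x0, +oo[ a,
      (forall t, x0 <= t -> 0 < a t) &
      forall lambda : R, 0 < lambda ->
        a (lambda * r) / a r @[r --> +oo] --> lambda `^ alpha].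

(* The notion for functions that are constructed (asymptotic inverses, bounds):
   they may be meaningless, or vanish, at small arguments. *)
Definition regularly_varying a (alpha : R) : Prop :=
  exists x0 : R, regularly_varying_from x0 a alpha.

Definition asymptotic_inverse a b : Prop :=
  [/\ (exists2 alpha : R, 0 < alpha & regularly_varying a alpha),
      (exists beta : R, regularly_varying b beta),
      sim_oo (fun x => a (b x)) id &
      sim_oo (fun x => b (a x)) id].

End Comparison.

Section Construction.
Context {R : realType}.
Variables (dl dphi : R -> R).

Definition bigD (t : R) : R := (dl t * dphi t)^-1.

Definition kfun (r : R) : \bar R :=
  ereal_sup [set t%:E | t in [set t : R | 1 <= t /\
    (ereal_sup [set (2 / (r * dl s * dphi s))%:E | s in `[1%R, t]] <= 1)%E]].

Definition hfun (r : R) : \bar R :=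
  ereal_sup [set t%:E | t in [set t : R | 1 <= t /\
    (ereal_sup [set (dphi s / (r * dl s))%:E | s in `[1%R, t]] <= 1)%E]].

Definition gfun (t r : R) : R :=
  if (t%:E < kfun r)%E then ln (r * dl t * dphi t)
  else if (t%:E < hfun r)%E then Num.sqrt r * Num.sqrt (dl t * dphi t)
  else r * dl t.

Definition gint (t r : R) : R :=
  \int[lebesgue_measure]_(s in `[1, t]) gfun s r.

Variables (cl cphi : R -> R).

Definition bigC (t : R) : R := (Num.sqrt (cl t * cphi t))^-1.

Definition Bfun (t r : R) : R := Num.max (gint t r) (r / bigC t).

Definition Binf (r : R) : R := inf [set Bfun t r | t in `[1, +oo[].

(* The assumptions shared by all parts; the last four parameters are the
   negated indices of the four functions. *)
Record standing (deltal deltaphi gammal gammaphi : R) : Prop := Standing {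
  rv_dl : regularly_varying_from 1 dl (- deltal);
  rv_dphi : regularly_varying_from 1 dphi (- deltaphi);
  rv_cl : regularly_varying_from 1 cl (- gammal);
  rv_cphi : regularly_varying_from 1 cphi (- gammaphi);
  deltal_ge0 : 0 <= deltal;
  deltaphi_ge0 : 0 <= deltaphi;
  gammal_ge0 : 0 <= gammal;
  gammaphi_ge0 : 0 <= gammaphi;
  dphi_le1 : forall t, 1 <= t -> dphi t <= 1;
  dl_locally : locally_asymp_one dl;
  dphi_locally : locally_asymp_one dphi;
  delta_gt0 : 0 < deltal + deltaphi;
  C_monotone : exists2 m : R -> R,
    nondecreasing_ge1 m & asymp_on `[1, +oo[ bigC m;
  C_cvg : bigC t @[t --> +oo] --> +oo
}.

Definition hypA : Prop :=
  lesssim_on `[1, +oo[ bigD (fun t => t * bigC t).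

Definition hypB (deltal deltaphi gamma : R) : Prop :=
  [/\ lesssim_on `[1, +oo[ (fun t => t * bigC t) bigD,
      (\int[lebesgue_measure]_(s in `[1%R, +oo[)
         ((Num.sqrt (bigD s))^-1)%:E < +oo)%E &
      [/\ deltal = 1, deltaphi = 1 & gamma = 0] ->
        [bounded dphi t / dl t | t in `[1, +oo[] \/
        exists2 m : R -> R, nondecreasing_ge1 m \/ nonincreasing_ge1 m &
          asymp_on `[1, +oo[ (fun t => dphi t / dl t) m].

Definition hypC (delta gamma : R) : Prop :=
  [/\ lesssim_on `[1, +oo[ (fun t => (dl t)^-1) (fun t => t * bigC t),
      lesssim_on `[1, +oo[ (fun t => t * bigC t) bigD,
      (\int[lebesgue_measure]_(s in `[1%R, +oo[)
         ((Num.sqrt (bigD s))^-1)%:E = +oo)%E &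
      (delta, gamma) <> (2, 0)].

Definition hypD : Prop :=
  [/\ lesssim_on `[1, +oo[ (fun t => t * bigC t) (fun t => (dl t)^-1),
      (\int[lebesgue_measure]_(s in `[1%R, +oo[)
         ((Num.sqrt (bigD s))^-1)%:E = +oo)%E &
      (\int[lebesgue_measure]_(s in `[1%R, +oo[) (dl s)%:E < +oo)%E].

End Construction.

(* Main.v *)
Require Import Defs.
From HB Require Import structures.
From mathcomp Require Import all_boot all_order all_algebra.
From mathcomp Require Import all_classical all_reals all_analysis.
From mathcomp Require Import measurable_realfun.
From mathcomp Require Import ring lra.

Set Implicit Arguments.
Unset Strict Implicit.
Unset Printing Implicit Defensive.

Import Order.TTheory GRing.Theory Num.Theory.
Import numFieldNormedType.Exports.

Local Open Scope classical_set_scope.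
Local Open Scope ring_scope.

(** Why the theorem holds.

    Fix the parameter r.  The integral gint(t, r) increases with t, while r / C(t) decreases up
    to a constant factor.  Hence every t bounds the infimum from above by Bfun(t, r), and every
    t at which both gint(t, r) and r / C(t) are at least m bounds it from below by a constant
    times m ([Binf_ge]).  Each of the four cases consists in evaluating both quantities at one
    well-chosen point: the solution of f(t) = r / alpha in (A), the point k(r) in (B), the
    solutions of f0(t) = r and of f1(t) = r in (C), where the second one is moved into the
    interval from k(r) to h(r), and the point h(r) in (D); for the upper bounds in (B) and (D),
    t is mostly sent to infinity, where r / C(t) vanishes ([Binf_le_limit]).

    The integral is governed by three phases.  Up to k(r) the integrand is ln (r / D(s)); by
    Potter's bounds it is at most ln (r / D(t)) plus a multiple of 1 + ln (t / s), and ln (t /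
    s) has integral at most t, so that gint(t, r) is comparable with t ln (r / D(t))
    ([gint_lo_le], [gint_lo_ge]).  At k(r) the ratio r / D is bounded, so the whole first phase
    contributes about k(r), which is absorbed by the middle phase.  There the integrand is sqrt
    r / sqrt D(s), and afterwards r dl(s); at h(r) the two expressions agree up to a constant,
    because dphi / dl is about r.  Karamata's theorem gives the index of the integrals of 1 /
    sqrt D and of dl, and says that they are comparable with t / sqrt D(t) and t dl(t) as soon
    as the index differs from the critical value -1: this is the reason why the upper and lower
    bounds agree when delta, or deltal, is not critical.

    The upper bound in (B) has one delicate point: when deltal = deltaphi, the point h(r) is
    larger than every power of r, and dphi / dl need not be comparable with r beyond h(r).  If
    gamma > 0, a suitable power of r already makes r / C negligible before h(r) is reached
    ([upper_equal_gamma]); if delta > 2, the integral of dl beyond h(r) is negligible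
    ([upper_equal_delta]); the only remaining indices are (1, 1, 0), and there the additional
    assumption on dphi / dl enters.

    All statements about regular variation go through the predicate [uvar], a form of Potter's
    bounds for ln a.  The uniform convergence theorem derives it from the pointwise limits in
    the definition of regular variation; products, quotients, compositions, inverses and
    integrals are then treated by elementary estimates of logarithms. *)

(** * Change of scale in integrals *)

Section scaling.
Context {R : realType}.
Local Notation mu := (@lebesgue_measure R).

(** Both sides are measures that agree on half-open intervals, so uniqueness of Lebesgue measure
    applies. *)
Lemma lebesgue_measure_scale (c : R) (c0 : 0 < c) (A : set R) : measurable A ->
  mu A = (c%:E * mu ((fun x : measurableTypeR R => (c * x)%R : measurableTypeR R) @^-1` A))%E.
Proof.
move=> mA.
have mc : measurable_fun setT (fun x : measurableTypeR R => (c * x)%R : measurableTypeR R).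
  by apply: measurable_funM => //; exact: measurable_cst.
pose m' := pushforward mu (fun x : measurableTypeR R => (c * x)%R : measurableTypeR R).
pose m2 : {measure set (measurableTypeR R) -> \bar R} :=
  mscale (NngNum (ltW c0)) (measure_function_pushforward__canonical__measure_function_Measure mu mc).
suff H : forall A : set R, measurable A -> mu A = m2 A by exact: (H A mA).
move=> {A mA}; apply: lebesgue_measure_unique => // _ [[a b]] _ <-.
rewrite /m2/= /mscale/= /m' /pushforward/=.
have -> : (fun x : R => c * x) @^-1` `]a, b] = `]a / c, b / c]%classic.
  apply/seteqP; split=> x /=; rewrite !in_itv/= ltr_pdivrMr// ler_pdivlMr//;
  by rewrite [x * c]mulrC.
rewrite !lebesgue_measure_itv/= !lte_fin ltr_pM2r ?invr_gt0//.
case: ifPn => ab; last by rewrite mule0.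
by rewrite -!EFinB -EFinM -mulrBl mulrCA divff ?mulr1// gt_eqF.
Qed.

Lemma ge0_integral_scale (c : R) (D : set R) (f : R -> \bar R) : 0 < c ->
  measurable D -> measurable_fun D f -> (forall x, D x -> 0 <= f x)%E ->
  (\int[mu]_(x in D) f x =
   c%:E * \int[mu]_(x in (fun x => c * x)%R @^-1` D) f (c * x)%R)%E.
Proof.
move=> c0 mD mf f0.
have mc : measurable_fun setT (fun x : measurableTypeR R => (c * x)%R : measurableTypeR R).
  by apply: measurable_funM => //; exact: measurable_cst.
pose m' := pushforward mu (fun x : measurableTypeR R => (c * x)%R : measurableTypeR R).
pose m2 : {measure set (measurableTypeR R) -> \bar R} :=
  mscale (NngNum (ltW c0)) (measure_function_pushforward__canonical__measure_function_Measure mu mc).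
transitivity (\int[m2]_(x in D) f x)%E.
  apply: eq_measure_integral => A mA _; rewrite /m2/= /mscale/=.
  exact: lebesgue_measure_scale.
rewrite /m2 ge0_integral_mscale//=.
rewrite ge0_integral_pushforward// => x; rewrite inE; exact: f0.
Qed.

End scaling.

(** * The uniform convergence theorem *)

Section uniform_convergence.
Context {R : realType}.
Local Notation mu := (@lebesgue_measure R).

(** From ln (1/2) <= -1/2. *)
Lemma half_le_ln2 : 2^-1 <= ln (2 : R).
Proof.
have := @le_ln1Dx R (- 2^-1) ltac:(lra).
by rewrite (_ : 1 + - 2^-1 = 2^-1 :> R) ?lnV ?posrE//; lra.
Qed.

Variable L : R -> R.
Hypothesis mL : measurable_fun [set: R] L.
Hypothesis cvgL : forall l : R, 0 < l -> L (l * x) - L x @[x --> +oo] --> (0 : R).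

(** The truncation at 1 provides the dominating function below. *)
Let Psi (x y : R) : R := Num.min 1 `|L y - L x|.
Let phi (x : R) : \bar R := (\int[mu]_(l in `[1%R, 4%R]) (Psi x (l * x))%:E)%E.

Let Psi_ge0 x y : 0 <= Psi x y.
Proof. by rewrite /Psi le_min ler01 normr_ge0. Qed.

Let Psi_le1 x y : Psi x y <= 1.
Proof. by rewrite /Psi ge_min lexx. Qed.

Let Psi_triangle x y z : Psi x y <= Psi x z + Psi y z.
Proof.
rewrite /Psi; have H : `|L y - L x| <= `|L z - L x| + `|L z - L y|.
  rewrite (_ : L y - L x = (L z - L x) - (L z - L y)); last by ring.
  exact: ler_normB.
move: H (normr_ge0 (L z - L x)) (normr_ge0 (L z - L y)).
rewrite /Num.min; case: ifP; case: ifP; case: ifP; lra.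
Qed.

Let mPsi (D : set R) z x : measurable_fun D (fun l => Psi z (l * x)).
Proof.
apply: (measurable_funS measurableT) => //.
apply: measurable_minr; first exact: measurable_cst.
apply: measurableT_comp => //.
apply: measurable_funB; last exact: measurable_cst.
apply: measurableT_comp => //.
by apply: measurable_funM => //; exact: measurable_cst.
Qed.

Let mu14 : mu `[1, 4] = 3%:E.
Proof.
rewrite lebesgue_measure_itv/= lte_fin ifT; last by lra.
by rewrite -EFinB; congr EFin; lra.
Qed.

Let phi_fin x : phi x \is a fin_num.
Proof.
rewrite ge0_fin_numE; last by apply: integral_ge0 => l _; rewrite lee_fin.
apply: (@le_lt_trans _ _ (\int[mu]_(l in `[1%R, 4%R]) cst 1%E l)%E).
  apply: ge0_le_integral => //.
  - by move=> l _; rewrite lee_fin.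
  - by apply/measurable_EFinP; exact: mPsi.
  - by move=> l _; rewrite lee_fin.
by rewrite integral_cst//= mul1e mu14 ltry.
Qed.

Let phi_cvg : fine (phi x) @[x --> +oo] --> (0 : R).
Proof.
apply/cvg_pinftyP => u uoo.
have := @dominated_convergence _ _ _ mu `[1, 4] (measurable_itv _)
  (fun n l => (Psi (u n) (l * u n))%:E) (cst 0%E) (cst 1%E).
case.
- by move=> n; apply/measurable_EFinP; exact: mPsi.
- exact: measurable_cst.
- apply: aeW => l; rewrite /= in_itv/= => /andP[l1 l4].
  apply: cvg_EFin; first by near=> n.
  have l0 : 0 < l by lra.
  have := cvgL l0 => /cvgrPdist_lt H.
  apply/cvgrPdist_lt => e e0.
  have e1 : 0 < Num.min e 1 by rewrite lt_min e0 ltr01.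
  have {}H := H _ e1.
  near=> n; rewrite /= sub0r normrN ger0_norm//.
  have : `|L (l * u n) - L (u n)| < Num.min e 1.
    rewrite -normrN -sub0r; near: n.
    exact: (uoo _ H).
  rewrite /Psi lt_min => /andP[Le L1].
  by rewrite gt_min Le orbT.
- apply/integrableP; split; first exact: measurable_cst.
  by rewrite integral_cst//= normr1 mul1e mu14 ltry.
- by apply: aeW => l n _; rewrite /= lee_fin ger0_norm.
by move=> _ _; rewrite integral0 => /fine_cvgP[].
Unshelve. all: by end_near. Qed.

Let Psi_le_phi x t : 1 <= t <= 2 ->
  2 * Psi x (t * x) <= fine (phi x) + 2 * fine (phi (t * x)).
Proof.
move=> /andP[t1 t2]; rewrite -lee_fin EFinD !EFinM !fineK//.
have t0 : 0 < t by lra.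
have mu24 : mu `[2, 4] = 2%:E.
  rewrite lebesgue_measure_itv/= lte_fin ifT; last by lra.
  by rewrite -EFinB; congr EFin; lra.
have mE f (D : set R) : measurable_fun D f -> measurable_fun D (EFin \o f).
  by move=> mf; apply/measurable_EFinP.
have -> : (2%:E * (Psi x (t * x)%R)%:E =
    \int[mu]_(l in `[2%R, 4%R]) (cst (Psi x (t * x)%R)%:E l))%E.
  by rewrite integral_cst//= mu24 muleC.
apply: (@le_trans _ _ (\int[mu]_(l in `[2%R, 4%R])
    ((Psi x (l * x))%:E + (Psi (t * x) (l * x))%:E))%E).
  apply: ge0_le_integral => //.
  - by move=> l _; rewrite lee_fin.
  - by apply: emeasurable_funD; apply: mE; exact: mPsi.
  - by move=> l _; rewrite -EFinD lee_fin Psi_triangle.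
rewrite ge0_integralD//=; last 4 first.
- by move=> l _; rewrite lee_fin.
- by apply: mE; exact: mPsi.
- by move=> l _; rewrite lee_fin.
- by apply: mE; exact: mPsi.
apply: leeD.
  apply: ge0_subset_integral => //.
  - by apply: mE; exact: mPsi.
  - by move=> l _; rewrite lee_fin.
  - by move=> l /=; rewrite !in_itv/= => /andP[? ?]; apply/andP; split; lra.
rewrite (ge0_integral_scale t0)//; last 2 first.
- by apply: mE; exact: mPsi.
- by move=> l _; rewrite lee_fin.
apply: lee_pmul => //.
- by rewrite lee_fin ltW.
- by apply: integral_ge0 => l _; rewrite lee_fin.
- rewrite /phi; under [leRHS]eq_integral do rewrite mulrCA mulrA.
  apply: ge0_subset_integral => //.
  - rewrite -[X in measurable X]setTI.
    by apply: measurable_funM => //; exact: measurable_cst.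
  - apply: mE; have := @mPsi `[1, 4]%classic (t * x) (t * x).
    by apply: eq_measurable_fun => l _; rewrite mulrCA mulrA.
  - by move=> l _; rewrite lee_fin.
  - move=> l /=; rewrite !in_itv/= => /andP[? ?]; apply/andP; split; nra.
Qed.

(** Integrating the triangle inequality for [Psi] over l in [2, 4], and substituting l = t u in the
    second term, bounds the increment of L from x to t x by [phi x] and [phi (t x)] alone; both tend
    to 0 by dominated convergence.  This gives uniformity in t from pointwise limits. *)
Let uniform_dyadic e : 0 < e -> exists2 X : R, 1 <= X &
  forall x t, X <= x -> 1 <= t <= 2 -> `|L (t * x) - L x| <= e.
Proof.
move=> e0; pose d := Num.min e 2^-1.
have d0 : 0 < d by rewrite lt_min e0; lra.
have := phi_cvg => /cvgrPdist_lt /(_ (d / 2) ltac:(lra)) [X [_ HX]].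
exists (Num.max 1 (X + 1)); first by rewrite le_max lexx.
move=> x t; rewrite ge_max => /andP[x1 xX] /[dup] t12 /andP[t1 t2].
have := HX x ltac:(lra); have := HX (t * x) ltac:(nra).
rewrite !sub0r !normrN => /(le_lt_trans (ler_norm _)) h1
  /(le_lt_trans (ler_norm _)) h2.
have := Psi_le_phi x t12 => h3.
have : Psi x (t * x) < d by lra.
by rewrite /Psi lt_min !gt_min => /andP[/orP[|]]; lra.
Qed.

(** Chaining increments over the dyadic points x, 2x, 4x, ... turns uniformity on the window [x, 2x]
    into a bound that grows with ln y - ln x. *)
Lemma uniform_of_pointwise e : 0 < e -> exists2 X : R, 1 <= X &
  forall x y, X <= x -> X <= y -> `|L y - L x| <= e * (1 + `|ln y - ln x|).
Proof.
move=> e0; have [X X1 HX] := @uniform_dyadic (e / 2) ltac:(lra).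
exists X => //.
have chain n : forall x y, X <= x -> x <= y -> ln y - ln x <= n%:R * ln 2 ->
    `|L y - L x| <= n%:R * (e / 2).
  elim: n => [|n IH] x y Xx xy.
    rewrite mul0r => h; suff -> : y = x by rewrite subrr normr0 mul0r.
    apply: ln_inj; rewrite ?posrE; [lra|lra|].
    by have := ler_ln; move=> /(_ R x y); rewrite !posrE xy => H;
      have := H ltac:(lra) ltac:(lra); lra.
  rewrite -natr1 !mulrDl !mul1r => h.
  have [y2x|y2x] := leP y (2 * x).
    have := HX x (y / x) Xx; rewrite divfK ?gt_eqF//; last by lra.
    move=> /(_ _)/le_trans; apply.
      by rewrite ler_pdivlMr ?ler_pdivrMr ?mul1r; lra.
    by rewrite lerDr mulr_ge0//; lra.
  have h1 := HX x 2 Xx ltac:(lra).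
  have h2 := IH (2 * x) y ltac:(lra) ltac:(lra) _.
  rewrite (_ : L y - L x = (L y - L (2 * x)) + (L (2 * x) - L x)); last by ring.
  apply: le_trans (ler_normD _ _) _; apply: lerD => //; apply: h2.
  by rewrite lnM ?posrE; lra.
have main x y : X <= x -> x <= y -> `|L y - L x| <= e * (1 + `|ln y - ln x|).
  move=> Xx xy.
  have l0 : 0 <= ln y - ln x by rewrite subr_ge0 ler_ln ?posrE; lra.
  have l2 := half_le_ln2.
  have z0 : 0 <= (ln y - ln x) / ln 2 by rewrite divr_ge0//; lra.
  have /andP[n1 n2] := truncn_itv z0.
  have := chain (Num.truncn ((ln y - ln x) / ln 2)).+1 x y Xx xy.
  move=> /(_ _)/le_trans; apply.
    by rewrite -ler_pdivrMr ?ltW//; lra.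
  rewrite ger0_norm// -natr1.
  have : (Num.truncn ((ln y - ln x) / ln 2))%:R <= 2 * (ln y - ln x).
    by apply: (le_trans n1); rewrite ler_pdivrMr; nra.
  nra.
move=> x y Xx Xy; have [xy|/ltW yx] := leP x y; first exact: main.
by rewrite distrC [`|ln _ - _|]distrC; exact: main.
Qed.

End uniform_convergence.

(** * Calculus of regularly varying functions *)

Section uniformly_varying.
Context {R : realType}.
Implicit Types (a b : R -> R) (rho sigma : R).

(** Regular variation with index rho in the form of Potter's bounds.  The condition does not mention
    measurability and, unlike the pointwise limits in the definition of regular variation, passes
    directly to compositions. *)
Definition uvar (a : R -> R) (rho : R) : Prop :=
  forall e : R, 0 < e -> exists2 X : R, 1 <= X &
    forall x y, X <= x -> X <= y -> 0 < a x /\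
      `|ln (a y) - ln (a x) - rho * (ln y - ln x)| <= e * (1 + `|ln y - ln x|).

Lemma nearyP (P : R -> Prop) : (\forall x \near +oo, P x) <->
  exists2 X : R, 1 <= X & forall x, X <= x -> P x.
Proof.
split=> [[M [_ HM]]|[X _ HX]].
  exists (Num.max 1 (M + 1)); first by rewrite le_max lexx.
  by move=> x; rewrite ge_max => /andP[_ h]; apply: HM; lra.
by exists X; split; rewrite ?num_real// => x /ltW; exact: HX.
Qed.

Lemma uvarI a rho : (forall e : R, 0 < e -> exists X : R,
    forall x y, X <= x -> X <= y -> 0 < a x /\
      `|ln (a y) - ln (a x) - rho * (ln y - ln x)| <= e * (1 + `|ln y - ln x|)) ->
  uvar a rho.
Proof.
move=> H e e0; have [X HX] := H _ e0; exists (Num.max 1 X).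
  by rewrite le_max lexx.
by move=> x y; rewrite !ge_max => /andP[_ ?] /andP[_ ?]; exact: HX.
Qed.

Lemma uvar_gt0 a rho : uvar a rho -> exists2 X, 1 <= X & forall x, X <= x -> 0 < a x.
Proof.
move=> /(_ _ ltr01)[X X1 HX]; exists X => // x Xx.
by have [] := HX x x Xx Xx.
Qed.

(** The uniform convergence theorem is applied to ln a(x) - rho ln x, where the argument is first
    cut off below so that the function is defined and measurable on the whole line. *)
Lemma uvar_of_log (x0 : R) a rho : measurable_fun `[x0, +oo[ a ->
  (forall x, x0 <= x -> 0 < a x) ->
  (forall l : R, 0 < l -> ln (a (l * x)) - ln (a x) @[x --> +oo] --> rho * ln l) ->
  uvar a rho.
Proof.
move=> ma a0 cvga e e0.
pose x1 := Num.max x0 1.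
have x1ge1 : 1 <= x1 by rewrite le_max lexx orbT.
have x1x0 : x0 <= x1 by rewrite le_max lexx.
clearbody x1.
pose m x := Num.max x x1.
have mm : measurable_fun setT m by apply: measurable_maxr.
pose L x := ln (a (m x)) - rho * ln (m x).
have mL : measurable_fun setT L.
  apply: measurable_funB.
    apply: measurableT_comp => //.
    apply: (@measurable_comp _ _ _ _ _ _ `[x0, +oo[) => //.
    by move=> _ [x _ <-] /=; rewrite in_itv/= andbT le_max x1x0 orbT.
  by apply: measurable_funM => //; apply: measurableT_comp.
have cvgL l : 0 < l -> L (l * x) - L x @[x --> +oo] --> (0 : R).
  move=> l0.
  have : ln (a (l * x)) - ln (a x) - rho * ln l @[x --> +oo] --> rho * ln l - rho * ln l.
    by apply: cvgB; [exact: cvga|exact: cvg_cst].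
  rewrite subrr; apply: cvg_trans; apply: near_eq_cvg.
  apply/nearyP; exists (Num.max x1 (x1 / l)); first by rewrite le_max x1ge1.
  move=> x; rewrite ge_max ler_pdivrMr// => /andP[xx1 xl].
  rewrite /L /m !max_l//; last by rewrite mulrC.
  by rewrite lnM ?posrE//; [ring|lra].
have [X X1 HX] := uniform_of_pointwise mL cvgL e0.
exists (Num.max X x1); first by rewrite le_max X1.
move=> x y; rewrite !ge_max => /andP[Xx x1x] /andP[Xy x1y].
split; first exact: a0 (le_trans x1x0 x1x).
have := HX x y Xx Xy; rewrite /L /m !max_l//; apply: le_trans.
by rewrite le_eqVlt; apply/orP; left; apply/eqP; congr `|_|; ring.
Qed.

Lemma rv_uvar x0 a rho : regularly_varying_from x0 a rho -> uvar a rho.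
Proof.
move=> [ma a0 cvga]; apply: (uvar_of_log ma a0) => l l0.
have l0' : 0 < l `^ rho by rewrite powR_gt0.
rewrite -ln_powR; have : ln (a (l * x) / a x) @[x --> +oo] --> ln (l `^ rho).
  by apply: continuous_cvg; [exact: continuous_ln|exact: cvga].
apply: cvg_trans; apply: near_eq_cvg.
apply/nearyP; exists (Num.max 1 (Num.max x0 (x0 / l))); first by rewrite le_max lexx.
move=> x; rewrite !ge_max ler_pdivrMr// => /and3P[x1 xx1 xl].
by rewrite ln_div ?posrE ?a0// mulrC.
Qed.

Lemma uvar_rv a rho (x0 : R) : uvar a rho -> measurable_fun `[x0, +oo[ a ->
  regularly_varying a rho.
Proof.
move=> ua ma; have [X X1 HX] := uvar_gt0 ua.
exists (Num.max X x0); split.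
- apply: measurable_funS ma => // x /=.
  by rewrite !in_itv/= !andbT ge_max => /andP[].
- by move=> t; rewrite ge_max => /andP[? _]; exact: HX.
move=> l l0.
have H : ln (a (l * x)) - ln (a x) @[x --> +oo] --> rho * ln l.
  apply/cvgrPdist_le => e e0.
  have n0 : 0 < 1 + `|ln l| by rewrite ltr_pwDl.
  have [Y Y1 HY] := ua (e / (1 + `|ln l|)) (divr_gt0 e0 n0).
  apply/nearyP; exists (Num.max Y (Y / l)); first by rewrite le_max Y1.
  move=> x; rewrite ge_max ler_pdivrMr// => /andP[xY]; rewrite mulrC => lxY.
  have [_] := HY _ _ xY lxY.
  rewrite lnM ?posrE//; last by lra.
  rewrite (_ : ln l + ln x - ln x = ln l); last by ring.
  by rewrite divfK ?gt_eqF ?ltr_pwDl// distrC.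
have : expR (ln (a (l * x)) - ln (a x)) @[x --> +oo] --> expR (rho * ln l).
  by apply: continuous_cvg; [exact: continuous_expR|exact: H].
rewrite /powR gt_eqF//; apply: cvg_trans; apply: near_eq_cvg.
apply/nearyP; exists (Num.max X (X / l)); first by rewrite le_max X1.
move=> x; rewrite ge_max ler_pdivrMr// => /andP[xX]; rewrite mulrC => lxX.
by rewrite expRB !lnK ?posrE ?HX.
Qed.

(** Convergence of ln b - ln a, to any limit, perturbs the defining estimate by arbitrarily little. *)
Lemma uvar_close a b rho (l : R) : uvar a rho -> (\forall x \near +oo, 0 < b x) ->
  ln (b x) - ln (a x) @[x --> +oo] --> l -> uvar b rho.
Proof.
move=> ua /nearyP[X0 _ b0] cvg; apply: uvarI => e e0.
have [X X1 HX] := ua (e / 2) ltac:(lra).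
move/cvgrPdist_le : cvg => /(_ (e / 4) ltac:(lra)) /nearyP[Y _ HY].
exists (Num.max X0 (Num.max X Y)) => x y.
rewrite !ge_max => /and3P[? Xx Yx] /and3P[? Xy Yy]; split; first exact: b0.
have [_] := HX _ _ Xx Xy; have := HY _ Yx; have := HY _ Yy.
have := normr_ge0 (ln y - ln x).
move: `|ln y - ln x| => t t0; rewrite !ler_norml => /andP[? ?] /andP[? ?] /andP[? ?].
apply/andP; split; nra.
Qed.

Lemma uvar_ext a b rho : (\forall x \near +oo, a x = b x) -> uvar a rho -> uvar b rho.
Proof.
move=> /nearyP[X _ HX] ua; apply: uvarI => e e0; have [Y _ HY] := ua _ e0.
exists (Num.max X Y) => x y; rewrite !ge_max => /andP[? ?] /andP[? ?].
by rewrite -!HX//; exact: HY.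
Qed.

Lemma uvar_id : uvar (fun x : R => x) 1.
Proof.
move=> e e0; exists 1 => // x y x1 y1; split; first by lra.
by rewrite mul1r subrr normr0 mulr_ge0 ?addr_ge0// ltW.
Qed.

Lemma uvar_cst (c : R) : 0 < c -> uvar (fun=> c) 0.
Proof.
move=> c0 e e0; exists 1 => // x y x1 y1; split => //.
by rewrite mul0r !subrr normr0 mulr_ge0 ?addr_ge0// ltW.
Qed.

Lemma uvarM a b rho sigma : uvar a rho -> uvar b sigma ->
  uvar (fun x => a x * b x) (rho + sigma).
Proof.
move=> ua ub; apply: uvarI => e e0.
have [X _ HX] := ua (e / 2) ltac:(lra); have [Y _ HY] := ub (e / 2) ltac:(lra).
exists (Num.max X Y) => x y; rewrite !ge_max => /andP[Xx Yx] /andP[Xy Yy].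
have [ax Ha] := HX _ _ Xx Xy; have [ay _] := HX _ _ Xy Xx.
have [bx Hb] := HY _ _ Yx Yy; have [by_ _] := HY _ _ Yy Yx.
split; first exact: mulr_gt0.
rewrite !lnM ?posrE//; move: Ha Hb; move: `|ln y - ln x| => t.
rewrite !ler_norml => /andP[? ?] /andP[? ?]; apply/andP; split; lra.
Qed.

Lemma uvarV a rho : uvar a rho -> uvar (fun x => (a x)^-1) (- rho).
Proof.
move=> ua; apply: uvarI => e e0; have [X _ HX] := ua _ e0.
exists X => x y Xx Xy; have [ax Ha] := HX _ _ Xx Xy; have [ay _] := HX _ _ Xy Xx.
split; first by rewrite invr_gt0.
rewrite !lnV ?posrE//; apply: le_trans Ha.
by rewrite le_eqVlt -normrN; apply/orP; left; apply/eqP; congr `|_|; ring.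
Qed.

Lemma ler_expRM (M x y : R) : 0 < x -> 0 < y -> (x <= expR M * y) = (ln x <= ln y + M).
Proof.
by move=> x0 y0; rewrite -[in LHS](lnK x0) -[in LHS](lnK y0) -expRD ler_expR addrC.
Qed.

Lemma expRM_ler (M x y : R) : 0 < x -> 0 < y -> (expR M * x <= y) = (ln x + M <= ln y).
Proof.
by move=> x0 y0; rewrite -[in LHS](lnK x0) -[in LHS](lnK y0) -expRD ler_expR addrC.
Qed.

Lemma ln_sqrt (x : R) : 0 < x -> ln (Num.sqrt x) = ln x / 2.
Proof. by move=> x0; rewrite -powR12_sqrt ?ltW// ln_powR mulrC. Qed.

Lemma uvar_sqrt a rho : uvar a rho -> uvar (fun x => Num.sqrt (a x)) (rho / 2).
Proof.
move=> ua; apply: uvarI => e e0; have [X _ HX] := ua _ e0.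
exists X => x y Xx Xy; have [ax Ha] := HX _ _ Xx Xy; have [ay _] := HX _ _ Xy Xx.
split; first by rewrite sqrtr_gt0.
rewrite !ln_sqrt//; move: Ha (normr_ge0 (ln y - ln x)); move: `|ln y - ln x| => t.
rewrite !ler_norml => /andP[? ?] ?; apply/andP; split; nra.
Qed.

(** Lets an index be computed by unification and adjusted afterwards by a field identity. *)
Lemma uvar_eqind a rho sigma : rho = sigma -> uvar a rho -> uvar a sigma.
Proof. by move=> ->. Qed.

Lemma uvar_ge a rho : 0 < rho -> uvar a rho ->
  exists2 X, 1 <= X & exists c : R, forall x, X <= x ->
    0 < a x /\ rho / 2 * ln x + c <= ln (a x).
Proof.
move=> r0 ua; have [X X1 HX] := ua (rho / 2) ltac:(lra).
exists X => //; exists (ln (a X) - rho / 2 - rho / 2 * ln X) => x Xx.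
have [_ H] := HX _ _ (lexx X) Xx.
have [-> _] := HX _ _ Xx Xx; split => //.
have l0 : 0 <= ln x - ln X by rewrite subr_ge0 ler_ln ?posrE; lra.
move: H; rewrite (ger0_norm l0) ler_norml => /andP[? ?]; nra.
Qed.

Lemma ln_pinfty : @ln R x @[x --> +oo] --> +oo.
Proof.
apply/cvgryPge => A; apply/nearyP; exists (Num.max 1 (expR A)).
  by rewrite le_max lexx.
move=> x; rewrite ge_max => /andP[x1 xA].
by rewrite -[A]expRK ler_ln// posrE ?expR_gt0//; lra.
Qed.

Lemma pinfty_of_ln (f : R -> R) : (\forall x \near +oo, 0 < f x) ->
  ln (f x) @[x --> +oo] --> +oo -> f x @[x --> +oo] --> +oo.
Proof.
move=> /nearyP[X _ HX] /cvgryPge H; apply/cvgryPge => A.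
have /nearyP[Y Y1 HY] := H (ln (Num.max A 1)).
apply/nearyP; exists (Num.max X Y); first by rewrite le_max Y1 orbT.
move=> x; rewrite ge_max => /andP[/HX fx /HY].
rewrite ler_ln ?posrE//; last by rewrite lt_max ltr01 orbT.
by rewrite ge_max => /andP[].
Qed.

Lemma uvar_pinfty a rho : 0 < rho -> uvar a rho -> a x @[x --> +oo] --> +oo.
Proof.
move=> r0 /(uvar_ge r0)[X X1 [c Hc]]; apply: pinfty_of_ln.
  by apply/nearyP; exists X => // x /Hc[].
apply/cvgryPge => A.
have /cvgryPge/(_ ((A - c) / (rho / 2)))/nearyP[Y Y1 HY] := ln_pinfty.
apply/nearyP; exists (Num.max X Y); first by rewrite le_max Y1 orbT.
move=> x; rewrite ge_max => /andP[/Hc[_ h] /HY].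
rewrite ler_pdivrMr; lra.
Qed.

Let comp_bound (e e1 e2 tB tD tr ts u v : R) :
  0 < e1 -> 0 < e2 -> 0 <= tD -> 0 <= tr ->
  u <= e1 * (1 + tB) -> v <= e2 * (1 + tD) -> tB <= ts * tD + 1 + tD ->
  0 <= ts -> e1 * (ts + 2) = e / 2 -> (tr + 1) * e2 <= e / 2 ->
  u + tr * v <= e * (1 + tD).
Proof.
move=> e10 e20 D0 r0 hu hv hB s0 he1 he2.
have h1 : e1 * (1 + tB) <= e1 * ((ts + 2) * (1 + tD)) by rewrite ler_pM2l//; nra.
have h2 : tr * v <= tr * (e2 * (1 + tD)) by exact: ler_wpM2l.
have h3 : (tr + 1) * e2 * (1 + tD) <= e / 2 * (1 + tD) by apply: ler_wpM2r => //; lra.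
have h4 : 0 <= e2 * (1 + tD) by rewrite mulr_ge0//; lra.
by rewrite mulrA he1 in h1; lra.
Qed.

Lemma uvar_comp a b rho sigma : uvar a rho -> uvar b sigma ->
  b x @[x --> +oo] --> +oo -> uvar (fun x => a (b x)) (rho * sigma).
Proof.
move=> ua ub boo; apply: uvarI => e e0.
have r1 : 0 < `|rho| + 1 by rewrite ltr_wpDl.
have s2 : 0 < `|sigma| + 2 by rewrite ltr_wpDl.
pose e2 := Num.min 1 (e / 2 / (`|rho| + 1)).
have e20 : 0 < e2 by rewrite lt_min ltr01 !divr_gt0.
pose e1 := e / 2 / (`|sigma| + 2).
have e10 : 0 < e1 by rewrite !divr_gt0.
have [X _ HX] := ua _ e10; have [Y _ HY] := ub _ e20.
have /nearyP[Z _ HZ] : \forall x \near +oo, X <= b x by move/cvgryPge : boo; exact.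
exists (Num.max Y Z) => x y; rewrite !ge_max => /andP[Yx /HZ Xx] /andP[Yy /HZ Xy].
have [ax] := HX _ _ Xx Xy; have [bx] := HY _ _ Yx Yy.
set B := ln (b y) - ln (b x); set D := ln y - ln x => HB HA; split => //.
have hB : `|B| <= `|sigma| * `|D| + 1 + `|D|.
  rewrite [in leLHS](_ : B = (B - sigma * D) + sigma * D); last by ring.
  apply: le_trans (ler_normD _ _) _; rewrite normrM -[leRHS]addrA [leLHS]addrC lerD2l.
  apply: (le_trans HB); rewrite -[leRHS]mul1r; apply: ler_wpM2r => //.
  by rewrite /e2 ge_min lexx.
rewrite (_ : _ - _ - _ = (ln (a (b y)) - ln (a (b x)) - rho * B) + rho * (B - sigma * D));
  last by rewrite /B; ring.
apply: le_trans (ler_normD _ _) _; rewrite normrM.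
apply: comp_bound e10 e20 _ _ HA HB hB _ _ _ => //.
  by rewrite /e1 divfK// gt_eqF.
by rewrite mulrC -ler_pdivlMr// /e2 ge_min lexx orbT.
Qed.

Let of_comp_bound (rho e e1 e2 K tB tD ts : R) :
  0 < rho -> 0 < e1 -> 0 <= tD -> 0 <= tB -> 0 <= ts ->
  e1 <= 1 -> e1 <= rho / 2 -> e1 * (1 + 2 / rho * (ts + 2)) <= rho * e / 2 ->
  e2 <= 1 -> e2 <= rho * e / 2 ->
  rho * tB <= ts * tD + e1 * (1 + tB) + e2 * (1 + tD) ->
  e1 * (1 + tB) + e2 * (1 + tD) <= e * (1 + tD) * rho.
Proof.
move=> r0 e10 D0 B0 s0 e11 e1r e1K e21 e2e H.
have D1 : 0 <= 1 + tD by lra.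
have a1 : e1 * tB <= rho / 2 * tB by exact: ler_wpM2r.
have a2 : e2 * (1 + tD) <= 1 * (1 + tD) by exact: ler_wpM2r.
have a3 : tB <= 2 / rho * (ts + 2) * (1 + tD).
  rewrite (_ : _ * _ = (2 * (ts + 2) * (1 + tD)) / rho); last by ring.
  by rewrite ler_pdivlMr//; lra.
have a4 : e1 * (1 + tB) <= e1 * ((1 + 2 / rho * (ts + 2)) * (1 + tD)).
  by rewrite ler_pM2l//; lra.
have a5 := ler_wpM2r D1 e1K; have a6 := ler_wpM2r D1 e2e.
rewrite mulrA in a4; lra.
Qed.
(** The inner function of a composition inherits its regular variation from the composite and the outer
    function, provided the outer index is positive: this makes inverses regularly varying. *)
Lemma uvar_of_comp a b rho sigma : 0 < rho -> uvar a rho ->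
  b x @[x --> +oo] --> +oo -> uvar (fun x => a (b x)) sigma -> uvar b (sigma / rho).
Proof.
move=> r0 ua boo uab; apply: uvarI => e e0.
have s0 := normr_ge0 sigma.
pose e2 := Num.min 1 (rho * e / 2).
have e20 : 0 < e2 by rewrite lt_min ltr01 !divr_gt0// mulr_gt0.
pose K := 1 + 2 / rho * (`|sigma| + 2).
have rV : 0 < rho^-1 by rewrite invr_gt0.
have K0 : 0 < K by rewrite /K addr_gt0// mulr_gt0 ?divr_gt0// ltr_wpDl.
pose e1 := Num.min 1 (Num.min (rho / 2) (rho * e / 2 / K)).
have e10 : 0 < e1 by rewrite !lt_min ltr01 !divr_gt0// mulr_gt0.
have [X _ HX] := ua _ e10; have [Y _ HY] := uab _ e20.
have /nearyP[Z _ HZ] : \forall x \near +oo, Num.max 1 X <= b x by move/cvgryPge : boo; exact.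
exists (Num.max Y Z) => x y; rewrite !ge_max => /andP[Yx /HZ] + /andP[Yy /HZ].
rewrite !ge_max => /andP[bx1 Xx] /andP[by1 Xy].
have [ax HA] := HX _ _ Xx Xy; have [_ HB] := HY _ _ Yx Yy.
split; first by lra.
move: HA HB; set A := ln (a (b y)) - ln (a (b x)).
set B := ln (b y) - ln (b x); set D := ln y - ln x => HA HB.
have e1_1 : e1 <= 1 by rewrite /e1 ge_min lexx.
have e1_r : e1 <= rho / 2 by rewrite /e1 !ge_min lexx orbT.
have e1_K : e1 * K <= rho * e / 2 by rewrite -ler_pdivlMr// /e1 !ge_min lexx !orbT.
have e2_1 : e2 <= 1 by rewrite /e2 ge_min lexx.
have e2_e : e2 <= rho * e / 2 by rewrite /e2 ge_min lexx orbT.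
have H1 : `|rho * B - sigma * D| <= e1 * (1 + `|B|) + e2 * (1 + `|D|).
  rewrite (_ : _ - _ = (A - sigma * D) - (A - rho * B)); last by ring.
  by rewrite (le_trans (ler_normB _ _))// addrC lerD.
have H2 : rho * `|B| <= `|sigma| * `|D| + e1 * (1 + `|B|) + e2 * (1 + `|D|).
  rewrite -{1}(gtr0_norm r0) -!normrM.
  rewrite (_ : rho * B = (rho * B - sigma * D) + sigma * D); last by ring.
  by rewrite (le_trans (ler_normD _ _))// addrC -addrA lerD2l.
rewrite (_ : B - _ = (rho * B - sigma * D) / rho); last first.
  by field; rewrite gt_eqF.
rewrite normrM (gtr0_norm rV) ler_pdivrMr//; apply: (le_trans H1).
exact: of_comp_bound r0 e10 _ _ _ e1_1 e1_r e1_K e2_1 e2_e H2.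
Qed.

(** Potter's bound is an inequality between the values at two points, and such inequalities add up for
    functions of the same index. *)
Lemma uvarD (a b : R -> R) rho : uvar a rho -> uvar b rho -> uvar (fun x => a x + b x) rho.
Proof.
move=> ua ub; apply: uvarI => e e0.
have [X _ HX] := ua _ e0; have [Y _ HY] := ub _ e0.
have key (x y : R) : Num.max X Y <= x -> Num.max X Y <= y -> [/\ 0 < a x + b x, 0 < a y + b y &
    ln (a y + b y) <= ln (a x + b x) + (rho * (ln y - ln x) + e * (1 + `|ln y - ln x|))].
  rewrite !ge_max => /andP[Xx Yx] /andP[Xy Yy].
  have [ax Ha] := HX _ _ Xx Xy; have [ay _] := HX _ _ Xy Xx.
  have [bx Hb] := HY _ _ Yx Yy; have [by_ _] := HY _ _ Yy Yx.
  split; [exact: addr_gt0|exact: addr_gt0|].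
  move: Ha Hb; set K := rho * _ + _; rewrite !ler_norml => /andP[_ Ha] /andP[_ Hb].
  have bound (u v : R) : 0 < u -> 0 < v -> ln v <= ln u + K -> v <= expR K * u.
    by move=> u0 v0 h; rewrite -[v]lnK// -[u]lnK// -expRD ler_expR addrC.
  have ha : a y <= expR K * a x by apply: bound => //; rewrite /K; lra.
  have hb : b y <= expR K * b x by apply: bound => //; rewrite /K; lra.
  have s1 : 0 < a x + b x by exact: addr_gt0.
  have s2 : 0 < a y + b y by exact: addr_gt0.
  have h : a y + b y <= expR K * (a x + b x) by rewrite mulrDr lerD.
  have K0 : 0 < expR K by exact: expR_gt0.
  have : ln (a y + b y) <= ln (expR K * (a x + b x)) by rewrite ler_ln ?posrE//; exact: mulr_gt0.
  by rewrite (@lnM _ (expR K)) ?posrE// expRK [K + _]addrC.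
exists (Num.max X Y) => x y hx hy; have [p1 p2 h1] := key x y hx hy.
have [_ _ h2] := key y x hy hx; split => //.
by rewrite distrC in h2; rewrite ler_norml; apply/andP; split; lra.
Qed.

End uniformly_varying.

(** * Potter bounds and asymptotic inverses *)

Section potter.
Context {R : realType}.
Implicit Types (a b u v : R -> R) (rho sigma : R).

(** What is needed to extend estimates valid for large arguments to the whole half-line. *)
Definition locbd a : Prop := (forall x, 1 <= x -> 0 < a x) /\
  forall X : R, exists M : R, forall x, 1 <= x <= X -> `|ln (a x)| <= M.

Lemma locbdM a b : locbd a -> locbd b -> locbd (fun x => a x * b x).
Proof.
move=> [a0 Ha] [b0 Hb]; split=> [x x1|X]; first by rewrite mulr_gt0 ?a0 ?b0.
have [M HM] := Ha X; have [N HN] := Hb X; exists (M + N) => x /[dup] /andP[x1 _] xX.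
rewrite lnM ?posrE ?a0 ?b0// (le_trans (ler_normD _ _))// lerD ?HM ?HN//.
Qed.

Lemma locbdV a : locbd a -> locbd (fun x => (a x)^-1).
Proof.
move=> [a0 Ha]; split=> [x x1|X]; first by rewrite invr_gt0 a0.
have [M HM] := Ha X; exists M => x /[dup] /andP[x1 _] xX.
by rewrite lnV ?posrE ?a0// normrN HM.
Qed.

Lemma locbd_sqrt a : locbd a -> locbd (fun x => Num.sqrt (a x)).
Proof.
move=> [a0 Ha]; split=> [x x1|X]; first by rewrite sqrtr_gt0 a0.
have [M HM] := Ha X; exists M => x /[dup] /andP[x1 _] xX.
have := HM x xX; rewrite ln_sqrt ?a0//.
move: (ln (a x)) => t; rewrite !ler_norml => /andP[? ?]; apply/andP; split; lra.
Qed.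

Lemma locbd_id : locbd (fun x : R => x).
Proof.
split=> [x x1|X]; first by lra.
exists (ln X) => x /andP[x1 xX].
by rewrite ger0_norm ?ln_ge0// ler_ln ?posrE; lra.
Qed.

Lemma locbd_cst (c : R) : 0 < c -> locbd (fun=> c).
Proof. by move=> c0; split=> // X; exists `|ln c|. Qed.

Lemma locbd_asymp a : (forall x, 1 <= x -> 0 < a x) -> locally_asymp_one a -> locbd a.
Proof.
move=> a0 H; split=> // X.
have [] := H `[1, X]%classic (@segment_compact R 1 X).
  by move=> x /=; rewrite !in_itv/= andbT => /andP[].
move=> [c c0 Hc] [d d0 Hd]; exists (Num.max (ln c) (ln d)) => x /[dup] /andP[x1 _] xX.
have xin : `[1, X]%classic x by rewrite /= in_itv.
have {}Hc := Hc _ xin; have {}Hd := Hd _ xin; have ax := a0 x x1.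
rewrite ler_norml -[- Num.max _ _]opprK lerNl opprK le_max [X in _ && X]le_max.
apply/andP; split; apply/orP; [right|left].
  have : 0 <= ln (d * a x) by apply: ln_ge0.
  by rewrite lnM ?posrE//; lra.
by rewrite ler_ln ?posrE//; lra.
Qed.

(** Arguments below the threshold of [uvar] are moved up to it, which changes every term by at most
    a constant. *)
Lemma global_potter a rho (e : R) : locbd a -> uvar a rho -> 0 < e ->
  exists2 M : R, 0 <= M & forall x y, 1 <= x -> 1 <= y ->
    `|ln (a y) - ln (a x) - rho * (ln y - ln x)| <= M + e * `|ln y - ln x|.
Proof.
move=> [a0 la] ua e0; have [X X1 HX] := ua _ e0; have [M HM] := la X.
have lX0 : 0 <= ln X by apply: ln_ge0.
have M0 : 0 <= M by apply: le_trans (HM 1 _); rewrite ?normr_ge0// lexx.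
pose p x := Num.max x X.
have Hp x : 1 <= x -> [/\ X <= p x, `|ln (a x) - ln (a (p x))| <= 2 * M &
    `|ln x - ln (p x)| <= ln X].
  move=> x1; rewrite /p; case: (leP x X) => [xX|/ltW Xx].
    split=> //.
      apply: le_trans (ler_normB _ _) _.
      by rewrite mulr_natl mulr2n lerD// HM ?x1 ?X1 ?lexx.
    have := ln_ge0 x1; have : ln x <= ln X by rewrite ler_ln ?posrE; lra.
    rewrite ler_norml => ? ?; apply/andP; split; lra.
  by rewrite !subrr normr0; split=> //; rewrite mulr_ge0.
exists (4 * M + e * (1 + 2 * ln X) + `|rho| * (2 * ln X)).
  have := normr_ge0 rho; nra.
move=> x y x1 y1; have [px hx1 hx2] := Hp _ x1; have [py hy1 hy2] := Hp _ y1.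
have [_] := HX _ _ px py; set A' := ln (a (p y)) - _; set B' := ln (p y) - _ => HAB.
set B := ln y - ln x.
have hB : `|B' - B| <= 2 * ln X.
  rewrite (_ : B' - B = (ln x - ln (p x)) - (ln y - ln (p y))); last by rewrite /B' /B; ring.
  by rewrite (le_trans (ler_normB _ _))// mulr_natl mulr2n lerD.
have hB' : `|B'| <= `|B| + 2 * ln X.
  rewrite -lerBlDl; apply: le_trans hB; exact: lerB_dist.
rewrite (_ : _ - _ = (A' - rho * B') + rho * (B' - B) +
   ((ln (a y) - ln (a (p y))) - (ln (a x) - ln (a (p x))))); last by rewrite /A'; ring.
apply: le_trans (ler_normD _ _) _.
have h1 : `|ln (a y) - ln (a (p y)) - (ln (a x) - ln (a (p x)))| <= 4 * M.
  by apply: le_trans (ler_normB _ _) _; lra.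
apply: le_trans (lerD (ler_normD _ _) h1) _; rewrite normrM.
have h2 : `|rho| * `|B' - B| <= `|rho| * (2 * ln X) by apply: ler_wpM2l.
have h3 : e * (1 + `|B'|) <= e * (1 + 2 * ln X) + e * `|B| by nra.
lra.
Qed.

Lemma uvar_unique a rho sigma : uvar a rho -> uvar a sigma -> rho = sigma.
Proof.
move=> ua ub; apply/eqP; rewrite -subr_eq0 -normr_le0; apply/ler_addgt0Pl => e e0.
rewrite addr0.
have e4 : 0 < e / 4 by lra.
have [X X1 HX] := ua _ e4; have [Y Y1 HY] := ub _ e4.
pose x := Num.max X Y; pose y := expR 1 * x.
have x1 : 1 <= x by rewrite le_max X1.
have xX : X <= x by rewrite le_max lexx.
have xY : Y <= x by rewrite le_max lexx orbT.
have e1 : 1 <= expR (1 : R) by rewrite -expR0 ler_expR.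
have yx : x <= y by rewrite /y ler_peMl//; lra.
have lyx : ln y - ln x = 1.
  by rewrite /y lnM ?posrE ?expR_gt0//; [rewrite expRK; ring|lra].
have [_] := HX x y xX (le_trans xX yx); have [_] := HY x y xY (le_trans xY yx).
rewrite lyx normr1 !mulr1 !ler_norml => /andP[? ?] /andP[? ?].
apply/andP; split; lra.
Qed.

(** A function of positive index is asymptotically injective. *)
Lemma ln_near_of_uvar a rho u v : 0 < rho -> uvar a rho ->
  u x @[x --> +oo] --> +oo -> v x @[x --> +oo] --> +oo ->
  ln (a (u x)) - ln (a (v x)) @[x --> +oo] --> 0 ->
  ln (u x) - ln (v x) @[x --> +oo] --> 0.
Proof.
move=> r0 ua uoo voo H; apply/cvgrPdist_le => e e0.
pose d := Num.min (rho / 2) (rho * e / 4).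
have d0 : 0 < d by rewrite lt_min !divr_gt0// mulr_gt0.
have d1 : d <= rho / 2 by rewrite /d ge_min lexx.
have d2 : d <= rho * e / 4 by rewrite /d ge_min lexx orbT.
have [X X1 HX] := ua _ d0.
move/cvgrPdist_le : H => /(_ _ d0) H.
move/cvgryPge : uoo => /(_ X) Hu; move/cvgryPge : voo => /(_ X) Hv.
near=> x.
have vx : X <= v x by near: x.
have ux : X <= u x by near: x.
have [_] := HX _ _ vx ux.
have : `|0 - (ln (a (u x)) - ln (a (v x)))| <= d by near: x.
rewrite !sub0r !normrN.
set A := ln (a (u x)) - _; set B := ln (u x) - _ => HA HB.
have : rho * `|B| <= d + d * (1 + `|B|).
  rewrite -{1}(gtr0_norm r0) -normrM.
  rewrite (_ : rho * B = A - (A - rho * B)); last by ring.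
  by rewrite (le_trans (ler_normB _ _))// lerD.
have := normr_ge0 B; nra.
Unshelve. all: by end_near. Qed.

(** A function of positive index reflects inequalities up to constants. *)
Lemma ln_le_of_uvar a rho u v (M : R) : 0 < rho -> uvar a rho ->
  u x @[x --> +oo] --> +oo -> v x @[x --> +oo] --> +oo ->
  (\forall x \near +oo, ln (a (u x)) <= ln (a (v x)) + M) ->
  exists M', \forall x \near +oo, ln (u x) <= ln (v x) + M'.
Proof.
move=> r0 ua uoo voo H; exists (2 / rho * (`|M| + rho / 2)).
have [X X1 HX] := ua (rho / 2) ltac:(lra).
move/cvgryPge : uoo => /(_ X) Hu; move/cvgryPge : voo => /(_ X) Hv.
near=> x.
have vx : X <= v x by near: x.
have ux : X <= u x by near: x.
have [_] := HX _ _ vx ux.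
have : ln (a (u x)) <= ln (a (v x)) + M by near: x.
set A := ln (a (u x)); set B := ln (u x) - _ => HA.
rewrite ler_norml => /andP[H1 H2]; rewrite -lerBlDl -/B.
have M0 := ler_norm M; have M1 := normr_ge0 M.
have [B0|/ltW B0] := leP 0 B; last first.
  by apply: le_trans B0 _; rewrite mulr_ge0// ?divr_ge0//; lra.
rewrite (ger0_norm B0) in H1 H2.
rewrite mulrAC ler_pdivlMr//; nra.
Unshelve. all: by end_near. Qed.

(** If a tends to infinity, ln is eventually Lipschitz with small constant at the values ln a(x);
    if the index is 0, the increments of ln a are already small. *)
Lemma uvar_ln a rho (c : R) : 0 <= rho -> 1 < c -> uvar a rho ->
  (\forall x \near +oo, c <= a x) -> uvar (fun x => ln (a x)) 0.
Proof.
move=> r0 c1 ua Hc; apply: uvarI => e e0.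
have lc : 0 < ln c by rewrite ln_gt0.
have key : exists2 d : R, 0 < d & exists2 W, 0 < W & (d + rho <= e * W) /\
    \forall x \near +oo, W <= ln (a x).
  case: (ltgtP 0 rho) r0 => // [rp _|<- _].
    exists 1 => //; exists ((1 + rho) / e); first by rewrite divr_gt0//; lra.
    split; first by rewrite mulrC divfK// gt_eqF.
    have /cvgryPge/(_ (expR ((1 + rho) / e))) := uvar_pinfty rp ua.
    apply: filterS => x h; rewrite -[X in X <= _]expRK ler_ln// posrE ?expR_gt0//.
    by apply: lt_le_trans h; rewrite expR_gt0.
  exists (e * ln c); first exact: mulr_gt0.
  exists (ln c) => //; split; first by rewrite addr0.
  by apply: filterS Hc => x h; rewrite ler_ln ?posrE//; lra.
have [d d0 [W W0 [dW HW]]] := key.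
have [X _ HX] := ua _ d0; move/nearyP : HW => [Y _ HY].
exists (Num.max X Y) => x y; rewrite !ge_max => /andP[Xx Yx] /andP[Xy Yy].
have [ax HA] := HX _ _ Xx Xy; have [ay _] := HX _ _ Xy Xx.
have wx := HY _ Yx; have wy := HY _ Yy; split; first exact: lt_le_trans wx.
rewrite mul0r subr0.
have lnlip s t : W <= s -> W <= t -> ln t - ln s <= `|t - s| / W.
  move=> Ws Wt; have s0 : 0 < s by lra.
  rewrite -ln_div ?posrE//; last by lra.
  have := @le_ln1Dx R (t / s - 1); rewrite (_ : 1 + (t / s - 1) = t / s); last by ring.
  move=> /(_ _)/le_trans; apply.
    by rewrite ltrBrDl subrr divr_gt0//; lra.
  rewrite (_ : t / s - 1 = (t - s) / s); last by field; rewrite gt_eqF.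
  apply: (@le_trans _ _ (`|t - s| / s)); first by rewrite ler_pM2r ?invr_gt0// ler_norm.
  by rewrite ler_wpM2l// lef_pV2// posrE.
have main : `|ln (a y) - ln (a x)| / W <= e * (1 + `|ln y - ln x|).
  rewrite ler_pdivrMr// mulrAC.
  move: HA; set A := ln (a y) - _; set B := ln y - _ => HA.
  have : `|A| <= d * (1 + `|B|) + rho * `|B|.
    rewrite -[X in _ + X * _](ger0_norm r0) -normrM.
    rewrite (_ : A = (A - rho * B) + rho * B); last by ring.
    by rewrite (le_trans (ler_normD _ _))// lerD2r.
  have B0 := normr_ge0 B.
  have : (d + rho) * (1 + `|B|) <= e * W * (1 + `|B|) by apply: ler_wpM2r => //; lra.
  nra.
rewrite ler_norml lerNl opprB.
by rewrite !(le_trans _ main)// ?lnlip// distrC lnlip.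
Qed.

Lemma sim_lnP u v : (\forall x \near +oo, 0 < v x) ->
  sim_oo u v -> (\forall x \near +oo, 0 < u x) /\
    ln (u x) - ln (v x) @[x --> +oo] --> 0.
Proof.
move=> v0 H; have u0 : \forall x \near +oo, 0 < u x.
  move/cvgrPdist_lt : (H) => /(_ 1 ltr01) H1.
  near=> x; have vx : 0 < v x by near: x.
  have : `|1 - u x / v x| < 1 by near: x.
  rewrite ltr_norml => /andP[_ h].
  have : 0 < u x / v x by lra.
  by rewrite pmulr_lgt0// invr_gt0.
split=> //; rewrite -(@ln1 R).
have : ln (u x / v x) @[x --> +oo] --> ln (1:R).
  by apply: continuous_cvg; [exact: continuous_ln|exact: H].
apply: cvg_trans; apply: near_eq_cvg; near=> x.
by rewrite ln_div// posrE; near: x.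
Unshelve. all: by end_near. Qed.

Lemma ln_simP u v : (\forall x \near +oo, 0 < v x) -> (\forall x \near +oo, 0 < u x) ->
    ln (u x) - ln (v x) @[x --> +oo] --> 0 -> sim_oo u v.
Proof.
move=> v0 u0 H; rewrite /sim_oo -(@expR0 R).
have : expR (ln (u x) - ln (v x)) @[x --> +oo] --> expR (0:R).
  by apply: continuous_cvg; [exact: continuous_expR|exact: H].
apply: cvg_trans; apply: near_eq_cvg; near=> x.
by rewrite expRB !lnK// posrE; near: x.
Unshelve. all: by end_near. Qed.

Lemma near_ge (X : R) : \forall x \near +oo, X <= x.
Proof. by apply/nearyP; exists (Num.max 1 X) => [|x]; rewrite ?le_max ?lexx// ge_max => /andP[]. Qed.

Lemma cvg_idy : (fun x : R => x) x @[x --> +oo] --> +oo.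
Proof. exact: cvg_id. Qed.

(** The index of an asymptotic inverse is forced by b(a(x)) ~ x and uniqueness of indices. *)
Lemma asymptotic_inverseP a b rho : 0 < rho -> uvar a rho -> asymptotic_inverse a b ->
  [/\ b x @[x --> +oo] --> +oo, uvar b rho^-1,
      ln (a (b x)) - ln x @[x --> +oo] --> 0 &
      exists x0 : R, measurable_fun `[x0, +oo[ b].
Proof.
move=> r0 ua [_ [beta [x0 rvb]] ab ba].
have ub := rv_uvar rvb.
have aoo := uvar_pinfty r0 ua.
have gt0id : \forall x \near +oo, 0 < id x :> R.
  by apply: filterS (near_ge 1) => x /= h; lra.
have [bap hba] := sim_lnP gt0id ba.
have uba : uvar (fun x => b (a x)) 1 by exact: uvar_close (@uvar_id R) bap hba.
have := uvar_unique uba (uvar_comp ub ua aoo) => e1.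
have be : beta = rho^-1.
  by rewrite -[rho^-1]mul1r e1 -mulrA divff ?mulr1// gt_eqF.
rewrite be in ub; have boo : b x @[x --> +oo] --> +oo.
  by apply: uvar_pinfty ub; rewrite invr_gt0.
split=> //; first by have [] := sim_lnP gt0id ab.
by exists x0; case: rvb.
Qed.

Lemma pinfty_near (u : R -> R) (P : R -> Prop) : u x @[x --> +oo] --> +oo ->
  (\forall x \near +oo, P x) -> \forall x \near +oo, P (u x).
Proof. by move=> uoo; exact: uoo. Qed.

Lemma pinfty_ge (u : R -> R) (A : R) : u x @[x --> +oo] --> +oo ->
  \forall x \near +oo, A <= u x.
Proof. by move/cvgryPge. Qed.

End potter.

(** * Generalized inverses *)

Section generalized_inverse.
Context {R : realType}.
Implicit Types (a b : R -> R) (rho : R).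

(** The supremum is taken over initial segments on which a is at most r, as in the definitions of k and
    h; this makes sense for functions that are not monotone. *)
Definition ginv a (r : R) : \bar R :=
  ereal_sup [set t%:E | t in [set t : R | 1 <= t /\ forall s, 1 <= s <= t -> a s <= r]].

Lemma ginv_ge a (X r : R) : 1 <= X -> (forall s, 1 <= s <= X -> a s <= r) ->
  (X%:E <= ginv a r)%E.
Proof. by move=> X1 H; apply: ereal_sup_ubound; exists X. Qed.

Lemma ginv_ge_near a (X : R) : locbd a -> \forall r \near +oo, (X%:E <= ginv a r)%E.
Proof.
move=> [a0 la]; pose Y := Num.max 1 X; have [M HM] := la Y.
apply: filterS (near_ge (expR M)) => r Mr.
apply: (@le_trans _ _ Y%:E); first by rewrite lee_fin le_max lexx orbT.
apply: ginv_ge => [|s sY]; first by rewrite le_max lexx.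
have /andP[s1 _] := sY; apply: le_trans Mr.
rewrite -[leLHS]lnK ?posrE ?a0// ler_expR.
exact: le_trans (ler_norm _) (HM s sY).
Qed.

Lemma ginv_bounded a (r : R) : (forall s, 1 <= s -> a s <= r) -> ginv a r = +oo%E.
Proof.
move=> H; apply/eqyP => x _.
apply: (@le_trans _ _ (Num.max 1 x)%:E); first by rewrite lee_fin le_max lexx orbT.
by apply: ginv_ge => [|s /andP[s1 _]]; [rewrite le_max lexx|exact: H].
Qed.

Lemma ginv_lt a (r s : R) : (s%:E < ginv a r)%E -> 1 <= s -> a s <= r.
Proof.
move=> /ereal_sup_gt[_ [t [t1 Ht] <-]]; rewrite lte_fin => st s1.
by apply: Ht; rewrite s1 ltW.
Qed.

Lemma ginv_gt a (r s : R) : (ginv a r < s%:E)%E -> 1 <= s ->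
  exists2 x : R, 1 <= x <= s & r < a x.
Proof.
move=> h s1; apply: contrapT => H; suff : (s%:E <= ginv a r)%E by rewrite leNgt h.
apply: ginv_ge => // x xs; rewrite leNgt; apply/negP => rx; apply: H; by exists x.
Qed.

Lemma ginv_mono a (r r' : R) : r <= r' -> (ginv a r <= ginv a r')%E.
Proof.
move=> rr'; apply: ereal_sup_le => _ [t [t1 Ht] <-]; exists t => //; split=> // s st.
exact: le_trans (Ht s st) rr'.
Qed.

Definition unbounded a := forall M : R, exists2 x : R, 1 <= x & M < a x.

Lemma unbounded_pinfty a : a x @[x --> +oo] --> +oo -> unbounded a.
Proof.
move=> /cvgryPge H M; have /nearyP[X X1 HX] := H (M + 1).
by exists X => //; have := HX X (lexx X); lra.
Qed.

Lemma ginv_fin_num a (r : R) : unbounded a -> (1%:E <= ginv a r)%E -> ginv a r \is a fin_num.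
Proof.
move=> ub g1; have [x x1 rx] := ub r.
apply: fin_real; rewrite (lt_le_trans (ltNyr 1) g1)/=.
apply: (@le_lt_trans _ _ x%:E); last by rewrite ltry.
by rewrite leNgt; apply/negP => /ginv_lt/(_ x1); rewrite leNgt rx.
Qed.

Lemma ginv_fin a : locbd a -> unbounded a -> \forall r \near +oo,
  ginv a r = (fine (ginv a r))%:E.
Proof.
move=> la ub; apply: filterS (ginv_ge_near 1 la) => r g1.
by rewrite fineK// ginv_fin_num.
Qed.

Lemma ginv_pinfty a : locbd a -> unbounded a -> fine (ginv a r) @[r --> +oo] --> +oo.
Proof.
move=> la ub; apply/cvgryPge => A.
apply: filterS2 (ginv_fin la ub) (ginv_ge_near A la) => r ->.
by rewrite lee_fin.
Qed.

(** Just beyond the supremum a exceeds r somewhere, while just below it a is at most r; by [uvar] the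
    values of a vary little between these points. *)
Lemma ginv_sol a rho : locbd a -> unbounded a -> uvar a rho ->
  ln (a (fine (ginv a r))) - ln r @[r --> +oo] --> 0.
Proof.
move=> la ub ua; apply/cvgrPdist_le => e e0.
have squeeze (p q u v : R) : `|u - p| <= e -> `|v - p| <= e -> q <= u -> v <= q ->
    `|0 - (p - q)| <= e.
  rewrite !ler_norml => /andP[? ?] /andP[? ?] ? ?; apply/andP; split; lra.
have rn : 0 < `|rho| + 2 by rewrite ltr_wpDl.
pose d := Num.min 1 (e / (`|rho| + 2)).
have d0 : 0 < d by rewrite lt_min ltr01 divr_gt0.
have d1 : d <= 1 by rewrite /d ge_min lexx.
have de : d * (`|rho| + 2) <= e by rewrite -ler_pdivlMr// /d ge_min lexx orbT.
have step (A B : R) : `|B| <= d -> `|A - rho * B| <= d * (1 + `|B|) -> `|A| <= e.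
  move=> hB hA; rewrite (_ : A = (A - rho * B) + rho * B); last by ring.
  apply: le_trans (ler_normD _ _) _; rewrite normrM; apply: le_trans de.
  have h1 : d * (1 + `|B|) <= d * 2 by rewrite ler_pM2l//; lra.
  have h2 : `|rho| * `|B| <= `|rho| * d by exact: ler_wpM2l.
  lra.
have [X X1 HX] := ua _ d0.
have X0 : 0 < X by exact: lt_le_trans X1.
pose E := expR d; have E1 : 1 < E by rewrite expR_gt1.
have E0 : 0 < E by exact: expR_gt0.
near=> r.
have gE : ginv a r = (fine (ginv a r))%:E by near: r; exact: ginv_fin.
have : E * X <= fine (ginv a r).
  by near: r; move/cvgryPge : (ginv_pinfty la ub); exact.
have r0 : 0 < r by near: r; exact: nbhs_pinfty_gt.
set x := fine (ginv a r) in gE *; move=> Yx.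
have Xx : X <= x by apply: le_trans Yx; rewrite ler_peMl ?ltW.
have x0 : 0 < x by exact: lt_le_trans Xx.
have xEx : x < E * x by rewrite ltr_pMl.
have aux s : X <= s -> `|ln s - ln x| <= d -> `|ln (a s) - ln (a x)| <= e.
  by move=> Xs sx; have [_ H] := HX _ _ Xx Xs; exact: step sx H.
have [s1 /andP[s11 s1x] rs1] : exists2 s, 1 <= s <= E * x & r < a s.
  apply: ginv_gt; first by rewrite gE lte_fin.
  by apply: le_trans X1 _; apply: le_trans Xx _; exact: ltW.
have xs1 : x <= s1.
  rewrite leNgt; apply/negP => s1x'.
  have : a s1 <= r by apply: ginv_lt => //; rewrite gE lte_fin.
  by rewrite leNgt rs1.
have s10 : 0 < s1 by exact: lt_le_trans xs1.
have H1 : `|ln (a s1) - ln (a x)| <= e.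
  apply: aux; first exact: le_trans xs1.
  rewrite ger0_norm; last by rewrite subr_ge0 ler_ln.
  by rewrite lerBlDl -ler_expRM.
pose s2 := x / E.
have Xs2 : X <= s2 by rewrite ler_pdivlMr// mulrC.
have s2x : s2 < x by rewrite ltr_pdivrMr// mulrC.
have H2 : `|ln (a s2) - ln (a x)| <= e.
  apply: aux => //; rewrite /s2 ln_div ?posrE// expRK.
  by rewrite (_ : _ - _ = - d); [rewrite normrN gtr0_norm|ring].
have as2 : a s2 <= r.
  by apply: ginv_lt; [rewrite gE lte_fin|exact: le_trans Xs2].
have [as20 _] := HX _ _ Xs2 Xs2.
apply: squeeze H1 H2 _ _; first by rewrite ler_ln ?posrE ?ltW// (lt_trans r0).
by rewrite ler_ln ?posrE.
Unshelve. all: by end_near. Qed.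

Lemma uvar_ginv a rho : 0 < rho -> locbd a -> uvar a rho ->
  uvar (fun r => fine (ginv a r)) rho^-1.
Proof.
move=> r0 la ua; have ub := unbounded_pinfty (uvar_pinfty r0 ua).
have goo := ginv_pinfty la ub.
rewrite -[_^-1]mul1r; apply: (uvar_of_comp r0 ua goo).
apply: uvar_close (@uvar_id R) _ (ginv_sol la ub ua).
have [X _ HX] := uvar_gt0 ua.
by move/cvgryPge : goo => /(_ X); apply: filterS => r; exact: HX.
Qed.

Lemma ginv_measurable a : locbd a -> unbounded a ->
  exists x0 : R, measurable_fun `[x0, +oo[ (fun r => fine (ginv a r)).
Proof.
move=> la ub; have [X X1 HX] := iffLR (nearyP _) (ginv_fin la ub).
exists X; pose f r := fine (ginv a (Num.max r X)).
have mf : measurable_fun `[X, +oo[ f.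
  apply: nondecreasing_measurable => // r s rs.
  rewrite /f -lee_fin -!HX ?le_max ?lexx ?orbT//.
  by apply: ginv_mono; rewrite ge_max !le_max rs lexx orbT.
apply: eq_measurable_fun mf => r; rewrite inE/= in_itv/= andbT /f => Xr.
by rewrite max_l.
Qed.

Lemma ginv_rv a rho : 0 < rho -> locbd a -> uvar a rho ->
  regularly_varying (fun r => fine (ginv a r)) rho^-1.
Proof.
move=> r0 la ua; have ub := unbounded_pinfty (uvar_pinfty r0 ua).
have [x0 mx] := ginv_measurable la ub; exact: uvar_rv (uvar_ginv r0 la ua) mx.
Qed.

Lemma asymptotic_inverse_ex a rho : 0 < rho -> locbd a -> uvar a rho ->
  measurable_fun `[(1 : R), +oo[ a -> exists b : R -> R, asymptotic_inverse a b.
Proof.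
move=> r0 la ua ma; have aoo := uvar_pinfty r0 ua.
have ub := unbounded_pinfty aoo.
have goo := ginv_pinfty la ub.
have gt0id : \forall x \near +oo, 0 < id x :> R.
  by apply: filterS (near_ge 1) => x /= h; lra.
have [X _ HX] := uvar_gt0 ua.
have sol := ginv_sol la ub ua.
exists (fun r => fine (ginv a r)); split.
- by exists rho => //; exact: uvar_rv ma.
- by exists rho^-1; exact: ginv_rv.
- apply: ln_simP => //.
  by move/cvgryPge : goo => /(_ X); apply: filterS => r; exact: HX.
- have gaoo : fine (ginv a (a x)) @[x --> +oo] --> +oo by exact: cvg_comp aoo goo.
  apply: ln_simP => //.
    by move/cvgryPge : gaoo => /(_ 1); apply: filterS => r; lra.
  apply: (ln_near_of_uvar r0 ua gaoo (@cvg_idy R)).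
  exact: (cvg_comp _ _ aoo sol).
Qed.

Lemma ereal_sup_le1 (f : R -> R) (t : R) :
  (ereal_sup [set (f s)%:E | s in `[1%R, t]] <= 1)%E <->
  (forall s, 1 <= s <= t -> f s <= 1).
Proof.
split=> [H s st|H].
  rewrite -lee_fin; apply: le_trans H; apply: ereal_sup_ubound.
  by exists s => //=; rewrite in_itv.
apply: ge_ereal_sup => _ [s /= st <-]; rewrite lee_fin; apply: H.
by move: st; rewrite in_itv.
Qed.

Lemma kfunE (dl dphi : R -> R) (r : R) : 0 < r ->
  kfun dl dphi r = ginv (fun t => 2 * bigD dl dphi t) r.
Proof.
move=> r0; rewrite /kfun /ginv; congr (ereal_sup _).
have H s : (2 / (r * dl s * dphi s) <= 1) = (2 * bigD dl dphi s <= r).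
  by rewrite -mulrA invfM mulrCA mulrC ler_pdivrMr// mul1r.
apply/seteqP; split=> _ [t [t1 Ht] <-]; exists t => //; split=> //.
  by move/ereal_sup_le1 : Ht => Ht s /Ht; rewrite H.
by apply/ereal_sup_le1 => s /Ht; rewrite H.
Qed.

Lemma hfunE (dl dphi : R -> R) (r : R) : 0 < r ->
  hfun dl dphi r = ginv (fun t => dphi t / dl t) r.
Proof.
move=> r0; rewrite /hfun /ginv; congr (ereal_sup _).
have H s : (dphi s / (r * dl s) <= 1) = (dphi s / dl s <= r).
  by rewrite invfM mulrCA mulrC ler_pdivrMr// mul1r.
apply/seteqP; split=> _ [t [t1 Ht] <-]; exists t => //; split=> //.
  by move/ereal_sup_le1 : Ht => Ht s /Ht; rewrite H.
by apply/ereal_sup_le1 => s /Ht; rewrite H.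
Qed.

End generalized_inverse.

(** * Integrals over bounded intervals *)

Section local_integrals.
Context {R : realType}.
Local Notation mu := (@lebesgue_measure R).
Implicit Types (f g : R -> R).

(** Enough for integrability over bounded intervals, and stable under the operations needed. *)
Definition intb f : Prop := [/\ measurable_fun `[(1 : R), +oo[ f,
  (forall s, 1 <= s -> 0 <= f s) &
  forall X : R, exists M : R, forall s, 1 <= s <= X -> f s <= M].

Definition Int f (a b : R) : R := \int[mu]_(s in `[a, b]) f s.

Lemma intb_integrable f (a b : R) (i : interval R) : intb f -> 1 <= a ->
  [set` i] `<=` `[a, b]%classic -> mu.-integrable [set` i] (EFin \o f).
Proof.
move=> [mf f0 bf] a1 iab.
have muab : (mu (`[a, b]%classic : set R) < +oo)%E.
  by rewrite lebesgue_measure_itv/=; case: ifPn => _; rewrite -?EFinB ltry.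
apply: (@integrableS _ _ _ mu `[a, b]%classic) => //.
apply: measurable_bounded_integrable => //.
- apply: measurable_funS mf => // x /=.
  by rewrite !in_itv/= andbT => /andP[ax _]; rewrite (le_trans a1).
- have [M HM] := bf b; exists M; split; first exact: num_real.
  move=> N MN s /=; rewrite in_itv/= => /andP[as_ sb].
  have s1 : 1 <= s by lra.
  by rewrite ger0_norm ?f0// (le_trans _ (ltW MN))// HM ?s1.
Qed.

Lemma intb_integrable_cc f (a b : R) : intb f -> 1 <= a -> mu.-integrable `[a, b] (EFin \o f).
Proof. by move=> bf a1; apply: (@intb_integrable f a b). Qed.

Lemma Int_chasles f (a b c : R) : intb f -> 1 <= a -> a <= b -> b <= c ->
  Int f a c = Int f a b + Int f b c.
Proof.
move=> bf a1 ab bc; have := @Rintegral_itvB R f (BLeft a) (BRight c) b.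
rewrite Rintegral_itv_obnd_cbnd; last first.
  apply: (intb_integrable bf a1 (b := c)) => x /=.
  by rewrite !in_itv/= => /andP[h ->]; rewrite andbT; lra.
rewrite /Int => <-; rewrite ?bnd_simp//; first by ring.
exact: intb_integrable_cc.
Qed.

Lemma Int_le f g (a b : R) : intb f -> intb g -> 1 <= a ->
  (forall s, a <= s < b -> f s <= g s) -> Int f a b <= Int g a b.
Proof.
move=> bf bg a1 fg; have ico h : intb h -> mu.-integrable `[a, b[ (EFin \o h).
  move=> bh; apply: (intb_integrable bh a1 (b := b)) => x /=.
  by rewrite !in_itv/= => /andP[-> /ltW].
rewrite /Int -!Rintegral_itv_bndo_bndc ?ico//.
apply: le_Rintegral; rewrite ?ico// => s /=; rewrite in_itv/=; exact: fg.
Qed.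

Lemma Int_ge0 f (a b : R) : intb f -> 1 <= a -> 0 <= Int f a b.
Proof.
move=> [_ f0 _] a1; apply: Rintegral_ge0 => x /=.
by rewrite in_itv/= => /andP[ax _]; apply: f0; lra.
Qed.

Lemma Int_cst (c a b : R) : a <= b -> Int (fun=> c) a b = c * (b - a).
Proof.
move=> ab; rewrite /Int Rintegral_cst//= lebesgue_measure_itv/= lte_fin.
by move: ab; rewrite le_eqVlt => /predU1P[->|->]; rewrite ?ltxx ?subrr.
Qed.

Lemma intb_cst (c : R) : 0 <= c -> intb (fun=> c).
Proof. by move=> c0; split=> // X; exists c. Qed.

Lemma intb_scale (c : R) f : 0 <= c -> intb f -> intb (fun s => c * f s).
Proof.
move=> c0 [mf f0 bf]; split=> [|s s1|X].
- by apply: measurable_funM => //; exact: measurable_cst.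
- by rewrite mulr_ge0 ?f0.
- by have [M HM] := bf X; exists (c * M) => s /HM ?; exact: ler_wpM2l.
Qed.

Lemma intb_add f g : intb f -> intb g -> intb (fun s => f s + g s).
Proof.
move=> [mf f0 bf] [mg g0 bg]; split=> [|s s1|X].
- exact: measurable_funD.
- by rewrite addr_ge0 ?f0 ?g0.
- have [M HM] := bf X; have [N HN] := bg X; exists (M + N) => s sX.
  by rewrite lerD ?HM ?HN.
Qed.

Lemma Int_scale (c : R) f (a b : R) : intb f -> 1 <= a ->
  Int (fun s => c * f s) a b = c * Int f a b.
Proof. by move=> bf a1; rewrite /Int RintegralZl//; exact: intb_integrable_cc. Qed.

Lemma Int_add f g (a b : R) : intb f -> intb g -> 1 <= a ->
  Int (fun s => f s + g s) a b = Int f a b + Int g a b.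
Proof. by move=> bf bg a1; rewrite /Int RintegralD//; exact: intb_integrable_cc. Qed.

Lemma Int_ge_cst f (m a b : R) : intb f -> 1 <= a -> a <= b -> 0 <= m ->
  (forall s, a <= s < b -> m <= f s) -> m * (b - a) <= Int f a b.
Proof.
by move=> bf a1 ab m0 H; rewrite -Int_cst//; apply: Int_le => //; exact: intb_cst.
Qed.

Lemma Int_le_cst f (m a b : R) : intb f -> 1 <= a -> a <= b -> 0 <= m ->
  (forall s, a <= s < b -> f s <= m) -> Int f a b <= m * (b - a).
Proof.
by move=> bf a1 ab m0 H; rewrite -Int_cst//; apply: Int_le => //; exact: intb_cst.
Qed.

Lemma Int_mono f (a b c : R) : intb f -> 1 <= a -> a <= b -> b <= c ->
  Int f a b <= Int f a c.
Proof.
move=> bf a1 ab bc; rewrite (Int_chasles bf a1 ab bc) lerDl Int_ge0//; lra.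
Qed.

Lemma Int_monol f (a b c : R) : intb f -> 1 <= a -> a <= b -> b <= c ->
  Int f b c <= Int f a c.
Proof. by move=> bf a1 ab bc; rewrite (Int_chasles bf a1 ab bc) lerDr Int_ge0. Qed.

Lemma EFin_Int f (a b : R) : intb f -> 1 <= a ->
  (Int f a b)%:E = (\int[mu]_(s in `[a, b]) (f s)%:E)%E.
Proof.
move=> bf a1; rewrite /Int /Rintegral fineK//.
apply: (@integrable_fin_num _ _ _ mu `[a, b]%classic) => //.
exact: (intb_integrable_cc b bf a1).
Qed.

Lemma Int_change f (c a b : R) : intb f -> 0 < c -> 1 <= a -> 1 <= c * a ->
  Int f (c * a) (c * b) = c * Int (fun s => f (c * s)) a b.
Proof.
move=> bf c0 a1 ca1; have [mf f0 _] := bf.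
rewrite /Int /Rintegral (@ge0_integral_scale R c)//=; last 2 first.
- apply/measurable_EFinP; apply: measurable_funS mf => // x /=.
  by rewrite !in_itv/= andbT => /andP[? _]; lra.
- by move=> x /=; rewrite in_itv/= => /andP[cax _]; rewrite lee_fin f0// (le_trans ca1).
have -> : (fun x : R => c * x) @^-1` `[c * a, c * b] = `[a, b]%classic.
  by apply/seteqP; split=> x /=; rewrite !in_itv/= !ler_pM2l.
have inr x : (`[a, b]%classic : set R) x -> 1 <= c * x <= c * b.
  rewrite /= in_itv/= => /andP[ax xb]; rewrite (ler_pM2l c0) xb andbT.
  by rewrite (le_trans ca1)// (ler_pM2l c0).
have f0' x : (`[a, b]%classic : set R) x -> (0 <= (f (c * x))%:E)%E.
  by move=> /inr/andP[? _]; rewrite lee_fin f0.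
rewrite fineM// ; last 1 first.
  have mcf : measurable_fun `[a, b] (fun s => f (c * s)).
    have mc : measurable_fun `[a, b] (fun s : R => c * s).
      by apply: measurable_funM => //; exact: measurable_cst.
    apply: (@measurable_comp _ _ _ _ _ _ `[(1 : R), +oo[) => //.
    by move=> _ [x /inr/andP[h _] <-] /=; rewrite in_itv/= h.
  rewrite ge0_fin_numE; last exact: integral_ge0.
  have [_ _ /(_ (c * b))[M HM]] := bf.
  apply: (@le_lt_trans _ _ (\int[mu]_(s in `[a, b]) cst (Num.max 0 M)%:E s)%E).
    apply: ge0_le_integral => //.
    - exact/measurable_EFinP.
    - by move=> x /inr xb; rewrite lee_fin le_max HM ?orbT.
  rewrite integral_cst//= lebesgue_measure_itv/=.
  by case: ifP; rewrite -?EFinB -?EFinM ?mule0 ltry.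
Qed.

Lemma Int_measurable f : intb f -> measurable_fun `[(1 : R), +oo[ (fun t => Int f 1 t).
Proof.
move=> bf; pose F t := Int f 1 (Num.max t 1).
have mF : measurable_fun `[(1 : R), +oo[ F.
  apply: nondecreasing_measurable => // r s rs.
  apply: Int_mono => //; first by rewrite le_max lexx orbT.
  by rewrite ge_max !le_max rs lexx orbT.
apply: eq_measurable_fun mF => r; rewrite inE/= in_itv/= andbT /F => r1.
by rewrite max_l.
Qed.

(** By monotone convergence along the integers, an upper bound of the integrals over [1, t] would bound
    the integral over the half-line. *)
Lemma Int_pinfty f : intb f -> (\int[mu]_(s in `[1%R, +oo[) (f s)%:E = +oo)%E ->
  Int f 1 t @[t --> +oo] --> +oo.
Proof.
move=> bf If; have [mf f0 _] := bf.
have unb A : exists2 t, 1 <= t & A <= Int f 1 t.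
  apply: contrapT => H; have {}H t : 1 <= t -> Int f 1 t <= A.
    by move=> t1; rewrite leNgt; apply/negP => /ltW h; apply: H; exists t.
  pose g := f \_ `[(1 : R), +oo[.
  have g0 x : 0 <= g x.
    by rewrite /g patchE; case: ifPn => //; rewrite inE/= in_itv/= andbT; exact: f0.
  have mg : measurable_fun setT g.
    by apply: (iffLR (measurable_restrictT f _)).
  have gE (a : itv_bound R) : (BLeft 1 <= a)%O ->
      (\int[mu]_(s in [set` Interval (BLeft (0:R)%R) a]) (g s)%:E =
       \int[mu]_(s in [set` Interval (BLeft (1:R)%R) a]) (f s)%:E)%E.
    move=> a1; rewrite integral_mkcond [RHS]integral_mkcond.
    apply: eq_integral => x _; rewrite /g !patchE.
    have -> : (x \in [set` Interval (BLeft (1:R)%R) a]) =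
       (x \in [set` Interval (BLeft (0:R)%R) a]) && (x \in `[(1 : R), +oo[%classic).
      apply/idP/andP; rewrite !inE/= !in_itv/= ?andbT.
        by case/andP => x1 xa; split => //; apply/andP; split => //; lra.
      by case=> /andP[_ xa] x1; apply/andP.
    by case: (x \in [set` Interval (BLeft (0:R)%R) a]) => //=; case: ifP.
  have := @ge0_integral_ereal_sup R mu g g0 mg.
  rewrite gE// If => /esym E.
  have : (ereal_sup [set \int[mu]_(x in `[0%R, i.+1%:R]) (g x)%:E | i in [set: nat]]
     <= A%:E)%E.
    apply: ge_ereal_sup => _ [n _ <-]; rewrite gE ?bnd_simp ?ler1n//.
    by rewrite -EFin_Int// lee_fin H// ler1n.
  by rewrite E.
apply/cvgryPge => A; have [t t1 At] := unb A.
apply: filterS (near_ge t) => u tu; apply: le_trans At _; exact: Int_mono.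
Qed.

End local_integrals.

(** * Karamata's theorem for primitives *)

Section karamata.
Context {R : realType}.
Local Notation mu := (@lebesgue_measure R).
Implicit Types (f g phi : R -> R).

Lemma locbd_intb phi : locbd phi -> measurable_fun `[(1 : R), +oo[ phi -> intb phi.
Proof.
move=> [p0 lp] mp; split=> // [s s1|X]; first exact/ltW/p0.
have [M HM] := lp X; exists (expR M) => s /[dup] /andP[s1 _] sX.
rewrite -[leLHS]lnK ?posrE ?p0// ler_expR; exact: le_trans (ler_norm _) (HM s sX).
Qed.

Lemma Int_ext f g (a b : R) : (forall s, a <= s <= b -> f s = g s) -> Int f a b = Int g a b.
Proof. by move=> fg; apply: eq_Rintegral => s; rewrite inE/= in_itv/=; exact: fg. Qed.

(** The maximum with 1 keeps the argument in the domain when c < 1. *)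
Lemma intb_dilate f (c : R) : 0 < c -> intb f -> intb (fun s => f (Num.max 1 (c * s))).
Proof.
move=> c0 [mf f0 bf]; split=> [|s s1|X].
- have mm : measurable_fun setT (fun s : R => Num.max 1 (c * s)).
    by apply: measurable_maxr => //; apply: measurable_funM.
  apply: (@measurable_comp _ _ _ _ _ _ `[(1 : R), +oo[) => //.
    by move=> _ [x _ <-] /=; rewrite in_itv/= andbT le_max lexx.
  exact: measurable_funS mm.
- by rewrite f0// le_max lexx.
- have [M HM] := bf (Num.max 1 (c * X)); exists M => s /andP[s1 sX].
  apply: HM; rewrite le_max lexx/= ge_max !le_max lexx/=.
  by rewrite ler_pM2l// sX orbT.
Qed.

(** On windows of bounded ratio a regularly varying function is constant up to a factor. *)
Lemma potter_window phi rho : locbd phi -> uvar phi rho ->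
  exists2 M : R, 0 <= M & forall x y, 1 <= x -> 1 <= y -> x <= 2 * y -> y <= 2 * x ->
    `|ln (phi y) - ln (phi x)| <= M.
Proof.
move=> lp up; have [M M0 HM] := global_potter lp up (@ltr01 R).
have l2 : 0 <= ln (2 : R) by apply: ln_ge0; lra.
have nr := normr_ge0 rho.
exists (M + ln 2 + `|rho| * ln 2); first by rewrite !addr_ge0// mulr_ge0.
move=> x y x1 y1 xy yx; have := HM x y x1 y1; rewrite mul1r.
have : `|ln y - ln x| <= ln 2.
  have : ln x <= ln (2 * y) by rewrite ler_ln ?posrE//; lra.
  have : ln y <= ln (2 * x) by rewrite ler_ln ?posrE//; lra.
  rewrite !lnM ?posrE//; [|lra|lra].
  rewrite ler_norml => ? ?; apply/andP; split; lra.
set B := ln y - ln x; set A := ln (phi y) - _ => HB HA.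
rewrite (_ : A = (A - rho * B) + rho * B); last by ring.
apply: le_trans (ler_normD _ _) _; rewrite normrM.
have := normr_ge0 B; nra.
Qed.

Section primitive.
Variables (phi : R -> R) (rho : R).
Hypotheses (lp : locbd phi) (mp : measurable_fun `[(1 : R), +oo[ phi) (up : uvar phi rho).
Let bp : intb phi := locbd_intb lp mp.
Let p0 x : 1 <= x -> 0 < phi x. Proof. by case: lp => + _; exact. Qed.

(** The pointwise limit phi(l s) / phi(s) -> l ^ rho in the form needed under an integral sign. *)
Lemma dilate_bounds (l d : R) : 0 < l -> 0 < d -> exists2 Y : R, 1 <= Y & 1 <= l * Y /\
  forall s, Y <= s -> expR (rho * ln l - d) * phi s <= phi (l * s) <=
    expR (rho * ln l + d) * phi s.
Proof.
move=> l0 d0; have n0 : 0 < 1 + `|ln l| by rewrite ltr_pwDl.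
have [X X1 HX] := up (divr_gt0 d0 n0).
exists (Num.max X (X / l)); first by rewrite le_max X1.
split.
  apply: (@le_trans _ _ (l * (X / l))); first by rewrite mulrC divfK ?gt_eqF.
  by rewrite ler_pM2l// le_max lexx orbT.
move=> s; rewrite ge_max ler_pdivrMr// => /andP[sX]; rewrite mulrC => lsX.
have [ps] := HX _ _ sX lsX; have [pls _] := HX _ _ lsX sX.
rewrite lnM ?posrE//; last by lra.
rewrite (_ : ln l + ln s - ln s = ln l); last by ring.
rewrite divfK ?gt_eqF// ler_norml => /andP[h1 h2].
rewrite -[phi s]lnK ?posrE// -[phi (l * s)]lnK ?posrE// -!expRD !ler_expR.
apply/andP; split; lra.
Qed.

(** The interval [t/2, t] alone contributes a multiple of t phi(t). *)
Lemma ln_Int_ge : exists M, forall t, 2 <= t ->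
  0 < Int phi 1 t /\ ln t + ln (phi t) <= ln (Int phi 1 t) + M.
Proof.
have [M M0 HM] := potter_window lp up.
have e0 : 0 < expR (- M) by rewrite expR_gt0.
exists (M + ln 2) => t t2.
have t1 : 1 <= t by lra.
have pt := p0 t1.
have h : expR (- M) * phi t * (t - t / 2) <= Int phi 1 t.
  apply: (@le_trans _ _ (Int phi (t / 2) t)); last by apply: Int_monol => //; lra.
  apply: Int_ge_cst => //; [lra|lra| |].
    by rewrite mulr_ge0 ?ltW.
  move=> s /andP[s1 s2].
  have := HM t s t1 ltac:(lra) ltac:(lra) ltac:(lra).
  rewrite ler_norml => /andP[H1 _].
  have ps : 0 < phi s by apply: p0; lra.
  rewrite -[phi t]lnK ?posrE// -[phi s]lnK ?posrE// -expRD ler_expR; lra.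
have c0 : 0 < expR (- M) * phi t * (t - t / 2) by rewrite !mulr_gt0//; lra.
split; first exact: lt_le_trans h.
have : ln (expR (- M) * phi t * (t - t / 2)) <= ln (Int phi 1 t).
  by rewrite ler_ln ?posrE//; exact: lt_le_trans h.
rewrite (_ : t - t / 2 = t / 2); last by field.
rewrite !lnM ?posrE// ?lnV ?posrE ?mulr_gt0// ?expRK; lra.
Qed.

Lemma Int_dyadic_le : exists M, forall t, 1 <= t ->
  Int phi t (2 * t) <= expR M * (t * phi t).
Proof.
have [M M0 HM] := potter_window lp up; exists M => t t1.
rewrite (_ : _ * _ = expR M * phi t * (2 * t - t)); last by ring.
apply: Int_le_cst => //; [lra|by rewrite mulr_ge0 ?expR_ge0// ltW ?p0|].
move=> s /andP[s1 s2]; have s11 : 1 <= s by exact: le_trans s1.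
rewrite ler_expRM ?p0// -lerBlDl.
apply: le_trans (ler_norm _) (HM t s t1 s11 _ _); lra.
Qed.

(** The substitution s -> l s turns the primitive F(l t) into l times the integral of phi(l s), which is
    about l ^ (1 + rho) F(t); the initial segments do not matter because F tends to infinity. *)
Lemma uvar_Int : Int phi 1 t @[t --> +oo] --> +oo -> uvar (Int phi 1) (1 + rho).
Proof.
move=> Foo; have [M0 HM0] := ln_Int_ge.
have F0 t : 2 <= t -> 0 < Int phi 1 t by move=> /HM0[].
apply: (@uvar_of_log _ 2) => //.
  apply: measurable_funS (Int_measurable bp) => // x /=.
  by rewrite !in_itv/= !andbT; apply: le_trans; lra.
have aux1 (A P F K c : R) : A <= F * (K * (c - 1)) -> P <= K * F -> A + P <= K * c * F.
  by move=> *; lra.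
have aux2 (A F I c : R) : A <= F * (1 - c) -> F = A + I -> c * F <= I.
  by move=> *; lra.
have aux3 (x y z w : R) : y <= z + (x + (rho * x + w) + w) ->
    z + (x + (rho * x - w) + - w) <= y -> `|(1 + rho) * x - (y - z)| <= 2 * w.
  by move=> *; rewrite ler_norml; apply/andP; split; lra.
move=> l l0; apply/cvgrPdist_le => e e0.
pose d := e / 2; have d0 : 0 < d by rewrite /d; lra.
have [Y Y1 [lY1 HY]] := dilate_bounds l0 d0.
pose psi s := phi (Num.max 1 (l * s)).
have bpsi : intb psi by exact: intb_dilate.
have lsl s : Y <= s -> 1 <= l * s by move=> Ys; apply: le_trans lY1 _; rewrite (ler_pM2l l0).
have psiE s : Y <= s -> psi s = phi (l * s).
  by move=> Ys; rewrite /psi max_r// lsl.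
pose Kp := expR (rho * ln l + d); pose Km := expR (rho * ln l - d).
have Kp0 : 0 < Kp by rewrite expR_gt0.
have Km0 : 0 < Km by rewrite expR_gt0.
have ed : 1 < expR d by rewrite expR_gt1.
have ed' : 0 < 1 - expR (- d) by rewrite subr_gt0 expR_lt1 oppr_lt0.
have lK : 0 < l * Kp * (expR d - 1) by rewrite !mulr_gt0// subr_gt0.
near=> t.
have tY : Y <= t by near: t; exact: near_ge.
have t2 : 2 <= t by near: t; exact: near_ge.
have lt2 : 2 <= l * t.
  by rewrite mulrC -ler_pdivrMr//; near: t; exact: near_ge.
have H1 : Int phi 1 (l * Y) / (l * Kp * (expR d - 1)) <= Int phi 1 t.
  by near: t; move/cvgryPge : Foo; exact.
have H2 : Int phi 1 Y / (1 - expR (- d)) <= Int phi 1 t.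
  by near: t; move/cvgryPge : Foo; exact.
rewrite (ler_pdivrMr _ _ lK) in H1; rewrite (ler_pdivrMr _ _ ed') in H2.
have Ft := F0 t t2; have Flt := F0 _ lt2.
(* substituting l * s for s, up to the initial segments that Foo makes negligible *)
have E : Int phi 1 (l * t) = Int phi 1 (l * Y) + l * Int psi Y t.
  rewrite (@Int_chasles _ phi 1 (l * Y) (l * t))//; last by rewrite (ler_pM2l l0).
  congr (_ + _); rewrite Int_change//; congr (_ * _); apply: Int_ext => s /andP[Ys _].
  by rewrite psiE.
have EF : Int phi 1 t = Int phi 1 Y + Int phi Y t by apply: Int_chasles.
have FY0 : 0 <= Int phi 1 Y by apply: Int_ge0.
have FlY0 : 0 <= Int phi 1 (l * Y) by apply: Int_ge0.
have up1 : Int psi Y t <= Kp * Int phi Y t.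
  rewrite -Int_scale//; apply: Int_le => //; first exact: (intb_scale (ltW Kp0) bp).
  by move=> s /andP[Ys _]; rewrite psiE//; have /andP[] := HY s Ys.
have lo1 : Km * Int phi Y t <= Int psi Y t.
  rewrite -Int_scale//; apply: Int_le => //; first exact: (intb_scale (ltW Km0) bp).
  by move=> s /andP[Ys _]; rewrite psiE//; have /andP[] := HY s Ys.
have up2 : Int phi 1 (l * t) <= expR (ln l + (rho * ln l + d) + d) * Int phi 1 t.
  rewrite [in leRHS]expRD [in leRHS]expRD (lnK l0) E; apply: aux1 H1 _.
  rewrite -[leRHS]mulrA (ler_pM2l l0); apply: (le_trans up1).
  by rewrite (ler_pM2l Kp0) EF lerDr.
have lo2 : expR (ln l + (rho * ln l - d) + - d) * Int phi 1 t <= Int phi 1 (l * t).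
  rewrite [in leLHS]expRD [in leLHS]expRD (lnK l0).
  apply: (@le_trans _ _ (l * Int psi Y t)); last by rewrite E lerDr.
  rewrite -!mulrA (ler_pM2l l0); apply: le_trans lo1; rewrite (ler_pM2l Km0).
  exact: aux2 H2 EF.
rewrite ler_expRM// in up2; rewrite expRM_ler// in lo2.
have -> : e = 2 * d by rewrite /d; field.
exact: aux3 up2 lo2.
Unshelve. all: by end_near. Qed.

(** F(2t) is at least a constant greater than 1 times F(t), since the index of F is positive; so F(t)
    is at most a multiple of F(2t) - F(t), the integral over one window. *)
Lemma ln_Int_le : -1 < rho -> Int phi 1 t @[t --> +oo] --> +oo ->
  exists M, \forall t \near +oo, ln (Int phi 1 t) <= ln t + ln (phi t) + M.
Proof.
move=> r1 Foo; have uF := uvar_Int Foo; have [M HM] := Int_dyadic_le.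
have l2 := @half_le_ln2 R; have l20 : 0 < ln (2 : R) by apply: lt_le_trans l2.
pose d := (1 + rho) * ln 2 / 2.
have d0 : 0 < d by rewrite /d !mulr_gt0//; lra.
have dE : (1 + rho) * ln 2 = 2 * d by rewrite /d; field.
have n0 : 0 < 1 + ln (2 : R) by rewrite addr_gt0.
have [X X1 HX] := uF _ (divr_gt0 d0 n0).
have ed0 : 0 < expR d - 1 by rewrite subr_gt0 expR_gt1.
have aux1 (x y : R) : - d <= y - x - 2 * d -> x + d <= y by move=> *; lra.
have aux2 (F I c : R) : expR d * F <= F + I -> I <= c -> F * (expR d - 1) <= c.
  by move=> *; lra.
have ge2 (t : R) : 1 <= t -> t <= 2 * t by move=> ?; lra.
exists (M - ln (expR d - 1)).
near=> t; have tX : X <= t by near: t; exact: near_ge.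
have t1 : 1 <= t by exact: le_trans tX.
have t0 : 0 < t by exact: lt_le_trans t1.
have t2t := ge2 t t1; have tX2 := le_trans tX t2t.
have [Ft] := HX t (2 * t) tX tX2; have [F2t _] := HX (2 * t) t tX2 tX.
rewrite (@lnM _ 2) ?posrE// addrK (gtr0_norm l20) divfK ?gt_eqF// dE.
rewrite ler_norml => /andP[/aux1 h _].
rewrite -expRM_ler// (@Int_chasles _ phi 1 t (2 * t))// in h.
have pt := p0 t1; rewrite -(@lnM _ t) ?posrE// -ler_expRM ?mulr_gt0//.
by rewrite expRB (lnK ed0) mulrAC ler_pdivlMr//; exact: aux2 h (HM t t1).
Unshelve. all: by end_near. Qed.

End primitive.
End karamata.

(** * Karamata's theorem for tails *)

Section tail.
Context {R : realType}.
Local Notation mu := (@lebesgue_measure R).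

Definition Tail (f : R -> R) (a : R) : R := \int[mu]_(s in `[a, +oo[) f s.

Variables (phi : R -> R) (rho : R).
Hypotheses (lp : locbd phi) (mp : measurable_fun `[(1 : R), +oo[ phi) (up : uvar phi rho).
Hypothesis Ip : (\int[mu]_(s in `[1%R, +oo[) (phi s)%:E < +oo)%E.
Let bp : intb phi := locbd_intb lp mp.
Let p0 x : 1 <= x -> 0 < phi x. Proof. by case: lp => + _; exact. Qed.

Let Tail_integrable (a : R) : 1 <= a -> mu.-integrable `[a, +oo[ (EFin \o phi).
Proof.
move=> a1; apply: (@integrableS _ _ _ mu `[(1:R), +oo[%classic) => //.
  by move=> x /=; rewrite !in_itv/= !andbT; exact: le_trans.
apply/integrableP; split; first exact/measurable_EFinP.
apply: le_lt_trans Ip; rewrite le_eqVlt; apply/orP; left; apply/eqP.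
apply: eq_integral => x; rewrite inE/= in_itv/= andbT => x1.
by rewrite ger0_norm// ltW ?p0.
Qed.

Lemma EFin_Tail (a : R) : 1 <= a -> (Tail phi a)%:E = (\int[mu]_(s in `[a, +oo[) (phi s)%:E)%E.
Proof.
move=> a1; rewrite /Tail /Rintegral fineK//.
apply: (@integrable_fin_num _ _ _ mu `[a, +oo[%classic) => //.
exact: (Tail_integrable a1).
Qed.

Lemma Tail_chasles (a b : R) : 1 <= a -> a <= b -> Tail phi a = Int phi a b + Tail phi b.
Proof.
move=> a1 ab; have := @Rintegral_itvB R phi (BLeft a) (BInfty _ false) b.
rewrite Rintegral_itv_obnd_cbnd; last first.
  apply: (@integrableS _ _ _ mu `[a, +oo[%classic) => //; last exact: (Tail_integrable a1).
  by move=> x /=; rewrite !in_itv/= !andbT => /ltW; exact: le_trans.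
rewrite /Tail /Int => <-; rewrite ?bnd_simp//; first by ring.
exact: (Tail_integrable a1).
Qed.

Lemma Tail_ge0 (a : R) : 1 <= a -> 0 <= Tail phi a.
Proof.
move=> a1; apply: Rintegral_ge0 => x /=.
by rewrite in_itv/= andbT => ax; apply/ltW/p0; exact: le_trans ax.
Qed.

Lemma Int_le_Tail (a b : R) : 1 <= a -> a <= b -> Int phi a b <= Tail phi a.
Proof.
by move=> a1 ab; rewrite (Tail_chasles a1 ab) lerDl Tail_ge0// (le_trans a1).
Qed.

Lemma ln_Tail_ge : exists M, forall t, 1 <= t ->
  0 < Tail phi t /\ ln t + ln (phi t) <= ln (Tail phi t) + M.
Proof.
have [M M0 HM] := potter_window lp up.
have e0 : 0 < expR (- M) by rewrite expR_gt0.
exists M => t t1.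
have pt := p0 t1; have t0 : 0 < t by lra.
have h : expR (- M) * phi t * (2 * t - t) <= Tail phi t.
  apply: (@le_trans _ _ (Int phi t (2 * t))); last by apply: Int_le_Tail => //; lra.
  apply: Int_ge_cst => //; [lra| |].
    by rewrite mulr_ge0 ?ltW.
  move=> s /andP[s1 s2]; have s11 : 1 <= s by lra.
  have := HM t s t1 ltac:(lra) ltac:(lra) ltac:(lra).
  rewrite ler_norml => /andP[H1 _].
  rewrite -[phi t]lnK ?posrE// -[phi s]lnK ?posrE ?p0// -expRD ler_expR; lra.
rewrite (_ : 2 * t - t = t) in h; last by ring.
have c0 : 0 < expR (- M) * phi t * t by rewrite !mulr_gt0//.
split; first exact: lt_le_trans h.
have : ln (expR (- M) * phi t * t) <= ln (Tail phi t).
  by rewrite ler_ln ?posrE//; exact: lt_le_trans h.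
by rewrite !lnM ?posrE// ?mulr_gt0// ?expRK; lra.
Qed.

Lemma Tail_measurable : measurable_fun `[(1 : R), +oo[ (Tail phi).
Proof.
pose F t := Tail phi (Num.max t 1).
have mF : measurable_fun `[(1 : R), +oo[ F.
  apply: nonincreasing_measurable => // r s rs.
  have h1 : 1 <= Num.max r 1 by rewrite le_max lexx orbT.
  have h2 : Num.max r 1 <= Num.max s 1 by rewrite ge_max !le_max rs lexx orbT.
  by rewrite /F (Tail_chasles h1 h2) lerDr Int_ge0.
apply: eq_measurable_fun mF => r; rewrite inE/= in_itv/= andbT /F => r1.
by rewrite max_l.
Qed.

(** As for primitives, by the substitution s -> l s; here there is no initial segment. *)
Lemma uvar_Tail : uvar (Tail phi) (1 + rho).
Proof.
have [M0 HM0] := ln_Tail_ge.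
have G0 t : 1 <= t -> 0 < Tail phi t by move=> /HM0[].
have aux (x y z w : R) : y <= z + (x + (rho * x + w)) ->
    z + (x + (rho * x - w)) <= y -> `|(1 + rho) * x - (y - z)| <= w.
  by move=> *; rewrite ler_norml; apply/andP; split; lra.
apply: (uvar_of_log Tail_measurable) => // l l0; apply/cvgrPdist_le => d d0.
have [Y Y1 [lY1 HY]] := dilate_bounds up l0 d0.
have mE (a : R) f : 1 <= a -> measurable_fun `[(1 : R), +oo[ f ->
    measurable_fun (`[a, +oo[%classic : set R) (fun s => (f s)%:E).
  move=> a1 mf; apply/measurable_EFinP; apply: measurable_funS mf => // x /=.
  by rewrite !in_itv/= !andbT; exact: le_trans.
near=> s.
have sY : Y <= s by near: s; exact: near_ge.
have s1 : 1 <= s by exact: le_trans sY.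
have ls1 : 1 <= l * s by apply: le_trans lY1 _; rewrite (ler_pM2l l0).
pose W := (\int[mu]_(x in `[s, +oo[) (phi (l * x))%:E)%E.
have E : ((Tail phi (l * s))%:E = l%:E * W)%E.
  rewrite EFin_Tail// (@ge0_integral_scale R l)//=.
  - congr (_ * integral _ _ _)%E.
    by apply/seteqP; split=> x /=; rewrite !in_itv/= !andbT (ler_pM2l l0).
  - exact: mE.
  - move=> x /=; rewrite in_itv/= andbT => h; rewrite lee_fin ltW// p0//.
    exact: le_trans h.
have msc (c : R) : measurable_fun (`[s, +oo[%classic : set R) (fun x => (c * phi x)%:E).
  have mc : measurable_fun `[(1 : R), +oo[ (fun x => c * phi x).
    by apply: measurable_funM => //; exact: measurable_cst.
  exact: mE s1 mc.
have mls : measurable_fun (`[s, +oo[%classic : set R) (fun x => (phi (l * x))%:E).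
  apply/measurable_EFinP.
  have mc : measurable_fun `[s, +oo[ (fun s : R => l * s).
    by apply: measurable_funM => //; exact: measurable_cst.
  apply: (@measurable_comp _ _ _ _ _ _ `[(1 : R), +oo[) => //.
  move=> _ [x /andP[sx _] <-]; apply/andP; split=> //=.
  by apply: le_trans ls1 _; rewrite (ler_pM2l l0).
have Iscale (c : R) : 0 < c ->
    (\int[mu]_(x in `[s, +oo[) (c * phi x)%:E = (c * Tail phi s)%:E)%E.
  move=> c0; rewrite EFinM EFin_Tail//.
  under eq_integral do rewrite EFinM.
  rewrite ge0_integralZl_EFin ?(ltW c0)//; first by
    move=> x /=; rewrite in_itv/= andbT => h; rewrite lee_fin ltW// p0// (le_trans s1).
  exact: mE.
pose Kp := expR (rho * ln l + d); pose Km := expR (rho * ln l - d).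
have Kp0 : 0 < Kp by rewrite expR_gt0.
have Km0 : 0 < Km by rewrite expR_gt0.
have phi_ge0 x : s <= x -> 0 <= phi x by move=> sx; rewrite ltW// p0// (le_trans s1).
have up1 : Tail phi (l * s) <= expR (ln l + (rho * ln l + d)) * Tail phi s.
  rewrite [in leRHS]expRD (lnK l0) -[in leRHS]mulrA -lee_fin E EFinM; apply: lee_pmul => //; rewrite ?lee_fin ?(ltW l0)//.
    apply: integral_ge0 => x /=; rewrite in_itv/= andbT => sx.
    by rewrite lee_fin ltW// p0// (le_trans ls1)// (ler_pM2l l0).
  rewrite -Iscale//; apply: ge0_le_integral => //.
    move=> x /=; rewrite in_itv/= andbT => sx.
    by rewrite lee_fin ltW// p0// (le_trans ls1)// (ler_pM2l l0).
    exact: msc.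
  move=> x /=; rewrite in_itv/= andbT => sx; rewrite lee_fin.
  by have /andP[] := HY x (le_trans sY sx).
have lo1 : expR (ln l + (rho * ln l - d)) * Tail phi s <= Tail phi (l * s).
  rewrite [in leLHS]expRD (lnK l0) -[in leLHS]mulrA -lee_fin E EFinM; apply: lee_pmul => //; rewrite ?lee_fin ?(ltW l0)//.
    by rewrite mulr_ge0 ?ltW// G0.
  rewrite -Iscale//; apply: ge0_le_integral => //.
    move=> x /=; rewrite in_itv/= andbT => sx.
    by rewrite lee_fin mulr_ge0 ?phi_ge0// ltW.
    exact: msc.
  move=> x /=; rewrite in_itv/= andbT => sx; rewrite lee_fin.
  by have /andP[] := HY x (le_trans sY sx).
have Gs := G0 _ s1; have Gls := G0 _ ls1.
rewrite ler_expRM// in up1; rewrite expRM_ler// in lo1; exact: aux up1 lo1.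
Unshelve. all: by end_near. Qed.

(** The index of the tail is negative, so the tail at t is at most a multiple of its part in [t, 2t]. *)
Lemma ln_Tail_le : rho < -1 ->
  exists M, \forall t \near +oo, ln (Tail phi t) <= ln t + ln (phi t) + M.
Proof.
move=> r1; have uG := uvar_Tail; have [M HM] := Int_dyadic_le lp mp up.
have [M1 HM1] := ln_Tail_ge.
have l2 := @half_le_ln2 R; have l20 : 0 < ln (2 : R) by apply: lt_le_trans l2.
pose d := - (1 + rho) * ln 2 / 2.
have d0 : 0 < d by rewrite /d !mulr_gt0//; lra.
have dE : (1 + rho) * ln 2 = - (2 * d) by rewrite /d; field.
have n0 : 0 < 1 + ln (2 : R) by rewrite addr_gt0.
have [X X1 HX] := uG _ (divr_gt0 d0 n0).
have ed0 : 0 < 1 - expR (- d) by rewrite subr_gt0 expR_lt1 oppr_lt0.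
have aux1 (x y : R) : y - x - - (2 * d) <= d -> y <= x + - d by move=> *; lra.
have aux2 (G G2 I c : R) : G2 <= expR (- d) * G -> G = I + G2 -> I <= c ->
  G * (1 - expR (- d)) <= c by move=> *; lra.
have ge2 (t : R) : 1 <= t -> t <= 2 * t by move=> ?; lra.
exists (M - ln (1 - expR (- d))).
near=> t; have tX : X <= t by near: t; exact: near_ge.
have t1 : 1 <= t by exact: le_trans tX.
have t0 : 0 < t by exact: lt_le_trans t1.
have t2t := ge2 t t1; have tX2 := le_trans tX t2t.
have [Ft] := HX t (2 * t) tX tX2; have [F2t _] := HX (2 * t) t tX2 tX.
rewrite (@lnM _ 2) ?posrE// addrK (gtr0_norm l20) divfK ?gt_eqF// dE.
rewrite ler_norml => /andP[_ /aux1 h].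
rewrite -ler_expRM// in h.
have pt := p0 t1; rewrite -(@lnM _ t) ?posrE// -ler_expRM ?mulr_gt0//.
rewrite expRB (lnK ed0) mulrAC ler_pdivlMr//.
exact: aux2 h (Tail_chasles t1 t2t) (HM t t1).
Unshelve. all: by end_near. Qed.

End tail.

(** * Measurability, comparison, and indices of integrals *)

Section positive_measurable.
Context {R : realType}.
Implicit Types (f g : R -> R).

Lemma measurable_of_ln f g : (forall x, 1 <= x -> f x = expR (g x)) ->
  measurable_fun `[(1 : R), +oo[ g -> measurable_fun `[(1 : R), +oo[ f.
Proof.
move=> fg mg; apply: (@eq_measurable_fun _ _ _ _ _ (fun x => expR (g x))).
  by move=> x; rewrite inE/= in_itv/= andbT => x1; rewrite fg.
exact: measurableT_comp mg.
Qed.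

Lemma measurable_posV f : (forall x, 1 <= x -> 0 < f x) ->
  measurable_fun `[(1 : R), +oo[ f -> measurable_fun `[(1 : R), +oo[ (fun x => (f x)^-1).
Proof.
move=> f0 mf; apply: (@measurable_of_ln _ (fun x => - ln (f x))).
  by move=> x x1; rewrite expRN lnK// posrE f0.
by apply: measurable_funN; exact: measurableT_comp mf.
Qed.

Lemma measurable_pos_sqrt f : (forall x, 1 <= x -> 0 < f x) ->
  measurable_fun `[(1 : R), +oo[ f -> measurable_fun `[(1 : R), +oo[ (fun x => Num.sqrt (f x)).
Proof.
move=> f0 mf; apply: (@measurable_of_ln _ (fun x => ln (f x) * 2^-1)).
  by move=> x x1; rewrite -ln_sqrt ?f0// lnK// posrE sqrtr_gt0 f0.
apply: measurable_funM; last exact: measurable_cst.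
exact: measurableT_comp mf.
Qed.

End positive_measurable.

Section log_comparison.
Context {R : realType}.
Implicit Types (f g h : R -> R).

Lemma lesssim_near f g (c : R) : 0 < c -> (\forall x \near +oo, f x <= c * g x) ->
  lesssim_oo f g.
Proof.
move=> c0 /nearyP[X _ HX]; exists X; exists c => // x /=; rewrite in_itv/= andbT; exact: HX.
Qed.

Lemma near_lesssim f g : lesssim_oo f g ->
  exists2 c : R, 0 < c & \forall x \near +oo, f x <= c * g x.
Proof.
move=> [X [c c0 H]]; exists c => //; apply: filterS (near_ge X) => x Xx.
by apply: H; rewrite /= in_itv/= andbT.
Qed.

Lemma lesssim_trans f g h : lesssim_oo f g -> lesssim_oo g h -> lesssim_oo f h.
Proof.
move=> /near_lesssim[c c0 Hc] /near_lesssim[d d0 Hd].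
apply: (@lesssim_near _ _ (c * d)); first exact: mulr_gt0.
apply: filterS2 Hc Hd => x h1 h2; apply: le_trans h1 _.
by rewrite -mulrA ler_pM2l.
Qed.

Lemma asymp_sym f g : asymp_oo f g -> asymp_oo g f.
Proof. by case. Qed.

Lemma asymp_trans f g h : asymp_oo f g -> asymp_oo g h -> asymp_oo f h.
Proof. by move=> [a b] [c d]; split; [exact: lesssim_trans a c|exact: lesssim_trans d b]. Qed.

Lemma lesssim_ln f g (M : R) :
  (\forall x \near +oo, [/\ 0 < f x, 0 < g x & ln (f x) <= ln (g x) + M]) -> lesssim_oo f g.
Proof.
move=> H; apply: (@lesssim_near _ _ (expR M)); first exact: expR_gt0.
apply: filterS H => x [f0 g0 h].
by rewrite -[f x]lnK// -[g x]lnK// -expRD ler_expR addrC.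
Qed.

(** In logarithms the constant of a comparison is an additive one, and may be taken nonnegative. *)
Lemma ln_lesssim_on f g : (forall x, 1 <= x -> 0 < f x) -> (forall x, 1 <= x -> 0 < g x) ->
  lesssim_on `[1, +oo[ f g ->
  exists2 M, 0 <= M & forall x, 1 <= x -> ln (f x) <= ln (g x) + M.
Proof.
move=> f0 g0 [c c0 H]; exists (Num.max 0 (ln c)); first by rewrite le_max lexx.
move=> x x1; have := H x; rewrite /= in_itv/= andbT => /(_ x1).
rewrite -ler_ln ?posrE ?mulr_gt0 ?f0 ?g0// lnM ?posrE ?g0//.
by move/le_trans; apply; rewrite addrC lerD2l le_max lexx orbT.
Qed.

End log_comparison.

Section inverses_and_integrals.
Context {R : realType}.
Implicit Types (a b f g : R -> R).

Lemma near_ln_lesssim f g : (\forall x \near +oo, 0 < f x) -> (\forall x \near +oo, 0 < g x) ->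
  lesssim_oo f g -> exists M, \forall x \near +oo, ln (f x) <= ln (g x) + M.
Proof.
move=> f0 g0 /near_lesssim[c c0 H]; exists (ln c); near=> x.
have fx : 0 < f x by near: x.
have gx : 0 < g x by near: x.
by rewrite addrC -lnM ?posrE// ler_ln ?posrE ?mulr_gt0//; near: x.
Unshelve. all: by end_near. Qed.

(** Taking inverses reverses inequalities: a(b(x)) ~ x ~ a'(b'(x)), and a is at most a multiple of a', so
    a at b'(x) is at most a multiple of a at b(x). *)
Lemma inverse_le (a a' b b' : R -> R) (rho rho' : R) : 0 < rho -> 0 < rho' ->
  uvar a rho -> uvar a' rho' -> asymptotic_inverse a b -> asymptotic_inverse a' b' ->
  lesssim_oo a a' -> exists M, \forall x \near +oo, ln (b' x) <= ln (b x) + M.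
Proof.
move=> r0 r0' ua ua' inv inv' aa.
have [boo _ sol _] := asymptotic_inverseP r0 ua inv.
have [boo' _ sol' _] := asymptotic_inverseP r0' ua' inv'.
have ev (u : R -> R) s : uvar u s -> \forall x \near +oo, 0 < u x.
  by move=> /uvar_gt0[X _ HX]; apply: filterS (near_ge X) => x; exact: HX.
have [M HM] := near_ln_lesssim (ev _ _ ua) (ev _ _ ua') aa.
apply: (ln_le_of_uvar (M := M + 2) r0 ua boo' boo); near=> x.
have h1 : ln (a (b' x)) <= ln (a' (b' x)) + M by near: x; exact: (boo' _ HM).
have : `|0 - (ln (a (b x)) - ln x)| <= 1 by near: x; move/cvgrPdist_le : sol; exact.
have : `|0 - (ln (a' (b' x)) - ln x)| <= 1 by near: x; move/cvgrPdist_le : sol'; exact.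
by rewrite !sub0r !normrN !ler_norml => /andP[? ?] /andP[? ?]; lra.
Unshelve. all: by end_near. Qed.

Lemma sqrt_measurable (D : set R) : measurable_fun D (@Num.sqrt R).
Proof. by apply: measurable_funTS; apply: continuous_measurable_fun; exact: sqrt_continuous. Qed.

Lemma uvar_neg a rho : rho < 0 -> uvar a rho -> forall e, 0 < e ->
  \forall x \near +oo, 0 < a x < e.
Proof.
move=> r0 ua e e0; have r0' : 0 < - rho by lra.
have [X _ HX] := uvar_gt0 ua.
near=> x; have ax : 0 < a x by apply: HX; near: x; exact: near_ge.
rewrite ax /=.
have h : e^-1 + 1 <= (a x)^-1 by near: x; exact: pinfty_ge (uvar_pinfty r0' (uvarV ua)).
have : e^-1 < (a x)^-1 by lra.
by rewrite ltf_pV2 ?posrE.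
Unshelve. all: by end_near. Qed.

Lemma uvar_ln_le a rho sigma : rho < sigma -> uvar a rho ->
  exists c : R, \forall x \near +oo, ln (a x) <= sigma * ln x + c.
Proof.
move=> rs ua; have [X X1 HX] := ua (sigma - rho) ltac:(lra).
exists (ln (a X) - sigma * ln X + (sigma - rho)).
near=> x; have Xx : X <= x by near: x; exact: near_ge.
have [_] := HX X x (lexx X) Xx.
have l0 : 0 <= ln x - ln X by rewrite subr_ge0 ler_ln ?posrE; lra.
rewrite (ger0_norm l0) ler_norml => /andP[_]; lra.
Unshelve. all: by end_near. Qed.

Lemma integral_lty_of_index (phi : R -> R) rho : locbd phi ->
  measurable_fun `[(1 : R), +oo[ phi -> uvar phi rho -> rho < -1 ->
  (\int[@lebesgue_measure R]_(s in `[1%R, +oo[) (phi s)%:E < +oo)%E.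
Proof.
move=> lp mp up r1; rewrite ltey; apply/eqP => If.
have Foo := Int_pinfty (locbd_intb lp mp) If.
have uF := uvar_Int lp mp up Foo.
have r1' : 1 + rho < 0 by lra.
have H := uvar_neg r1' uF ltr01.
have /nearyP[X _ HX] : \forall x \near +oo, 0 < Int phi 1 x < 1 /\ 1 <= Int phi 1 x.
  exact: filterI H (pinfty_ge 1 Foo).
have [/andP[_ h1] h2] := HX X (lexx X); lra.
Qed.

(** With a larger index the tail itself would tend to infinity, although it is nonincreasing. *)
Lemma index_ge_of_integral (phi : R -> R) rho : locbd phi ->
  measurable_fun `[(1 : R), +oo[ phi -> uvar phi rho ->
  (\int[@lebesgue_measure R]_(s in `[1%R, +oo[) (phi s)%:E < +oo)%E -> rho <= -1.
Proof.
move=> lp mp up Ip; rewrite leNgt; apply/negP => h.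
have uG := uvar_Tail lp mp up Ip.
have r1 : 0 < 1 + rho by lra.
have /nearyP[X X1 HX] := pinfty_ge (Tail phi 1 + 1) (uvar_pinfty r1 uG).
have := HX X (lexx X); rewrite (Tail_chasles lp mp Ip (lexx 1) X1).
have := Int_ge0 X (locbd_intb lp mp) (lexx 1); lra.
Qed.

(** Asymptotic inverses only depend on the asymptotic class of the function. *)
Lemma asymptotic_inverse_sim (a a' b : R -> R) rho : 0 < rho -> uvar a rho -> uvar a' rho ->
  measurable_fun `[(1 : R), +oo[ a -> ln (a x) - ln (a' x) @[x --> +oo] --> 0 ->
  asymptotic_inverse a' b -> asymptotic_inverse a b.
Proof.
move=> r0 ua ua' ma aa inv.
have [boo ub sol [x0 mb]] := asymptotic_inverseP r0 ua' inv.
have aoo := uvar_pinfty r0 ua.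
have gt0id : \forall x \near +oo, 0 < id x :> R by exact: nbhs_pinfty_gt.
have [X _ HX] := uvar_gt0 ua.
split.
- by exists rho => //; exact: uvar_rv ua ma.
- by exists rho^-1; exact: uvar_rv ub mb.
- apply: ln_simP => //.
    by apply: filterS (pinfty_ge X boo) => r; exact: HX.
  have h1 : ln (a (b x)) - ln (a' (b x)) @[x --> +oo] --> 0 by exact: (cvg_comp _ _ boo aa).
  rewrite (_ : (fun x => ln (a (b x)) - _) = (fun x => (ln (a (b x)) - ln (a' (b x))) +
    (ln (a' (b x)) - ln x))); last by apply/funext => x; rewrite /=; ring.
  by rewrite -[0]addr0; exact: cvgD h1 sol.
- have baoo : b (a x) @[x --> +oo] --> +oo by exact: cvg_comp aoo boo.
  apply: ln_simP => //.
    by apply: filterS (pinfty_ge 1 baoo) => r; lra.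
  apply: (ln_near_of_uvar r0 ua' baoo (@cvg_idy R)).
  have h1 : ln (a' (b (a x))) - ln (a x) @[x --> +oo] --> 0 by exact: (cvg_comp _ _ aoo sol).
  rewrite (_ : (fun x => ln (a' (b (a x))) - _) = (fun x => (ln (a' (b (a x))) - ln (a x)) +
    (ln (a x) - ln (a' x)))); last by apply/funext => x; ring.
  by rewrite -[0]addr0; exact: cvgD h1 aa.
Qed.

End inverses_and_integrals.

Section composition.
Context {R : realType}.
Implicit Types (a b F : R -> R).

Lemma measurable_comp_pinfty F b (x0 : R) : measurable_fun `[(1 : R), +oo[ F ->
  measurable_fun `[x0, +oo[ b -> b x @[x --> +oo] --> +oo ->
  exists x1 : R, measurable_fun `[x1, +oo[ (fun x => F (b x)).
Proof.
move=> mF mb /cvgryPge/(_ 1)/nearyP[X _ HX]; exists (Num.max x0 X).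
apply: (@measurable_comp _ _ _ _ _ _ `[(1 : R), +oo[) => //.
  move=> _ [x /= xX <-]; have : Num.max x0 X <= x by case/andP: xX.
  by rewrite ge_max in_itv/= andbT => /andP[_ /HX].
apply: measurable_funS mb => // x /=.
by rewrite !in_itv/= !andbT ge_max => /andP[].
Qed.

(** With positive index rho >= e, the loss in Potter's bound with parameter e is compensated by the
    growth, except for a constant e. *)
Lemma uvar_almost_mono a rho (e : R) : 0 < e -> e <= rho -> locbd a -> uvar a rho ->
  exists T, forall s t, 1 <= s -> s <= t -> T <= t -> ln (a s) <= ln (a t) + e.
Proof.
move=> e0 er [a0 la] ua; have [X X1 HX] := ua _ e0; have [M HM] := la X.
have r0 : 0 < rho by lra.
have /cvgryPge/(_ (expR M))/nearyP[T _ HT] := uvar_pinfty r0 ua.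
exists (Num.max T X) => s t s1 st; rewrite ge_max => /andP[Tt Xt].
have [sX|/ltW Xs] := leP s X.
  have := HM s; rewrite s1 sX => /(_ isT)/(le_trans (ler_norm _)) h.
  have at0 := a0 t (le_trans s1 st).
  have : M <= ln (a t) by rewrite -[M]expRK ler_ln ?posrE ?expR_gt0// HT.
  lra.
have [_] := HX s t Xs Xt.
have l0 : 0 <= ln t - ln s by rewrite subr_ge0 ler_ln ?posrE; lra.
rewrite (ger0_norm l0) ler_norml => /andP[h _]; nra.
Qed.

Lemma scale_pinfty (c : R) : 0 < c -> c * x @[x --> +oo] --> +oo.
Proof.
move=> c0; apply/cvgryPge => A; apply: filterS (near_ge (A / c)) => x.
by rewrite ler_pdivrMr// mulrC.
Qed.

End composition.

(** The value is t - 1 - ln t, by the primitive s (1 + ln t - ln s). *)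
Lemma Int_ln_le (R : realType) (t : R) : 1 <= t -> Int (fun s => ln t - ln s) 1 t <= t.
Proof.
rewrite le_eqVlt => /predU1P[<-|t1].
  suff -> : Int (fun s : R => ln 1 - ln s) 1 1 = Int (fun=> 0) 1 1 by rewrite Int_cst// mul0r.
  apply: Int_ext => s /andP[s1 s2]; suff -> : s = 1 by rewrite subrr.
  by apply/eqP; rewrite eq_le s1 s2.
pose F := (id : R -> R) * (cst (1 + ln t) - @ln R).
have dF (s : R) : 0 < s -> is_derive s 1 F (ln t - ln s).
  move=> s0; have := is_derive1_ln s0 => dl.
  have d2 := is_deriveB (is_derive_cst (1 + ln t) s 1) dl.
  have H := is_deriveM (is_derive_id s 1) d2.
  apply: (is_derive_eq H); rewrite /GRing.scale/= sub0r mulrN divff ?gt_eqF//.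
  by rewrite /cst mulr1 !fctE; ring.
have cF (s : R) : 0 < s -> {for s, continuous F}.
  move=> s0; apply: differentiable_continuous; apply/derivable1_diffP.
  by have [] := dF s s0.
rewrite /Int /Rintegral (@continuous_FTC2 _ _ F)//=.
- by rewrite /F !fctE/= ln1 /cst; have := ln_ge0 (ltW t1); lra.
- apply: derivable_within_continuous => s; rewrite in_itv/= => /andP[s1 _].
  apply: derivableB; first exact: derivable_cst.
  by have [] := is_derive1_ln (lt_le_trans ltr01 s1).
- split.
  + move=> s; rewrite in_itv/= => /andP[s1 _].
    by have [] := dF s (lt_trans ltr01 s1).
  + by apply: cvg_at_right_filter; exact: cF.
  + by apply: cvg_at_left_filter; apply: cF; exact: lt_trans t1.
- move=> s; rewrite in_itv/= => /andP[s1 _]; rewrite derive1E.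
  by have [_ ->] := dF s (lt_trans ltr01 s1).
Qed.

(** * The functions of the problem *)

Section problem.
Context {R : realType}.
Variables (dl dphi cl cphi : R -> R) (deltal deltaphi gammal gammaphi : R).
Hypothesis st : standing dl dphi cl cphi deltal deltaphi gammal gammaphi.
Local Notation D := (bigD dl dphi).
Local Notation C := (bigC cl cphi).
Local Notation delta := (deltal + deltaphi).
Local Notation gamma := ((gammal + gammaphi) / 2).
Local Notation I1 := (`[(1 : R), +oo[%classic).

(** The integrand of the middle phase is sqrt r times this function. *)
Definition density (t : R) := (Num.sqrt (D t))^-1.
Local Notation phi := density.
Definition quot (t : R) := dphi t / dl t.

Lemma mdl : measurable_fun I1 dl. Proof. by case: st => -[]. Qed.
Lemma mdphi : measurable_fun I1 dphi. Proof. by case: st => _ -[]. Qed.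
Lemma mcl : measurable_fun I1 cl. Proof. by case: st => _ _ -[]. Qed.
Lemma mcphi : measurable_fun I1 cphi. Proof. by case: st => _ _ _ -[]. Qed.
Lemma dl_gt0 t : 1 <= t -> 0 < dl t. Proof. by case: st => -[_ + _] *; auto. Qed.
Lemma dphi_gt0 t : 1 <= t -> 0 < dphi t. Proof. by case: st => _ -[_ + _] *; auto. Qed.
Lemma cl_gt0 t : 1 <= t -> 0 < cl t. Proof. by case: st => _ _ -[_ + _] *; auto. Qed.
Lemma cphi_gt0 t : 1 <= t -> 0 < cphi t. Proof. by case: st => _ _ _ -[_ + _] *; auto. Qed.

Lemma delta_pos : 0 < delta. Proof. by case: st. Qed.
Lemma gamma_ge0 : 0 <= gamma. Proof. case: st => *; lra. Qed.

Lemma uvar_dl : uvar dl (- deltal). Proof. by case: st => /rv_uvar. Qed.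
Lemma uvar_dphi : uvar dphi (- deltaphi). Proof. by case: st => _ /rv_uvar. Qed.

Lemma locbd_dl : locbd dl.
Proof. by apply: locbd_asymp; [exact: dl_gt0|case: st]. Qed.
Lemma locbd_dphi : locbd dphi.
Proof. by apply: locbd_asymp; [exact: dphi_gt0|case: st]. Qed.

Lemma uvar_D : uvar D delta.
Proof.
refine (uvar_eqind _ (uvarV (uvarM uvar_dl uvar_dphi))); ring.
Qed.
Lemma locbd_D : locbd D.
Proof. exact: locbdV (locbdM locbd_dl locbd_dphi). Qed.
Lemma D_gt0 t : 1 <= t -> 0 < D t. Proof. by case: locbd_D => + _; exact. Qed.
Lemma mD : measurable_fun I1 D.
Proof.
apply: measurable_posV; first by move=> x x1; rewrite mulr_gt0 ?dl_gt0 ?dphi_gt0.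
exact: measurable_funM mdl mdphi.
Qed.
Lemma lnDE t : 1 <= t -> ln (D t) = - ln (dl t) - ln (dphi t).
Proof.
by move=> t1; rewrite lnV ?lnM ?posrE ?mulr_gt0 ?dl_gt0 ?dphi_gt0//; ring.
Qed.

Lemma uvar_density : uvar phi (- (delta / 2)).
Proof. exact: uvarV (uvar_sqrt uvar_D). Qed.
Lemma locbd_density : locbd phi.
Proof. exact: locbdV (locbd_sqrt locbd_D). Qed.
Lemma density_gt0 t : 1 <= t -> 0 < phi t. Proof. by case: locbd_density => + _; exact. Qed.
Lemma mdensity : measurable_fun I1 phi.
Proof.
apply: measurable_posV; first by move=> x x1; rewrite sqrtr_gt0 D_gt0.
exact: measurable_pos_sqrt D_gt0 mD.
Qed.
Lemma lndensityE t : 1 <= t -> ln (phi t) = - ln (D t) / 2.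
Proof. by move=> t1; rewrite lnV ?posrE ?sqrtr_gt0 ?D_gt0// ln_sqrt ?D_gt0// mulNr. Qed.

Lemma uvar_quot : uvar quot (deltal - deltaphi).
Proof. by refine (uvar_eqind _ (uvarM uvar_dphi (uvarV uvar_dl))); ring. Qed.
Lemma locbd_quot : locbd quot.
Proof. exact: locbdM locbd_dphi (locbdV locbd_dl). Qed.
Lemma quot_gt0 t : 1 <= t -> 0 < quot t. Proof. by case: locbd_quot => + _; exact. Qed.
Lemma lnquotE t : 1 <= t -> ln (quot t) = ln (dphi t) - ln (dl t).
Proof. by move=> t1; rewrite ln_div ?posrE ?dl_gt0 ?dphi_gt0. Qed.

Lemma C_gt0 t : 1 <= t -> 0 < C t.
Proof. by move=> t1; rewrite invr_gt0 sqrtr_gt0 mulr_gt0 ?cl_gt0 ?cphi_gt0. Qed.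
Lemma uvar_C : uvar C gamma.
Proof.
have [_ _ /rv_uvar ucl /rv_uvar ucphi _ _ _ _ _ _ _ _ _ _] := st.
by refine (uvar_eqind _ (uvarV (uvar_sqrt (uvarM ucl ucphi)))); ring.
Qed.
Lemma mC : measurable_fun I1 C.
Proof.
have h x : 1 <= x -> 0 < cl x * cphi x by move=> x1; rewrite mulr_gt0 ?cl_gt0 ?cphi_gt0.
apply: measurable_posV; first by move=> x x1; rewrite sqrtr_gt0 h.
apply: measurable_pos_sqrt => //; exact: measurable_funM mcl mcphi.
Qed.

(** The comparison with a nondecreasing function enters the proof only through this. *)
Lemma C_almost_mono : exists2 M, 0 <= M & forall s t, 1 <= s -> s <= t ->
  ln (C s) <= ln (C t) + M.
Proof.
have [m mm [[c c0 Hc] [d d0 Hd]]] := C_monotone st.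
exists (Num.max 0 (ln (c * d))); first by rewrite le_max lexx.
move=> s t s1 st'; have t1 : 1 <= t by exact: le_trans st'.
have i u : 1 <= u -> (`[1, +oo[%classic : set R) u by rewrite /= in_itv/= andbT.
have h1 : C s <= c * d * C t.
  apply: le_trans (Hc _ (i _ s1)) _; rewrite -mulrA ler_pM2l//.
  by apply: le_trans (Hd _ (i _ t1)); apply: mm; rewrite ?in_itv/= ?s1 ?t1.
rewrite -ler_ln ?posrE ?C_gt0 ?mulr_gt0 ?C_gt0// in h1.
apply: le_trans h1 _; rewrite lnM ?posrE ?C_gt0 ?mulr_gt0//.
by rewrite addrC lerD2l le_max lexx orbT.
Qed.

(** Local bounds of C follow from almost monotonicity: ln C is bounded above by its value at the right end
    of a segment and below by its value at 1, up to constants. *)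
Lemma locbd_C : locbd C.
Proof.
split=> [|X]; first exact: C_gt0.
have [M M0 HM] := C_almost_mono; pose Y := Num.max 1 X.
exists (`|ln (C 1)| + `|ln (C Y)| + M) => t /andP[t1 tX].
have tY : t <= Y by rewrite le_max tX orbT.
have := HM 1 t (lexx 1) t1; have := HM t Y t1 tY.
have := ler_norm (ln (C 1)); have := ler_norm (ln (C Y)).
have := ler_norm (- ln (C 1)); have := ler_norm (- ln (C Y)); rewrite !normrN.
have := normr_ge0 (ln (C 1)); have := normr_ge0 (ln (C Y)).
move: (ln (C t)) (ln (C 1)) (ln (C Y)) `|ln (C 1)| `|ln (C Y)|.
by move=> *; rewrite ler_norml; apply/andP; split; lra.
Qed.

Lemma C_pinfty : C t @[t --> +oo] --> +oo. Proof. by case: st. Qed.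

(** Bounded factors in the argument change C by bounded factors: almost monotonicity treats u <= v, and
    Potter's bound the other case. *)
Lemma lnC_le (M : R) : exists M', forall u v, 1 <= u -> 1 <= v ->
  ln u <= ln v + M -> ln (C u) <= ln (C v) + M'.
Proof.
have [M1 M10 HM1] := C_almost_mono.
have [M2 M20 HM2] := global_potter locbd_C uvar_C (@ltr01 R).
have g0 := gamma_ge0.
exists (M1 + M2 + (1 + gamma) * `|M|) => u v u1 v1 uv.
have nM := normr_ge0 M.
have [luv|vu] := leP u v.
  apply: le_trans (HM1 u v u1 luv) _; rewrite lerD2l -addrA lerDl addr_ge0// mulr_ge0//; lra.
have := HM2 v u v1 u1.
have l0 : 0 <= ln u - ln v by rewrite subr_ge0 ler_ln ?posrE; lra.
rewrite (ger0_norm l0) ler_norml => /andP[_]; rewrite mul1r => h.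
have lM : ln u - ln v <= `|M| by have := ler_norm M; lra.
move: h lM l0 g0 nM; move: (ln u - ln v) (ln (C u)) (ln (C v)) gamma `|M| => x a b g m.
move=> *; nra.
Qed.

(** Meaningful for large r. *)
Definition kk r := fine (kfun dl dphi r).
(** Meaningful for large r, provided that the quotient is unbounded. *)
Definition hh r := fine (hfun dl dphi r).

Let D2 t := 2 * D t.
Let uvar_D2 : uvar D2 delta.
Proof. by refine (uvar_eqind _ (uvarM (@uvar_cst R 2 ltac:(lra)) uvar_D)); ring. Qed.
Let locbd_D2 : locbd D2.
Proof. exact: locbdM (@locbd_cst R 2 ltac:(lra)) locbd_D. Qed.
Let unb_D2 : unbounded D2.
Proof. exact: unbounded_pinfty (uvar_pinfty delta_pos uvar_D2). Qed.

Lemma kfun_fin : \forall r \near +oo, kfun dl dphi r = (kk r)%:E.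
Proof.
apply: filterS2 (near_ge 1) (ginv_fin locbd_D2 unb_D2) => r r1 h.
by rewrite /kk kfunE; [|lra].
Qed.

Lemma kk_eq : \forall r \near +oo, kk r = fine (ginv D2 r).
Proof. by apply: filterS (near_ge 1) => r r1; rewrite /kk kfunE; [|lra]. Qed.

Lemma kk_pinfty : kk r @[r --> +oo] --> +oo.
Proof.
apply: cvg_trans (ginv_pinfty locbd_D2 unb_D2); apply: near_eq_cvg.
by apply: filterS kk_eq => r ->.
Qed.

Lemma uvar_kk : uvar kk delta^-1.
Proof.
apply: uvar_ext (uvar_ginv delta_pos locbd_D2 uvar_D2).
by apply: filterS kk_eq => r ->.
Qed.

Lemma kk_measurable : exists x0 : R, measurable_fun `[x0, +oo[ kk.
Proof.
have [x0 m] := ginv_measurable locbd_D2 unb_D2.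
have [X _ HX] := iffLR (nearyP _) kk_eq.
exists (Num.max x0 X); apply: eq_measurable_fun; last first.
  apply: measurable_funS m => // x /=.
  by rewrite !in_itv/= !andbT ge_max => /andP[].
by move=> r; rewrite inE/= in_itv/= andbT ge_max => /andP[_ /HX ->].
Qed.

Lemma lt_k_le r t : 0 < r -> 1 <= t -> (t%:E < kfun dl dphi r)%E -> ln 2 + ln (D t) <= ln r.
Proof.
move=> r0 t1; rewrite kfunE// => /ginv_lt/(_ t1).
by rewrite -ler_ln ?lnM ?posrE ?mulr_gt0 ?D_gt0.
Qed.

(** By definition of k, 2 D(k(r)) is asymptotic to r. *)
Lemma lnD_kk : exists2 M, 0 <= M & \forall r \near +oo, `|ln r - ln (D (kk r))| <= M.
Proof.
exists 2 => //; have := ginv_sol locbd_D2 unb_D2 uvar_D2.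
move/cvgrPdist_le => /(_ 1 ltr01) H.
have l2 := @half_le_ln2 R; have l22 : ln (2 : R) <= 1.
  by have := @le_ln1Dx R 1 ltac:(lra); rewrite (_ : 1 + 1 = 2 :> R); [|ring].
near=> r.
have E : kk r = fine (ginv D2 r) by near: r; exact: kk_eq.
have k1 : 1 <= kk r by near: r; move/cvgryPge : kk_pinfty; exact.
have : `|0 - (ln (D2 (fine (ginv D2 r))) - ln r)| <= 1 by near: r.
rewrite -E sub0r normrN /D2 lnM ?posrE ?D_gt0//.
rewrite !ler_norml => /andP[? ?]; apply/andP; split; lra.
Unshelve. all: by end_near. Qed.

(** The quotient dphi / dl need not tend to infinity, nor be bounded; for large r, h(r) is finite exactly
    when the quotient exceeds r somewhere. *)
Lemma hh_cases : (\forall r \near +oo, hfun dl dphi r = +oo%E) \/ unbounded quot.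
Proof.
have [ub|/existsNP[M HM]] := pselect (unbounded quot); first by right.
left; apply: filterS2 (near_ge 1) (near_ge M) => r r1 Mr.
rewrite hfunE; last by lra.
apply: ginv_bounded => s s1; rewrite leNgt; apply/negP => h.
by apply: HM; exists s => //; exact: le_lt_trans h.
Qed.

Lemma hfun_fin : unbounded quot -> \forall r \near +oo, hfun dl dphi r = (hh r)%:E.
Proof.
move=> ub; apply: filterS2 (near_ge 1) (ginv_fin locbd_quot ub) => r r1 h.
by rewrite /hh hfunE; [|lra].
Qed.

Lemma hh_eq : \forall r \near +oo, hh r = fine (ginv quot r).
Proof. by apply: filterS (near_ge 1) => r r1; rewrite /hh hfunE; [|lra]. Qed.

Lemma hh_pinfty : unbounded quot -> hh r @[r --> +oo] --> +oo.
Proof.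
move=> ub; apply: cvg_trans (ginv_pinfty locbd_quot ub); apply: near_eq_cvg.
by apply: filterS hh_eq => r ->.
Qed.

Lemma hh_rv : deltaphi < deltal -> uvar hh (deltal - deltaphi)^-1 /\
  exists x0 : R, measurable_fun `[x0, +oo[ hh.
Proof.
move=> h; have d0 : 0 < deltal - deltaphi by lra.
have ub := unbounded_pinfty (uvar_pinfty d0 uvar_quot).
split.
  apply: uvar_ext (uvar_ginv d0 locbd_quot uvar_quot).
  by apply: filterS hh_eq => r ->.
have [x0 m] := ginv_measurable locbd_quot ub.
have [X _ HX] := iffLR (nearyP _) hh_eq.
exists (Num.max x0 X); apply: eq_measurable_fun; last first.
  apply: measurable_funS m => // x /=.
  by rewrite !in_itv/= !andbT ge_max => /andP[].
by move=> r; rewrite inE/= in_itv/= andbT ge_max => /andP[_ /HX ->].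
Qed.

Lemma lnquot_hh : unbounded quot -> \forall r \near +oo, `|ln r - ln (quot (hh r))| <= 1.
Proof.
move=> ub; have := ginv_sol locbd_quot ub uvar_quot.
move/cvgrPdist_le => /(_ 1 ltr01) H.
near=> r.
have E : hh r = fine (ginv quot r) by near: r; exact: hh_eq.
have : `|0 - (ln (quot (fine (ginv quot r))) - ln r)| <= 1 by near: r.
by rewrite -E sub0r normrN distrC.
Unshelve. all: by end_near. Qed.

(** Beyond the finite value h(r) the quotient exceeds r somewhere nearby, but not necessarily everywhere. *)
Lemma hfun_gt r s : 0 < r -> 1 <= s -> (hfun dl dphi r < s%:E)%E ->
  exists2 x : R, 1 <= x <= s & r < quot x.
Proof. by move=> r0 s1; rewrite hfunE// => /ginv_gt; exact. Qed.

Lemma k_le_h r : 0 < r -> (kfun dl dphi r <= hfun dl dphi r)%E.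
Proof.
move=> r0; rewrite kfunE// hfunE//.
apply: ereal_sup_le => _ [t [t1 Ht] <-]; exists t => //; split=> // s /[dup] /andP[s1 _] /Ht.
have dp := dphi_gt0 s1; have dlp := dl_gt0 s1; have dp1 := dphi_le1 st s1.
rewrite /D2 /bigD ler_pdivrMr ?mulr_gt0// => h; rewrite ler_pdivrMr//.
have : r * (dl s * dphi s) <= r * dl s by rewrite ler_pM2l// ger_pMr.
lra.
Qed.

(** * The integrand and its integral *)

Local Notation kfun := (kfun dl dphi).
Local Notation hfun := (hfun dl dphi).
Local Notation gfun := (gfun dl dphi).
Local Notation gint := (gint dl dphi).
Local Notation Bf := (Bfun dl dphi cl cphi).
Local Notation Bi := (Binf dl dphi cl cphi).
Local Notation lphi := locbd_density.
Local Notation mphi := mdensity.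
Local Notation uphi := uvar_density.
Local Notation ldl := locbd_dl.
Local Notation udl := uvar_dl.

Lemma gfun_lo r s : 0 < r -> 1 <= s -> (s%:E < kfun r)%E -> gfun s r = ln r - ln (D s).
Proof.
move=> r0 s1 sk; rewrite /Defs.gfun sk lnDE//.
by rewrite !lnM ?posrE ?mulr_gt0 ?dl_gt0 ?dphi_gt0//; ring.
Qed.

Lemma gfun_mid r s : 1 <= s -> (kfun r <= s%:E)%E -> (s%:E < hfun r)%E ->
  gfun s r = Num.sqrt r * phi s.
Proof.
by move=> s1 ks sh; rewrite /Defs.gfun ltNge ks/= sh /density /bigD sqrtrV ?invrK// ltW// mulr_gt0 ?dl_gt0 ?dphi_gt0.
Qed.

Lemma gfun_hi r s : 0 < r -> (hfun r <= s%:E)%E -> gfun s r = r * dl s.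
Proof.
move=> r0 hs; rewrite /Defs.gfun !ltNge hs/=.
by rewrite (le_trans (k_le_h r0) hs).
Qed.

(** Before k(r) one has r >= 2 D(s), so the logarithm is at least ln 2. *)
Lemma gfun_lo_ge r s : 0 < r -> 1 <= s -> (s%:E < kfun r)%E -> 2^-1 <= gfun s r.
Proof.
move=> r0 s1 sk; rewrite gfun_lo//; have := lt_k_le r0 s1 sk.
have := @half_le_ln2 R; lra.
Qed.

Lemma gfun_ge0 r s : 0 < r -> 1 <= s -> 0 <= gfun s r.
Proof.
move=> r0 s1; case: (ltP s%:E (kfun r)) => ks.
  have := gfun_lo_ge r0 s1 ks; lra.
case: (ltP s%:E (hfun r)) => hs.
  by rewrite gfun_mid// mulr_ge0 ?sqrtr_ge0// ltW ?density_gt0.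
by rewrite gfun_hi// mulr_ge0 ?ltW ?dl_gt0.
Qed.

Lemma intb_dl : intb dl.
Proof. exact: locbd_intb locbd_dl mdl. Qed.

Lemma intb_density : intb phi.
Proof. exact: locbd_intb locbd_density mdensity. Qed.

Lemma intb_gfun r : 0 < r -> intb (gfun ^~ r).
Proof.
move=> r0; split=> [|s|X]; last 2 first.
- exact: gfun_ge0.
- have [_ _ /(_ X)[M1 HM1]] := intb_dl; have [_ _ /(_ X)[M2 HM2]] := intb_density.
  have [_ /(_ X)[M3 HM3]] := locbd_D.
  exists (Num.max (r * M1) (Num.max (Num.sqrt r * M2) (ln r + M3))).
  move=> s /[dup] sX /andP[s1 _]; rewrite !le_max.
  case: (ltP s%:E (kfun r)) => ks.
    rewrite gfun_lo//; have := HM3 s sX; rewrite ler_norml => /andP[? _].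
    by apply/orP; right; apply/orP; right; lra.
  case: (ltP s%:E (hfun r)) => hs.
    by rewrite gfun_mid// (ler_wpM2l (sqrtr_ge0 r))// ?HM2// orbT.
  by rewrite gfun_hi// ler_pM2l// HM1.
have mlt (e : \bar R) : measurable_fun I1 (fun s : R => (s%:E < e)%E).
  apply: measurable_fun_lte; last exact: measurable_cst.
  by apply: measurable_funTS; exact: EFin_measurable.
rewrite /Defs.gfun; apply: measurable_fun_if => //.
  apply: measurable_funS (_ : measurable_fun I1 _) => //.
  apply: measurableT_comp => //; apply: measurable_funM; last exact: mdphi.
  by apply: measurable_funM; [exact: measurable_cst|exact: mdl].
apply: measurable_funS (_ : measurable_fun I1 _) => //.
apply: measurable_fun_if => //.
  apply: measurable_funS (_ : measurable_fun I1 _) => //.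
  apply: measurable_funM; first exact: measurable_cst.
  apply: measurable_pos_sqrt; first by move=> x x1; rewrite mulr_gt0 ?dl_gt0 ?dphi_gt0.
  exact: measurable_funM mdl mdphi.
apply: measurable_funS (_ : measurable_fun I1 _) => //.
by apply: measurable_funM; [exact: measurable_cst|exact: mdl].
Qed.

Lemma gintE t r : gint t r = Int (gfun ^~ r) 1 t. Proof. by []. Qed.

Lemma gint_mono r s t : 0 < r -> 1 <= s -> s <= t -> gint s r <= gint t r.
Proof. by move=> r0 s1 st'; rewrite !gintE Int_mono//; exact: intb_gfun. Qed.

Lemma gint_ge0 r t : 0 < r -> 0 <= gint t r.
Proof. by move=> r0; rewrite gintE Int_ge0//; exact: intb_gfun. Qed.

Lemma Binf_le r t : 0 < r -> 1 <= t -> Bi r <= Bf t r.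
Proof.
move=> r0 t1; apply: ge_inf; last by exists t => //=; rewrite in_itv/= andbT.
exists 0; move=> ? [s /=]; rewrite in_itv/= andbT => s1 <-.
by rewrite /Bfun le_max gint_ge0.
Qed.

(** Arguments s >= t are handled by monotonicity of gint, arguments s <= t by almost monotonicity of C. *)
Lemma Binf_ge : exists2 c, 0 < c & forall r t m, 0 < r -> 1 <= t -> 0 < m ->
  m <= gint t r -> m <= r / C t -> c * m <= Bi r.
Proof.
have [M M0 HM] := C_almost_mono.
exists (expR (- M)); first exact: expR_gt0.
move=> r t m r0 t1 m0 mg mC; apply: lb_le_inf.
  by exists (Bf 1 r); exists 1 => //=; rewrite in_itv/= lexx.
move=> ? [s /=]; rewrite in_itv/= andbT => s1 <-; rewrite /Bfun le_max.
have e1 : expR (- M) <= 1 by rewrite -expR0 ler_expR lerNl oppr0.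
have [ts|/ltW sl] := leP t s.
  apply/orP; left; apply: le_trans (gint_mono r0 t1 ts); apply: le_trans mg.
  by rewrite ger_pMl.
apply/orP; right; apply: (@le_trans _ _ (expR (- M) * (r / C t))).
  by rewrite ler_pM2l// expR_gt0.
rewrite mulrCA ler_pM2l//.
have Cs := C_gt0 s1; have Ct := C_gt0 t1.
rewrite -[C t]lnK ?posrE// -[C s]lnK ?posrE// -!expRN -expRD ler_expR.
have := HM s t s1 sl; lra.
Qed.

Lemma lnD_le_k : exists2 M, 0 <= M & \forall r \near +oo, forall t, 1 <= t ->
  (t%:E <= kfun r)%E -> ln (D t) <= ln r + M.
Proof.
have [M M0 HM] := lnD_kk; exists M => //.
near=> r => t t1; have r0 : 0 < r by near: r; exact: nbhs_pinfty_gt.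
have -> : kfun r = (kk r)%:E by near: r; exact: kfun_fin.
have : `|ln r - ln (D (kk r))| <= M by near: r.
rewrite ler_norml lee_fin => /andP[h _]; rewrite le_eqVlt => /orP[/eqP->|tk]; first by lra.
have : (t%:E < kfun r)%E.
  suff -> : kfun r = (kk r)%:E by rewrite lte_fin.
  by near: r; exact: kfun_fin.
by move=> /(lt_k_le r0 t1); have := @half_le_ln2 R; lra.
Unshelve. all: by end_near. Qed.

(** Potter's bound compares ln D(s) with ln D(t) at the cost of (delta + 1) (ln t - ln s), whose
    integral is at most a multiple of t. *)
Lemma gint_lo_le : exists2 M, 0 <= M & \forall r \near +oo, forall t, 1 <= t ->
  (t%:E <= kfun r)%E -> gint t r <= t * (ln r - ln (D t) + M).
Proof.
have [M0 M00 HM0] := global_potter locbd_D uvar_D (@ltr01 R).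
have [M1 M10 HM1] := lnD_le_k.
have d0 := delta_pos.
exists (M0 + M1 + delta + 1); first by lra.
near=> r => t t1 tk; have r0 : 0 < r by near: r; exact: nbhs_pinfty_gt.
have h1 : ln (D t) <= ln r + M1.
  by move: t t1 tk; near: r.
pose x := ln r - ln (D t) + M0 + M1.
have x0 : 0 <= x by rewrite /x; lra.
have i1 : intb (fun=> x) by exact: intb_cst.
have i2 : intb (fun s : R => (delta + 1) * Num.max 0 (ln t - ln s)).
  apply: intb_scale; first by lra.
  split=> [|s s1|X].
  - apply: measurable_maxr; first exact: measurable_cst.
    apply: measurable_funB; first exact: measurable_cst.
    exact: measurable_funTS.
  - by rewrite le_max lexx.
  - exists (ln t) => s /andP[s1 _]; rewrite ge_max ln_ge0//=.
    by have := ln_ge0 s1; lra.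
rewrite gintE; apply: (@le_trans _ _ (Int (fun s => x + (delta + 1) * Num.max 0 (ln t - ln s)) 1 t)).
  apply: Int_le => //; [exact: intb_gfun|exact: intb_add|].
  move=> s /andP[s1 st'].
  have sk : (s%:E < kfun r)%E by apply: lt_le_trans tk; rewrite lte_fin.
  have l0 : 0 <= ln t - ln s by rewrite subr_ge0 ler_ln ?posrE; lra.
  rewrite gfun_lo// (max_idPr l0).
  have := HM0 s t s1 t1; rewrite (ger0_norm l0) ler_norml /x => /andP[_]; lra.
rewrite Int_add//.
have -> : Int (fun s => (delta + 1) * Num.max 0 (ln t - ln s)) 1 t =
   (delta + 1) * Int (fun s => ln t - ln s) 1 t.
  rewrite Int_scale//; last first.
    move: i2 => [m2 p2 b2]; split=> [|s s1|X].
    - apply: measurable_maxr; first exact: measurable_cst.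
      apply: measurable_funB; first exact: measurable_cst.
      exact: measurable_funTS.
    - by rewrite le_max lexx.
    - exists (ln t) => s /andP[s1 _]; rewrite ge_max ln_ge0//=.
      by have := ln_ge0 s1; lra.
  congr (_ * _); apply: Int_ext => s /andP[s1 st'].
  by rewrite max_r// subr_ge0 ler_ln ?posrE; lra.
have h2 := Int_ln_le t1.
have -> : Int (fun=> x) 1 t = x * (t - 1) by rewrite Int_cst.
have h3 : (delta + 1) * Int (fun s => ln t - ln s) 1 t <= (delta + 1) * t.
  by rewrite ler_pM2l//; lra.
rewrite /x in x0 *; nra.
Unshelve. all: by end_near. Qed.

(** Lower bounds of the integral only use the window [t/2, t], on which all functions involved are
    constant up to factors. *)
Lemma gint_ge_window r t m : 0 < r -> 2 <= t -> 0 <= m ->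
  (forall s, 1 <= s -> t <= 2 * s -> s <= 2 * t -> s < t -> m <= gfun s r) ->
  m * (t / 2) <= gint t r.
Proof.
move=> r0 t2 m0 H; rewrite gintE; have big := intb_gfun r0.
have {}H s : t / 2 <= s < t -> m <= gfun s r by case/andP=> ? ?; apply: H => //; lra.
apply: (@le_trans _ _ (Int (gfun ^~ r) (t / 2) t)); last by apply: Int_monol => //; lra.
rewrite [X in m * X](_ : t / 2 = t - t / 2); last by field.
by apply: Int_ge_cst => //; lra.
Qed.

(** On [t/2, t] the integrand differs from x = ln (r / D(t)) by at most M and is at least 1/2, hence it is
    at least a fixed multiple of x, whether x is large or not. *)
Lemma gint_lo_ge : exists2 c, 0 < c & \forall r \near +oo, forall t, 2 <= t ->
  (t%:E <= kfun r)%E -> c * t * (ln r - ln (D t)) <= gint t r.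
Proof.
have [M M0 HM] := potter_window locbd_D uvar_D.
pose c := (2 * (M + 1))^-1.
have c0 : 0 < c by rewrite invr_gt0; lra.
have cM : c * (M + 1) = 2^-1 by rewrite /c; field; rewrite gt_eqF; lra.
have c1 : c <= 2^-1 by rewrite lef_pV2 ?posrE; lra.
have aux (a b d : R) : 0 < a - b -> 2^-1 <= a - d -> d - b <= M -> c * (a - b) <= a - d.
  by move=> *; have [y|y] := leP (a - b) (M + 1); nra.
exists (c / 2); first by rewrite divr_gt0.
near=> r => t t2 tk; have r0 : 0 < r by near: r; exact: nbhs_pinfty_gt.
have [x0|x0] := leP (ln r - ln (D t)) 0.
  apply: (@le_trans _ _ 0); last exact: gint_ge0.
  by rewrite mulr_ge0_le0// mulr_ge0// ?divr_ge0//; lra.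
rewrite (_ : c / 2 * t * (ln r - ln (D t)) = (c * (ln r - ln (D t))) * (t / 2)); last by field.
apply: gint_ge_window => //; first by rewrite mulr_ge0 ?ltW.
move=> s s1 ts st' slt.
have sk : (s%:E < kfun r)%E by apply: lt_le_trans tk; rewrite lte_fin.
have h1 := gfun_lo_ge r0 s1 sk.
have := HM t s (le_trans (ler1n _ 2) t2) s1 ts st'.
rewrite gfun_lo// in h1 *; rewrite ler_norml => /andP[_ h2].
move: x0 h1 h2; move: (ln r) (ln (D t)) (ln (D s)) => a b d x0 h1 h2.
exact: aux.
Unshelve. all: by end_near. Qed.

Lemma gint_k_ge : \forall r \near +oo, kk r / 4 <= gint (kk r) r.
Proof.
near=> r; have r0 : 0 < r by near: r; exact: nbhs_pinfty_gt.
have kE : kfun r = (kk r)%:E by near: r; exact: kfun_fin.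
have k2 : 2 <= kk r by near: r; exact: pinfty_ge kk_pinfty.
rewrite (_ : kk r / 4 = 2^-1 * (kk r / 2)); last by field.
apply: gint_ge_window => // s s1 _ _ sk.
by apply: gfun_lo_ge => //; rewrite kE lte_fin.
Unshelve. all: by end_near. Qed.

Lemma gint_k_le : exists2 M, 0 <= M & \forall r \near +oo, gint (kk r) r <= M * kk r.
Proof.
have [M M0 HM] := gint_lo_le; have [N N0 HN] := lnD_kk.
exists (M + N); first by rewrite addr_ge0.
near=> r.
have kE : kfun r = (kk r)%:E by near: r; exact: kfun_fin.
have k1 : 1 <= kk r by near: r; exact: pinfty_ge kk_pinfty.
have H : forall t, 1 <= t -> (t%:E <= kfun r)%E -> gint t r <= t * (ln r - ln (D t) + M).
  by near: r.
apply: le_trans (H _ k1 _) _; first by rewrite kE.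
rewrite mulrC ler_pM2r; last by lra.
have : `|ln r - ln (D (kk r))| <= N by near: r.
rewrite ler_norml; lra.
Unshelve. all: by end_near. Qed.

(** Since D(k(r)) is about r, k(r) is about sqrt r k(r) / sqrt D(k(r)), which is at most a multiple of
    the middle integral up to k(r). *)
Lemma kk_le_Int : exists2 c, 0 < c &
  \forall r \near +oo, kk r <= c * (Num.sqrt r * Int phi 1 (kk r)).
Proof.
have [N N0 HN] := lnD_kk.
have [A HA] := ln_Int_ge locbd_density mdensity uvar_density.
have aux2 (lr lk lD lF : R) : lk + - lD / 2 <= lF + A -> lr - lD >= - N ->
  lk <= lr / 2 + lF + (A + N) by move=> *; lra.
exists (expR (A + N)); first exact: expR_gt0.
near=> r; have r0 : 0 < r by near: r; exact: nbhs_pinfty_gt.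
have k2 : 2 <= kk r by near: r; exact: pinfty_ge kk_pinfty.
have k1 : 1 <= kk r by near: r; exact: pinfty_ge kk_pinfty.
have k0 : 0 < kk r by exact: lt_le_trans k1.
have sr : 0 < Num.sqrt r by rewrite sqrtr_gt0.
have h : `|ln r - ln (D (kk r))| <= N by near: r.
have [Fk hk] := HA _ k2.
rewrite ler_expRM ?mulr_gt0// (@lnM _ (Num.sqrt r)) ?posrE// ln_sqrt//.
move: hk h; rewrite (lndensityE k1) ler_norml => hk /andP[h _].
exact: aux2 hk h.
Unshelve. all: by end_near. Qed.

Lemma gint_mid_le : exists2 M, 0 <= M & \forall r \near +oo, forall t,
  kk r <= t -> (t%:E <= hfun r)%E -> gint t r <= M * kk r + Num.sqrt r * Int phi (kk r) t.
Proof.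
have [M M0 HM] := gint_k_le; exists M => //.
near=> r => t kt th; have r0 : 0 < r by near: r; exact: nbhs_pinfty_gt.
have kE : kfun r = (kk r)%:E by near: r; exact: kfun_fin.
have k1 : 1 <= kk r by near: r; exact: pinfty_ge kk_pinfty.
have big := intb_gfun r0; have bphi := intb_density.
rewrite gintE (Int_chasles big (lexx 1) k1 kt) -gintE; apply: lerD; first by near: r.
rewrite -Int_scale//; apply: Int_le => //; first exact: intb_scale (sqrtr_ge0 _) bphi.
move=> s /andP[ks st']; rewrite gfun_mid//.
- exact: le_trans ks.
- by rewrite kE lee_fin.
- by apply: lt_le_trans th; rewrite lte_fin.
Unshelve. all: by end_near. Qed.

Lemma gint_hi_le : exists2 M, 0 <= M & \forall r \near +oo, forall h t,
  hfun r = h%:E -> h <= t ->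
  gint t r <= M * kk r + Num.sqrt r * Int phi (kk r) h + r * Int dl h t.
Proof.
have [M M0 HM] := gint_mid_le; exists M => //.
near=> r => h t hE ht; have r0 : 0 < r by near: r; exact: nbhs_pinfty_gt.
have kE : kfun r = (kk r)%:E by near: r; exact: kfun_fin.
have k1 : 1 <= kk r by near: r; exact: pinfty_ge kk_pinfty.
have kh : kk r <= h by rewrite -lee_fin -kE -hE k_le_h.
have h1 : 1 <= h by exact: le_trans kh.
have big := intb_gfun r0; have bdl := intb_dl.
rewrite gintE (Int_chasles big (lexx 1) h1 ht) -gintE; apply: lerD.
  have H : forall t, kk r <= t -> (t%:E <= hfun r)%E ->
     gint t r <= M * kk r + Num.sqrt r * Int phi (kk r) t by near: r.
  by apply: H; rewrite ?hE.
rewrite -Int_scale//; apply: Int_le => //; first exact: intb_scale (ltW r0) bdl.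
by move=> s /andP[hs _]; rewrite gfun_hi// hE lee_fin.
Unshelve. all: by end_near. Qed.

(** The hypotheses place t, up to a constant M, between k(r) and h(r).  The window [t/2, t] may
    reach into any of the three phases, but in each of them the integrand is comparable from below
    with its middle expression at t. *)
Lemma gint_mid_ge (M : R) : exists2 c, 0 < c & forall r t, 0 < r -> 2 <= t ->
  ln r <= ln (D t) + M -> ln (quot t) <= ln r + M ->
  c * t * (Num.sqrt r * phi t) <= gint t r.
Proof.
have [M1 M10 HM1] := potter_window locbd_density uvar_density.
have [M2 M20 HM2] := potter_window locbd_dl uvar_dl.
pose K := `|M| + ln 2 + M1 + M2.
have nM0 := normr_ge0 M; have nM := ler_norm M.
have l2 := @half_le_ln2 R.
exists (expR (- K) / 2); first by rewrite divr_gt0// expR_gt0.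
move=> r t r0 t2 hD hq.
have t1 : 1 <= t by lra.
have sp : 0 < Num.sqrt r * phi t by rewrite mulr_gt0 ?sqrtr_gt0// density_gt0.
rewrite (_ : expR (- K) / 2 * t * (Num.sqrt r * phi t) =
   (expR (- K) * (Num.sqrt r * phi t)) * (t / 2)); last by field.
apply: gint_ge_window => //; first by rewrite mulr_ge0 ?expR_ge0// ltW.
move=> s s11 ts st' _.
have lsp : ln (Num.sqrt r * phi t) = ln r / 2 - ln (D t) / 2.
  by rewrite lnM ?posrE ?sqrtr_gt0 ?density_gt0// ln_sqrt// lndensityE// mulNr.
rewrite -[X in expR _ * X]lnK ?posrE// -expRD lsp.
have ge_ln y : 0 < y -> - K + (ln r / 2 - ln (D t) / 2) <= ln y ->
    expR (- K + (ln r / 2 - ln (D t) / 2)) <= y.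
  by move=> y0 h; rewrite -[leRHS]lnK ?posrE// ler_expR.
case: (ltP s%:E (kfun r)) => ks.
  apply: le_trans (gfun_lo_ge r0 s11 ks).
  have lV : ln (2^-1 : R) = - ln 2 by rewrite lnV// posrE.
  by apply: ge_ln => //; rewrite lV /K; lra.
case: (ltP s%:E (hfun r)) => hs.
  rewrite gfun_mid//; apply: ge_ln.
    by rewrite mulr_gt0 ?sqrtr_gt0// density_gt0.
  rewrite lnM ?posrE ?sqrtr_gt0 ?density_gt0// ln_sqrt//.
  have := HM1 t s t1 s11 ts st'.
  rewrite (lndensityE t1) ler_norml => /andP[h _]; rewrite /K; lra.
rewrite gfun_hi//; apply: ge_ln; first by rewrite mulr_gt0// dl_gt0.
rewrite lnM ?posrE ?dl_gt0//.
have := HM2 t s t1 s11 ts st'.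
move: hq; rewrite lnquotE// lnDE// ler_norml => hq /andP[h _]; rewrite /K; lra.
Qed.

(** * The balance point lies in the logarithmic phase *)

Lemma mCV : measurable_fun I1 (fun x => (C x)^-1).
Proof. exact: measurable_posV C_gt0 mC. Qed.

Lemma rv_div_C b beta (x0 : R) : uvar b beta -> b x @[x --> +oo] --> +oo ->
  measurable_fun `[x0, +oo[ b ->
  regularly_varying (fun r => r / C (b r)) (1 - gamma * beta).
Proof.
move=> ub boo mb; have [x1 m1] := measurable_comp_pinfty mCV mb boo.
apply: (@uvar_rv _ _ _ x1).
  by apply: uvarM (@uvar_id R) _; apply: uvarV; exact: uvar_comp uvar_C ub boo.
by apply: measurable_funM.
Qed.

(** Points at which C takes comparable values give comparable bounds. *)
Lemma asymp_div_C (u v : R -> R) (M : R) :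
  (\forall r \near +oo, [/\ 1 <= u r, 1 <= v r & `|ln (C (u r)) - ln (C (v r))| <= M]) ->
  asymp_oo (fun r => r / C (u r)) (fun r => r / C (v r)).
Proof.
move=> H; split; apply: (@lesssim_ln _ _ _ M); near=> r;
  (have [u1 v1 h] : [/\ 1 <= u r, 1 <= v r & `|ln (C (u r)) - ln (C (v r))| <= M] by near: r);
  (have r0 : 0 < r by near: r; exact: nbhs_pinfty_gt);
  rewrite !divr_gt0 ?C_gt0//; split => //;
  rewrite !ln_div ?posrE ?C_gt0//;
  by move: h; rewrite ler_norml => /andP[? ?]; lra.
Unshelve. all: by end_near. Qed.

Section balance.
Variable alpha : R.
Hypothesis alpha0 : 0 < alpha.
Hypothesis hA : forall t, 1 <= t -> 4 * D t <= alpha * (t * C t).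

Let Y t := alpha * (t * C t / D t).
Let f t := t * C t * ln (alpha * (t * C t / D t)).

Let tC_gt0 t : 1 <= t -> 0 < t * C t. Proof. by move=> t1; rewrite mulr_gt0 ?C_gt0//; lra. Qed.

Let Y4 t : 1 <= t -> 4 <= Y t.
Proof. by move=> t1; rewrite /Y mulrA ler_pdivlMr ?D_gt0// hA. Qed.

Let uvar_tC : uvar (fun t => t * C t) (1 + gamma).
Proof. exact: uvarM (@uvar_id R) uvar_C. Qed.

Let locbd_tC : locbd (fun t => t * C t).
Proof. exact: locbdM (@locbd_id R) locbd_C. Qed.

Let uvar_Y : uvar Y (1 + gamma - delta).
Proof.
refine (uvar_eqind _ (uvarM (uvar_cst alpha0) (uvarM uvar_tC (uvarV uvar_D)))); ring.
Qed.

Let locbd_Y : locbd Y.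
Proof.
by apply: locbdM; [exact: locbd_cst|exact: locbdM locbd_tC (locbdV locbd_D)].
Qed.

Let ln4 : 1 <= ln (4 : R).
Proof.
rewrite (_ : 4 = 2 * 2 :> R) ?lnM ?posrE//; last by ring.
by have := @half_le_ln2 R; lra.
Qed.

(** The factor 4 in the choice of alpha makes the logarithm in f at least 1, and its own logarithm
    nonnegative. *)
Let w1 t : 1 <= t -> 1 <= ln (Y t).
Proof.
move=> t1; apply: le_trans ln4 _; have := Y4 t1 => h.
by rewrite ler_ln ?posrE//; lra.
Qed.

(** Otherwise Y would tend to 0, whereas Y >= 4. *)
Let rhoY_ge0 : 0 <= 1 + gamma - delta.
Proof.
rewrite leNgt; apply/negP => h.
have h' : 0 < - (1 + gamma - delta) by lra.
have /cvgryPge/(_ 1)/nearyP[X X1 HX] := uvar_pinfty h' (uvarV uvar_Y).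
have := HX X (lexx X); have := Y4 X1 => y4.
rewrite invf_ge1; lra.
Qed.

Let uvar_w : uvar (fun t => ln (Y t)) 0.
Proof.
apply: (@uvar_ln _ _ _ 4 rhoY_ge0 _ uvar_Y); first by lra.
by apply: filterS (near_ge 1) => x; exact: Y4.
Qed.

Let locbd_w : locbd (fun t => ln (Y t)).
Proof.
split=> [x x1|X]; first by have := w1 x1; lra.
have [_ /(_ X)[M HM]] := locbd_Y; exists M => x /[dup] /andP[x1 _] xX.
have h := w1 x1; rewrite ger0_norm ?ln_ge0//.
apply: le_trans (le_trans (ler_norm _) (HM x xX)); apply/ltW/ln_sublinear; lra.
Qed.

Let uvar_f : uvar f (1 + gamma).
Proof. by refine (uvar_eqind _ (uvarM uvar_tC uvar_w)); rewrite addr0. Qed.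

Let locbd_f : locbd f.
Proof. exact: locbdM locbd_tC locbd_w. Qed.

Let mf : measurable_fun I1 f.
Proof.
apply: measurable_funM; first by apply: measurable_funM => //; exact: mC.
apply: measurableT_comp => //; apply: measurable_funM => //.
apply: measurable_funM; first by apply: measurable_funM => //; exact: mC.
exact: measurable_posV D_gt0 mD.
Qed.

Let gamma1 : 0 < 1 + gamma. Proof. have := gamma_ge0; lra. Qed.

Lemma balance_inverse_ex : exists fm : R -> R, asymptotic_inverse f fm.
Proof. exact: asymptotic_inverse_ex gamma1 locbd_f uvar_f mf. Qed.

Lemma uvar_balance : uvar f (1 + gamma). Proof. exact: uvar_f. Qed.

(** The equation f(tau) = r / alpha, taken in logarithms up to 1/4, compares t ln Y(t) with r / C(t), and
    shows that ln (r / D(t)) is comparable with ln Y(t). *)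
Let log_solution (lr lt lC lD la w lw : R) : w = la + (lt + lC - lD) ->
  1 <= w -> 0 <= lw -> lw <= w -> - 4^-1 <= lt + lC + lw - (- la + lr) <= 4^-1 ->
  [/\ lt + lw <= lr - lC + (4^-1 - la), lr - lC + (- 4^-1 - la) <= lt + lw,
      lr - lD <= 3 * w & 3 / 4 * w <= lr - lD].
Proof. by move=> -> ? ? ? /andP[? ?]; split; lra. Qed.

(** The factor 4 in the choice of alpha places the balance point below k(r): there 2 D(s) <= r. *)
Let below_k (la ls lCs lDs lt lC lr lw l2 : R) : 2^-1 <= l2 -> 0 <= lw ->
  lt + lC + lw - (- la + lr) <= 4^-1 -> l2 + l2 + lDs <= la + (ls + lCs) ->
  ls + lCs <= lt + lC + 4^-1 -> l2 + lDs <= lr.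
Proof. by move=> *; lra. Qed.

Section inverse.
Variable fm : R -> R.
Hypothesis inv : asymptotic_inverse f fm.
Let tau r := fm (alpha^-1 * r).

Let aV : 0 < alpha^-1. Proof. by rewrite invr_gt0. Qed.

Let foo : fm r @[r --> +oo] --> +oo.
Proof. by have [] := asymptotic_inverseP gamma1 uvar_f inv. Qed.

Let tauoo : tau r @[r --> +oo] --> +oo.
Proof. exact: cvg_comp (scale_pinfty aV) foo. Qed.

Let tau_below_k : \forall r \near +oo, ((tau r)%:E <= kfun r)%E /\
  [/\ tau r * ln (Y (tau r)) <= expR (4^-1 - ln alpha) * (r / C (tau r)),
      expR (- 4^-1 - ln alpha) * (r / C (tau r)) <= tau r * ln (Y (tau r)),
      ln r - ln (D (tau r)) <= 3 * ln (Y (tau r)) &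
      3 / 4 * ln (Y (tau r)) <= ln r - ln (D (tau r))].
Proof.
have [_ _ fsol _] := asymptotic_inverseP gamma1 uvar_f inv.
have tausol : ln (f (tau r)) - ln (alpha^-1 * r) @[r --> +oo] --> 0.
  exact: (cvg_comp _ _ (scale_pinfty aV) fsol).
have q0 : 0 < 4^-1 :> R by rewrite invr_gt0.
have q1 : 4^-1 <= 1 + gamma by have := gamma_ge0; lra.
have [T HT] := uvar_almost_mono q0 q1 locbd_tC uvar_tC.
have ln4E : ln (4 : R) = ln 2 + ln 2 by rewrite (_ : 4 = 2 * 2 :> R) ?lnM ?posrE//; ring.
near=> r.
have r0 : 0 < r by near: r; exact: nbhs_pinfty_gt.
have t1 : 1 <= tau r by near: r; exact: pinfty_ge tauoo.
have tT : T <= tau r by near: r; exact: pinfty_ge tauoo.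
have sol : `|0 - (ln (f (tau r)) - ln (alpha^-1 * r))| <= 4^-1.
  by near: r; move/cvgrPdist_le : tausol; exact.
move: t1 tT sol; set t := tau r => t1 tT.
have t0 : 0 < t by exact: lt_le_trans t1.
have Ct := C_gt0 t1; have Dt := D_gt0 t1; have wt := w1 t1; have tC0 := tC_gt0 t1.
have w0 : 0 < ln (Y t) by exact: lt_le_trans wt.
have lf : ln (f t) = ln t + ln (C t) + ln (ln (Y t)).
  by rewrite /f -/(Y t) (@lnM _ (t * C t)) ?posrE// (@lnM _ t) ?posrE.
have lY : ln (Y t) = ln alpha + (ln t + ln (C t) - ln (D t)).
  have q : 0 < t * C t / D t by rewrite divr_gt0.
  by rewrite /Y (@lnM _ alpha) ?posrE// (@ln_div _ (t * C t)) ?posrE// (@lnM _ t) ?posrE.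
rewrite lf (@lnM _ alpha^-1) ?posrE// (lnV alpha0) sub0r normrN ler_norml => sol.
have lw0 : 0 <= ln (ln (Y t)) by rewrite ln_ge0.
have lw1 : ln (ln (Y t)) <= ln (Y t) by apply/ltW/ln_sublinear.
have [up lo h3 h4] := log_solution lY wt lw0 lw1 sol.
have rC0 : 0 < r / C t by rewrite divr_gt0.
have lrC : ln (r / C t) = ln r - ln (C t) by rewrite (@ln_div _ r) ?posrE.
have tw0 : 0 < t * ln (Y t) by rewrite mulr_gt0.
have ltw : ln (t * ln (Y t)) = ln t + ln (ln (Y t)) by rewrite (@lnM _ t) ?posrE.
split; last first.
  split => //; first by rewrite ler_expRM// ltw lrC.
  by rewrite expRM_ler// ltw lrC.
rewrite kfunE//; apply: ginv_ge => // s /andP[s1 st'].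
have Ds := D_gt0 s1; have Cs := C_gt0 s1; have sC0 := tC_gt0 s1.
have s0 : 0 < s by exact: lt_le_trans s1.
have p4 : 0 < 4 :> R by [].
have h : ln (4 * D s) <= ln (alpha * (s * C s)) by rewrite ler_ln ?posrE ?mulr_gt0// hA.
have h5 := HT s t s1 st' tT.
rewrite (@lnM _ 4) ?posrE// (@lnM _ alpha) ?posrE// (@lnM _ s) ?posrE// ln4E in h.
rewrite (@lnM _ s) ?posrE// (@lnM _ t) ?posrE// in h5.
rewrite -ler_ln ?posrE ?mulr_gt0// (@lnM _ 2) ?posrE//.
case/andP: sol => _ sol; exact: below_k (@half_le_ln2 R) lw0 sol h h5.
Unshelve. all: by end_near. Qed.

Let Bfun_tau : exists c K, [/\ 0 < c, 0 < K & \forall r \near +oo, [/\ 1 <= tau r,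
  Bf (tau r) r <= K * (r / C (tau r)), c * (r / C (tau r)) <= gint (tau r) r &
  c * (r / C (tau r)) <= r / C (tau r)]].
Proof.
have [M M0 HM] := gint_lo_le; have [c c0 Hc] := gint_lo_ge.
pose K := Num.max 1 ((3 + M) * expR (4^-1 - ln alpha)).
pose c1 := Num.min 1 (3 / 4 * c * expR (- 4^-1 - ln alpha)).
have K0 : 0 < K by rewrite lt_max ltr01.
have M3 : 0 < 3 + M by rewrite ltr_pwDl.
have c34 : 0 < 3 / 4 * c by rewrite mulr_gt0.
have c10 : 0 < c1 by rewrite lt_min ltr01/= mulr_gt0// expR_gt0.
have aux (x w : R) : 1 <= w -> x <= 3 * w -> x + M <= (3 + M) * w.
  by move=> w1' hx; have := ler_wpM2l M0 w1'; lra.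
exists c1, K; split => //; near=> r.
have r0 : 0 < r by near: r; exact: nbhs_pinfty_gt.
have t2 : 2 <= tau r by near: r; exact: pinfty_ge tauoo.
have t1 : 1 <= tau r by near: r; exact: pinfty_ge tauoo.
have [tk [up lo hi3 hi4]] : ((tau r)%:E <= kfun r)%E /\
  [/\ tau r * ln (Y (tau r)) <= expR (4^-1 - ln alpha) * (r / C (tau r)),
      expR (- 4^-1 - ln alpha) * (r / C (tau r)) <= tau r * ln (Y (tau r)),
      ln r - ln (D (tau r)) <= 3 * ln (Y (tau r)) &
      3 / 4 * ln (Y (tau r)) <= ln r - ln (D (tau r))] by near: r.
have H1 : forall t, 1 <= t -> (t%:E <= kfun r)%E -> gint t r <= t * (ln r - ln (D t) + M).
  by near: r.
have H2 : forall t, 2 <= t -> (t%:E <= kfun r)%E -> c * t * (ln r - ln (D t)) <= gint t r.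
  by near: r.
have {}H1 := H1 _ t1 tk; have {}H2 := H2 _ t2 tk.
move: t1 up lo hi3 hi4 H1 H2; set t := tau r => t1 up lo hi3 hi4 H1 H2.
have t0 : 0 < t by exact: lt_le_trans t1.
have q0 : 0 < r / C t by rewrite divr_gt0// C_gt0.
split => //; last by rewrite ler_piMl ?(ltW q0)// ge_min lexx.
  rewrite /Bfun ge_max; apply/andP; split; last by rewrite ler_peMl ?(ltW q0)// le_max lexx.
  apply: (le_trans H1); apply: (@le_trans _ _ ((3 + M) * (t * ln (Y t)))).
    by rewrite mulrCA ler_pM2l//; apply: aux => //; exact: w1.
  apply: (@le_trans _ _ ((3 + M) * (expR (4^-1 - ln alpha) * (r / C t)))).
    by rewrite ler_pM2l.
  by rewrite mulrA; apply: ler_wpM2r; [exact: ltW q0|]; rewrite le_max lexx orbT.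
apply: le_trans H2; apply: (@le_trans _ _ (3 / 4 * c * (t * ln (Y t)))).
  apply: (@le_trans _ _ (3 / 4 * c * (expR (- 4^-1 - ln alpha) * (r / C t)))).
    by rewrite [leRHS]mulrA; apply: ler_wpM2r; [exact: ltW q0|]; rewrite ge_min lexx orbT.
  by rewrite ler_pM2l.
rewrite (_ : 3 / 4 * c * (t * ln (Y t)) = c * t * (3 / 4 * ln (Y t))); last by ring.
by rewrite ler_pM2l ?mulr_gt0.
Unshelve. all: by end_near. Qed.

Let C_tau_fm : asymp_oo (fun r => r / C (tau r)) (fun r => r / C (fm r)).
Proof.
have [_ ufm _ _] := asymptotic_inverseP gamma1 uvar_f inv.
have [X X1 HX] := uvar_comp uvar_C ufm foo ltr01.
apply: (@asymp_div_C _ _ (1 * (1 + `|ln alpha|) + `|gamma * (1 + gamma)^-1| * `|ln alpha|)).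
near=> r; have r0 : 0 < r by near: r; exact: nbhs_pinfty_gt.
split; [by near: r; exact: pinfty_ge tauoo|by near: r; exact: pinfty_ge foo|].
have rX : X <= r by near: r; exact: near_ge.
have rX' : X <= alpha^-1 * r by near: r; exact: pinfty_ge (scale_pinfty aV).
have [_] := HX _ _ rX rX'; rewrite (@lnM _ alpha^-1) ?posrE// (lnV alpha0) addrK normrN => h.
rewrite (_ : ln (C (tau r)) - _ = (ln (C (tau r)) - ln (C (fm r)) -
  gamma * (1 + gamma)^-1 * - ln alpha) - gamma * (1 + gamma)^-1 * ln alpha); last by ring.
by apply: le_trans (ler_normB _ _) _; rewrite normrM; exact: lerD.
Unshelve. all: by end_near. Qed.

(** At tau both quantities are comparable, so it realises the infimum up to constants; passing from
    tau(r) = fm(r / alpha) to fm(r) changes C by a bounded factor. *)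
Lemma Binf_asymp_balance : [/\ asymp_oo Bi (fun r => Bf (tau r) r),
  asymp_oo (fun r => Bf (tau r) r) (fun r => r / C (fm r)) &
  regularly_varying (fun r => r / C (fm r)) (1 / (1 + gamma))].
Proof.
have [_ ufm _ [x0 mfm]] := asymptotic_inverseP gamma1 uvar_f inv.
have [c [K [c0 K0 main]]] := Bfun_tau; have [d d0 Hd] := Binf_ge.
have rpos : \forall r \near (+oo : set_system R), 0 < r by exact: nbhs_pinfty_gt.
have up : asymp_oo (fun r => Bf (tau r) r) (fun r => r / C (tau r)).
  split; first by apply: (lesssim_near K0); apply: filterS main => r [].
  by apply: (lesssim_near ltr01); near=> r; rewrite mul1r /Bfun le_max lexx orbT.
have inf_le : lesssim_oo Bi (fun r => Bf (tau r) r).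
  apply: (lesssim_near ltr01); apply: filterS2 main rpos => r [t1 _ _ _] r0.
  by rewrite mul1r; exact: Binf_le _ _ r0 t1.
have inf_ge : lesssim_oo (fun r => r / C (tau r)) Bi.
  apply: (@lesssim_near _ _ _ (d * c)^-1); first by rewrite invr_gt0 mulr_gt0.
  apply: filterS2 main rpos => r [t1 _ h h'] r0.
  rewrite ler_pdivlMl ?mulr_gt0// -mulrA; apply: Hd h h' => //.
  by rewrite mulr_gt0// divr_gt0// C_gt0.
split.
- by split => //; case: up => up _; exact: lesssim_trans up inf_ge.
- exact: asymp_trans up C_tau_fm.
- have indE (g : R) : 0 < 1 + g -> 1 - g * (1 + g)^-1 = 1 / (1 + g).
    by move=> g0; field; rewrite gt_eqF.
  by rewrite -indE//; exact: rv_div_C ufm foo mfm.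
Unshelve. all: by end_near. Qed.

End inverse.

(** With delta < 1 + gamma, Y has positive index, so ln Y(t) is comparable with ln t. *)
Lemma balance_asymp_log : delta < 1 + gamma -> asymp_oo f (fun t => t * C t * ln t).
Proof.
move=> h; have r0 : 0 < 1 + gamma - delta by lra.
set rho := 1 + gamma - delta in r0.
have [X X1 HX] := uvar_Y (e := rho / 2) ltac:(lra).
have key : \forall t \near +oo, [/\ 1 < t, ln (Y t) <= (2 * rho + 1) * ln t &
    rho / 4 * ln t <= ln (Y t)].
  near=> t.
  have Xt : X <= t by near: t; exact: near_ge.
  have t1 : 1 < t by near: t; exact: nbhs_pinfty_gt.
  have big1 : ln (Y X) + rho / 2 <= ln t.
    by near: t; move/cvgryPge : (@ln_pinfty R); exact.
  have big2 : (rho / 2 + rho * 2 * ln X - ln (Y X)) / (rho / 4) <= ln t.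
    by near: t; move/cvgryPge : (@ln_pinfty R); exact.
  rewrite ler_pdivrMr in big2; last by lra.
  have [_] := HX X t (lexx X) Xt.
  have l0 : 0 <= ln t - ln X by rewrite subr_ge0 ler_ln ?posrE; lra.
  have lX : 0 <= ln X by exact: ln_ge0.
  rewrite (ger0_norm l0) -/rho ler_norml => /andP[h1 h2].
  split => //; nra.
have tC0 : \forall t \near +oo, 0 < t * C t.
  by apply: filterS (near_ge 1) => t; exact: tC_gt0.
split.
  apply: (@lesssim_near _ _ _ (2 * rho + 1)); first by lra.
  apply: filterS2 key tC0 => t [_ h1 _] p0.
  by rewrite mulrCA ler_pM2l.
apply: (@lesssim_near _ _ _ (rho / 4)^-1); first by rewrite invr_gt0; lra.
apply: filterS2 key tC0 => t [_ _ h1] p0.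
by rewrite mulrCA ler_pM2l// ler_pdivlMl//; lra.
Unshelve. all: by end_near. Qed.

End balance.

(** * The bound by the tail integral *)

(** Letting t tend to infinity in Bfun(t, r) makes r / C(t) vanish. *)
Lemma Binf_le_limit r K T : 0 < r -> 0 < K -> (forall t, T <= t -> gint t r <= K) -> Bi r <= K.
Proof.
move=> r0 K0 H; have /nearyP[X X1 HX] := pinfty_ge (r / K) C_pinfty.
pose t := Num.max X T.
have tX : X <= t by rewrite le_max lexx.
have t1 : 1 <= t by exact: le_trans tX.
apply: le_trans (Binf_le r0 t1) _; rewrite /Bfun ge_max H ?le_max ?lexx ?orbT//=.
rewrite ler_pdivrMr ?C_gt0// mulrC -ler_pdivrMr//; exact: HX.
Qed.

(** A negative index would make the quotient tend to 0. *)
Lemma unbounded_index : unbounded quot -> deltaphi <= deltal.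
Proof.
move=> ub; rewrite leNgt; apply/negP => h.
have r0 : deltal - deltaphi < 0 by lra.
have /nearyP[X X1 HX] := uvar_neg r0 uvar_quot ltr01.
have [q0 /(_ X)[M HM]] := locbd_quot.
have [x x1] := ub (Num.max 1 (expR M)); apply/negP; rewrite -leNgt.
rewrite le_max; have [xX|Xx] := leP x X.
  apply/orP; right; rewrite -[leLHS]lnK ?posrE ?q0// ler_expR.
  by apply: le_trans (ler_norm _) (HM x _); rewrite x1.
by have /andP[_ /ltW ->] := HX x (ltW Xx).
Qed.

(** Where dphi / dl is at least of order r, the last expression of the integrand is at most of the order of
    the middle one. *)
Lemma dl_le_density M r s : 0 < r -> 1 <= s -> ln r <= ln (quot s) + M ->
  r * dl s <= expR (M / 2) * Num.sqrt r * phi s.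
Proof.
move=> r0 s1 h; have dp := dl_gt0 s1; have pp := density_gt0 s1.
have sr : 0 < Num.sqrt r by rewrite sqrtr_gt0.
rewrite -ler_ln ?posrE ?mulr_gt0 ?expR_gt0//.
rewrite !lnM ?posrE ?mulr_gt0 ?expR_gt0// expRK ln_sqrt// (lndensityE s1) (lnDE s1).
by rewrite (lnquotE s1) in h; lra.
Qed.

(** The quotient then has index 0 and grows slower than any power, so it takes values of size r only at
    arguments larger than any power of r. *)
Lemma ln_hh_ge (N : R) : unbounded quot -> deltal = deltaphi -> 0 < N ->
  \forall r \near +oo, N * ln r <= ln (hh r).
Proof.
move=> ub dd N0.
have uq : uvar quot 0 by have := uvar_quot; rewrite dd subrr.
have e0 : 0 < (2 * N)^-1 by rewrite invr_gt0; lra.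
have [X X1 HX] := uq _ e0.
near=> r.
have r1 : 1 <= r by near: r; exact: near_ge.
have hX : X <= hh r by near: r; exact: pinfty_ge (hh_pinfty ub).
have hq : `|ln r - ln (quot (hh r))| <= 1 by near: r; exact: lnquot_hh ub.
have big : 2 * (1 + ln (quot X) + (2 * N)^-1) <= ln r.
  by near: r; exact: pinfty_ge (@ln_pinfty R).
have [_] := HX _ _ (lexx X) hX.
have l0 : 0 <= ln (hh r) - ln X by rewrite subr_ge0 ler_ln ?posrE; lra.
have lX : 0 <= ln X by exact: ln_ge0.
rewrite mul0r subr0 (ger0_norm l0) ler_norml => /andP[_ h].
move: hq; rewrite ler_norml => /andP[_ hq].
have h2 : ln r / 2 <= (2 * N)^-1 * ln (hh r).
  have : (2 * N)^-1 * (1 + (ln (hh r) - ln X)) <= (2 * N)^-1 + (2 * N)^-1 * ln (hh r).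
    by rewrite mulrDr mulr1 lerD2l ler_pM2l//; lra.
  lra.
rewrite ler_pdivlMl ?mulr_gt0// in h2.
by rewrite (_ : N * ln r = 2 * N * (ln r / 2)); [|field].
Unshelve. all: by end_near. Qed.

Section tail_bound.
Hypothesis hB : hypB dl dphi cl cphi deltal deltaphi gamma.

Let Ip : (\int[@lebesgue_measure R]_(s in `[1%R, +oo[) (phi s)%:E < +oo)%E.
Proof. by case: hB. Qed.

Let tC_D : exists2 M, 0 <= M & forall t, 1 <= t -> ln t + ln (C t) <= ln (D t) + M.
Proof.
have [H _ _] := hB.
have tC0 t : 1 <= t -> 0 < t * C t by move=> t1; rewrite mulr_gt0 ?C_gt0//; lra.
have [M M0 HM] := ln_lesssim_on tC0 D_gt0 H; exists M => // t t1.
by have := HM t t1; rewrite lnM ?posrE ?C_gt0//; lra.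
Qed.

Let U r := Num.sqrt r * Tail phi (kk r).

Let koo := kk_pinfty.

(** At k(r) the integral is at least k(r) / 4, and so is, up to a constant, r / C(k(r)) because t C(t) is
    at most a multiple of D(t). *)
Lemma k_lesssim_Binf : lesssim_oo kk Bi.
Proof.
have [M M0 HM] := tC_D; have [N N0 HN] := lnD_kk; have [c c0 Hc] := Binf_ge.
pose m := Num.min 4^-1 (expR (- (M + N))).
have m0 : 0 < m by rewrite lt_min expR_gt0 andbT; lra.
apply: (@lesssim_near _ _ _ (c * m)^-1); first by rewrite invr_gt0 mulr_gt0.
near=> r; have r0 : 0 < r by near: r; exact: nbhs_pinfty_gt.
have k1 : 1 <= kk r by near: r; exact: pinfty_ge koo.
have k0 : 0 < kk r by lra.
rewrite ler_pdivlMl ?mulr_gt0// -mulrA; apply: (Hc r (kk r)) => //.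
- exact: mulr_gt0.
- have h : kk r / 4 <= gint (kk r) r by near: r; exact: gint_k_ge.
  apply: le_trans h; rewrite mulrC ler_pM2l//.
  by rewrite ge_min lexx.
have h : `|ln r - ln (D (kk r))| <= N by near: r.
have Ck := C_gt0 k1.
apply: (@le_trans _ _ (expR (- (M + N)) * kk r)).
  by rewrite ler_pM2r// ge_min lexx orbT.
have -> : r / C (kk r) = expR (ln r - ln (C (kk r))) by rewrite expRB !lnK.
rewrite -[X in _ * X]lnK ?posrE// -expRD ler_expR.
have := HM _ k1; move: h; rewrite ler_norml => /andP[h _]; lra.
Unshelve. all: by end_near. Qed.

Let U_gt0 : \forall r \near +oo, 0 < U r.
Proof.
have [M HM] := ln_Tail_ge lphi mphi uphi Ip.
near=> r; have r0 : 0 < r by near: r; exact: nbhs_pinfty_gt.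
have k1 : 1 <= kk r by near: r; exact: pinfty_ge koo.
by rewrite mulr_gt0 ?sqrtr_gt0//; have [] := HM _ k1.
Unshelve. all: by end_near. Qed.

Let k_le_U : exists2 c, 0 < c & \forall r \near +oo, kk r <= c * U r.
Proof.
have [M HM] := ln_Tail_ge lphi mphi uphi Ip.
have [N N0 HN] := lnD_kk.
exists (expR (M + N)); first exact: expR_gt0.
near=> r; have r0 : 0 < r by near: r; exact: nbhs_pinfty_gt.
have k1 : 1 <= kk r by near: r; exact: pinfty_ge koo.
have k0 : 0 < kk r by lra.
have h : `|ln r - ln (D (kk r))| <= N by near: r.
have [T0 HT] := HM _ k1.
rewrite /U -ler_ln ?posrE ?mulr_gt0 ?expR_gt0 ?sqrtr_gt0//.
rewrite !lnM ?posrE ?mulr_gt0 ?expR_gt0 ?sqrtr_gt0// expRK ln_sqrt//.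
move: h HT; rewrite (lndensityE k1) ler_norml => /andP[? _]; lra.
Unshelve. all: by end_near. Qed.

Let delta2 : 2 <= delta.
Proof. by have := index_ge_of_integral lphi mphi uphi Ip; lra. Qed.

(** Stated with a threshold T, so that it applies whichever phase gint(t, r) ends in. *)
Let upper_of_gint (c : R) : 0 < c ->
  (\forall r \near +oo, exists T, forall t, T <= t -> gint t r <= c * U r) -> lesssim_oo Bi U.
Proof.
move=> c0 H; apply: (lesssim_near c0); near=> r.
have r0 : 0 < r by near: r; exact: nbhs_pinfty_gt.
have Ur : 0 < U r by near: r.
have [T HT] : exists T, forall t, T <= t -> gint t r <= c * U r by near: r.
apply: (Binf_le_limit r0 _ HT); exact: mulr_gt0.
Unshelve. all: by end_near. Qed.

Let upper_h_infinite : (\forall r \near +oo, hfun r = +oo%E) -> lesssim_oo Bi U.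
Proof.
move=> hoo; have [M M0 HM] := gint_mid_le; have [c c0 Hc] := k_le_U.
apply: (upper_of_gint (c := M * c + 1)); first by rewrite ltr_wpDl// mulr_ge0// ltW.
near=> r; exists (kk r) => t kt.
have r0 : 0 < r by near: r; exact: nbhs_pinfty_gt.
have k1 : 1 <= kk r by near: r; exact: pinfty_ge koo.
have hE : hfun r = +oo%E by near: r.
have H : forall t, kk r <= t -> (t%:E <= hfun r)%E ->
  gint t r <= M * kk r + Num.sqrt r * Int phi (kk r) t by near: r.
apply: le_trans (H t kt _) _; first by rewrite hE leey.
have hk : kk r <= c * U r by near: r.
rewrite mulrDl mul1r -mulrA; apply: lerD; first exact: ler_wpM2l.
apply: ler_wpM2l; first exact: sqrtr_ge0.
exact: (Int_le_Tail lphi mphi Ip).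
Unshelve. all: by end_near. Qed.

(** If the quotient stays of order at least r beyond h(r), the last phase is dominated by continuing the
    middle one. *)
Let upper_quot_large (M1 : R) : unbounded quot ->
  (\forall r \near +oo, forall s, hh r <= s -> ln r <= ln (quot s) + M1) -> lesssim_oo Bi U.
Proof.
move=> ub Hq; have [M M0 HM] := gint_hi_le; have [c c0 Hc] := k_le_U.
pose E := 1 + expR (M1 / 2).
have E1 : 1 <= E by rewrite lerDl expR_ge0.
have E2 : expR (M1 / 2) <= E by rewrite lerDr.
apply: (upper_of_gint (c := M * c + E)).
  by rewrite ltr_wpDl// ?mulr_ge0// ?ltW//; lra.
near=> r; exists (hh r) => t ht.
have r0 : 0 < r by near: r; exact: nbhs_pinfty_gt.
have k1 : 1 <= kk r by near: r; exact: pinfty_ge koo.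
have hE : hfun r = (hh r)%:E by near: r; exact: hfun_fin ub.
have kE : kfun r = (kk r)%:E by near: r; exact: kfun_fin.
have kh : kk r <= hh r by rewrite -lee_fin -kE -hE k_le_h.
have h1 : 1 <= hh r by exact: le_trans kh.
have kt : kk r <= t by exact: le_trans ht.
have H : forall h t, hfun r = h%:E -> h <= t ->
  gint t r <= M * kk r + Num.sqrt r * Int phi (kk r) h + r * Int dl h t by near: r.
have Hq' : forall s, hh r <= s -> ln r <= ln (quot s) + M1 by near: r.
apply: le_trans (H _ t hE ht) _.
have hk : kk r <= c * U r by near: r.
have bphi := intb_density; have bdl := intb_dl.
have sr : 0 <= Num.sqrt r by exact: sqrtr_ge0.
have i1 : r * Int dl (hh r) t <= expR (M1 / 2) * Num.sqrt r * Int phi (hh r) t.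
  rewrite -!Int_scale//; apply: Int_le => //.
  - exact: intb_scale (ltW r0) bdl.
  - by apply: intb_scale bphi; rewrite mulr_ge0 ?expR_ge0.
  - move=> s /andP[hs _]; apply: (dl_le_density r0); first exact: le_trans hs.
    exact: Hq'.
have i2 : Num.sqrt r * Int phi (kk r) (hh r) + r * Int dl (hh r) t <= E * U r.
  apply: (@le_trans _ _ (E * (Num.sqrt r * Int phi (kk r) t))).
    rewrite (Int_chasles bphi k1 kh ht) !mulrDr; apply: lerD.
      by rewrite ler_peMl// mulr_ge0// Int_ge0.
    apply: le_trans i1 _; rewrite -!mulrA; apply: ler_wpM2r => //.
    by rewrite mulr_ge0// Int_ge0.
  rewrite ler_wpM2l//; first by lra.
  rewrite /U ler_wpM2l//; exact: (Int_le_Tail lphi mphi Ip).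
rewrite mulrDl -addrA -mulrA; apply: lerD => //; exact: ler_wpM2l.
Unshelve. all: by end_near. Qed.

Let kk_le : \forall r \near +oo, ln (kk r) <= ln r.
Proof.
have d1 : delta^-1 < 3 / 4.
  have d2 := delta2; have : delta^-1 <= 2^-1 by rewrite lef_pV2 ?posrE//; lra.
  lra.
have [c Hc] := uvar_ln_le d1 uvar_kk.
near=> r; have h : ln (kk r) <= 3 / 4 * ln r + c by near: r.
have : 4 * c <= ln r by near: r; exact: pinfty_ge (@ln_pinfty R).
lra.
Unshelve. all: by end_near. Qed.

(** The infimum is tested at a power of r that h(r) exceeds, so that only the first two phases enter. *)
Let upper_equal_gamma : unbounded quot -> deltal = deltaphi -> 0 < gamma -> lesssim_oo Bi U.
Proof.
move=> ub dd g0; have [M M0 HM] := gint_mid_le; have [c c0 Hc] := k_le_U.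
have [X X1 [b Hb]] := uvar_ge g0 uvar_C.
pose N := 1 + 4 / gamma.
have N0 : 0 < N by rewrite ltr_pwDl// divr_ge0//; lra.
have gN : gamma / 2 * N = gamma / 2 + 2 by rewrite /N; field; rewrite gt_eqF//; lra.
have Mc0 : 0 <= M * c by rewrite mulr_ge0// ltW.
have K0 : 0 < M * c + 1 + c by lra.
have aux1 (L lC : R) : 1 <= L -> - b <= L -> (gamma / 2 + 2) * L + b <= lC -> L <= lC.
  by move=> L1 bL; have := mulr_ge0 (ltW g0) (le_trans ler01 L1); lra.
have aux2 (u : R) : 0 <= u ->
    M * (c * u) + u <= (M * c + 1 + c) * u /\ c * u <= (M * c + 1 + c) * u.
  by move=> u0; have := mulr_ge0 Mc0 u0; have := mulr_ge0 (ltW c0) u0; split; lra.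
apply: (lesssim_near K0); near=> r.
have r0 : 0 < r by near: r; exact: nbhs_pinfty_gt.
have lr1 : 1 <= ln r by near: r; exact: pinfty_ge (@ln_pinfty R).
have k1 : 1 <= kk r by near: r; exact: pinfty_ge koo.
have k0 : 0 < kk r by exact: lt_le_trans k1.
have hE : hfun r = (hh r)%:E by near: r; exact: hfun_fin ub.
have h0 : 0 < hh r.
  by apply: lt_le_trans ltr01 _; near: r; exact: pinfty_ge (hh_pinfty ub).
have lh : N * ln r <= ln (hh r) by near: r; exact: (ln_hh_ge ub dd N0).
have lk : ln (kk r) <= ln r by near: r; exact: kk_le.
have lb : - b <= ln r by near: r; exact: pinfty_ge (@ln_pinfty R).
have lX : ln X <= ln r by near: r; exact: pinfty_ge (@ln_pinfty R).
have hk : kk r <= c * U r by near: r.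
have H : forall t, kk r <= t -> (t%:E <= hfun r)%E ->
  gint t r <= M * kk r + Num.sqrt r * Int phi (kk r) t by near: r.
(* a power of r that stays below h(r), yet makes r / C(t) negligible *)
pose t := expR (N * ln r).
have t0 : 0 < t by exact: expR_gt0.
have Nl : ln r <= N * ln r.
  by apply: ler_peMl; [exact: le_trans lr1|rewrite lerDl divr_ge0// ltW].
have kt : kk r <= t by rewrite -ler_ln ?posrE// expRK; exact: le_trans Nl.
have th : t <= hh r by rewrite -ler_ln ?posrE// expRK.
have t1 : 1 <= t by exact: le_trans kt.
have X0 : 0 < X by exact: lt_le_trans X1.
have Xt : X <= t by rewrite -ler_ln ?posrE// expRK; exact: le_trans Nl.
have [Ct hC] := Hb _ Xt; rewrite expRK mulrA gN in hC.
have U0 : 0 <= U r by rewrite mulr_ge0 ?sqrtr_ge0// (Tail_ge0 lphi).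
have [a1 a2] := aux2 _ U0.
apply: le_trans (Binf_le r0 t1) _; rewrite /Bfun ge_max; apply/andP; split.
  apply: le_trans (H t kt _) _; first by rewrite hE lee_fin.
  apply: le_trans a1; apply: lerD; first exact: (ler_wpM2l M0).
  by rewrite ler_wpM2l ?sqrtr_ge0//; exact: (Int_le_Tail lphi mphi Ip).
apply: le_trans a2; apply: le_trans hk; apply: le_trans k1.
by rewrite ler_pdivrMr// mul1r -ler_ln ?posrE//; exact: aux1 hC.
Unshelve. all: by end_near. Qed.

(** The tail of dl has negative index, and at h(r), beyond every power of r, it compensates the factor r. *)
Let upper_equal_delta : unbounded quot -> deltal = deltaphi -> 2 < delta -> lesssim_oo Bi U.
Proof.
move=> ub dd d2; have [M M0 HM] := gint_hi_le; have [c c0 Hc] := k_le_U.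
have dl1 : - deltal < -1 by lra.
have Id := integral_lty_of_index locbd_dl mdl uvar_dl dl1.
have uT := uvar_Tail locbd_dl mdl uvar_dl Id.
pose p := (deltal - 1) / 2.
have p0 : 0 < p by rewrite /p; lra.
have pl : 1 - deltal < - p by rewrite /p; lra.
have [b Hb] := uvar_ln_le pl uT.
pose N := 2 / p; have N0 : 0 < N by rewrite divr_gt0.
have pN : p * N = 2 by rewrite /N; field; rewrite gt_eqF.
have Mc0 : 0 <= M * c by rewrite mulr_ge0// ltW.
apply: (upper_of_gint (c := M * c + 1 + c)); first by lra.
near=> r; exists (hh r) => t ht.
have r0 : 0 < r by near: r; exact: nbhs_pinfty_gt.
have k1 : 1 <= kk r by near: r; exact: pinfty_ge koo.
have hE : hfun r = (hh r)%:E by near: r; exact: hfun_fin ub.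
have kE : kfun r = (kk r)%:E by near: r; exact: kfun_fin.
have kh : kk r <= hh r by rewrite -lee_fin -kE -hE k_le_h.
have h1 : 1 <= hh r by exact: le_trans kh.
have lh : N * ln r <= ln (hh r) by near: r; exact: (ln_hh_ge ub dd N0).
have hT : ln (Tail dl (hh r)) <= - p * ln (hh r) + b.
  by near: r; exact: (pinfty_near (hh_pinfty ub) Hb).
have lb : b <= ln r by near: r; exact: pinfty_ge (@ln_pinfty R).
have H : forall h t, hfun r = h%:E -> h <= t ->
  gint t r <= M * kk r + Num.sqrt r * Int phi (kk r) h + r * Int dl h t by near: r.
have hk : kk r <= c * U r by near: r.
have [G HG] := ln_Tail_ge locbd_dl mdl uvar_dl Id.
have [T0 _] := HG _ h1.
have i1 : r * Int dl (hh r) t <= kk r.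
  apply: le_trans k1; apply: (@le_trans _ _ (r * Tail dl (hh r))).
    by rewrite ler_pM2l//; exact: (Int_le_Tail locbd_dl mdl Id).
  rewrite -ler_ln ?posrE ?mulr_gt0// ln1 lnM ?posrE//.
  have : p * (N * ln r) <= p * ln (hh r) by rewrite ler_pM2l.
  rewrite mulrA pN; lra.
apply: le_trans (H _ t hE ht) _.
have i2 : Num.sqrt r * Int phi (kk r) (hh r) <= U r.
  by rewrite /U ler_wpM2l ?sqrtr_ge0//; exact: (Int_le_Tail lphi mphi Ip).
have i3 : M * kk r <= M * (c * U r) by exact: ler_wpM2l.
lra.
Unshelve. all: by end_near. Qed.

Let quot_bounded_not_unb : [bounded quot t | t in `[1, +oo[] -> ~ unbounded quot.
Proof.
move=> [M [_ HM]] ub; have [x x1] := ub (`|M| + 1); apply/negP; rewrite -leNgt.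
have := HM (`|M| + 1) ltac:(by have := ler_norm M; lra) x.
rewrite /= in_itv/= andbT => /(_ x1); exact: le_trans (ler_norm _).
Qed.

(** If deltal > deltaphi, the quotient is almost increasing, and so it stays of order r beyond h(r).  If
    the indices agree, either gamma > 0 or delta > 2 helps, or all three are critical; in that case a
    quotient comparable with a monotone function is again almost increasing, unless it is bounded. *)
Lemma Binf_lesssim_tail : lesssim_oo Bi U.
Proof.
have [hoo|ub] := hh_cases; first exact: upper_h_infinite.
have := unbounded_index ub; rewrite le_eqVlt => /predU1P[/esym dd|dd].
  have [g0|g0] := ltP 0 gamma; first exact: upper_equal_gamma.
  have [d2|d2] := ltP 2 delta; first exact: upper_equal_delta.
  have gE : gamma = 0 by apply/eqP; rewrite eq_le g0 gamma_ge0.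
  have dE : deltal = 1 by have := delta2; lra.
  have dE' : deltaphi = 1 by lra.
  have [_ _ /(_ (And3 dE dE' gE))[/quot_bounded_not_unb//|[m mono [[c c0 Hc] [d d0 Hd]]]]] := hB.
  have i u : 1 <= u -> (`[1, +oo[%classic : set R) u by rewrite /= in_itv/= andbT.
  have qm s x : 1 <= s -> 1 <= x -> m x <= m s -> quot x <= c * d * quot s.
    move=> s1 x1 ms; apply: le_trans (Hc _ (i _ x1)) _; rewrite -mulrA ler_pM2l//.
    exact: le_trans ms (Hd _ (i _ s1)).
  case: mono => mono; last first.
    exfalso; have [x x1] := ub (c * d * quot 1); apply/negP; rewrite -leNgt.
    by apply: qm => //; apply: mono; rewrite ?in_itv/= ?andbT ?lexx.
  have cd0 : 0 < c * d by rewrite mulr_gt0.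
  apply: (upper_quot_large (M1 := Num.max 1 (ln (c * d)))) => //; near=> r => s hs.
  have r0 : 0 < r by near: r; exact: nbhs_pinfty_gt.
  have h1 : 1 <= hh r by near: r; exact: pinfty_ge (hh_pinfty ub).
  have hE : hfun r = (hh r)%:E by near: r; exact: hfun_fin ub.
  have s1 : 1 <= s by exact: le_trans hs.
  move: hs; rewrite le_eqVlt => /predU1P[<-|hs].
    have : `|ln r - ln (quot (hh r))| <= 1 by near: r; exact: lnquot_hh ub.
    rewrite ler_norml => /andP[_ h]; rewrite -lerBlDl le_max; apply/orP; left; lra.
  have hs' : (hfun r < s%:E)%E by rewrite hE lte_fin.
  have [x /andP[x1 xs] rx] := hfun_gt r0 s1 hs'.
  have q1 : quot x <= c * d * quot s.
    by apply: qm => //; apply: mono; rewrite ?in_itv/= ?andbT ?x1 ?s1.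
  have qs := quot_gt0 s1.
  have : ln r <= ln (c * d * quot s).
    have rq : r <= c * d * quot s by exact: le_trans (ltW rx) q1.
    by rewrite ler_ln ?posrE//; exact: mulr_gt0.
  rewrite lnM ?posrE// => h; rewrite -lerBlDl le_max; apply/orP; right; lra.
have d0 : 0 < deltal - deltaphi by lra.
pose e := Num.min 1 (deltal - deltaphi).
have e0 : 0 < e by rewrite lt_min ltr01.
have e1 : e <= 1 by rewrite ge_min lexx.
have ed : e <= deltal - deltaphi by rewrite ge_min lexx orbT.
have [T HT] := uvar_almost_mono e0 ed locbd_quot uvar_quot.
apply: (upper_quot_large (M1 := 2)) => //; near=> r => s hs.
have h1 : 1 <= hh r by near: r; exact: pinfty_ge (hh_pinfty ub).
have hT : T <= hh r by near: r; exact: pinfty_ge (hh_pinfty ub).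
have : `|ln r - ln (quot (hh r))| <= 1 by near: r; exact: lnquot_hh ub.
rewrite ler_norml => /andP[_ h]; have := HT _ _ h1 hs (le_trans hT hs); lra.
Unshelve. all: by end_near. Qed.

Lemma rv_kk : regularly_varying kk (1 / delta).
Proof.
have [x0 m] := kk_measurable; rewrite div1r; exact: uvar_rv uvar_kk m.
Qed.

Lemma rv_sqrt_tail : regularly_varying U (1 / delta).
Proof.
have [x0 m] := kk_measurable.
have uT := uvar_Tail lphi mphi uphi Ip.
have [x1 m1] := measurable_comp_pinfty (Tail_measurable lphi mphi Ip) m koo.
apply: (@uvar_rv _ _ _ x1); last first.
  by apply: measurable_funM => //; exact: sqrt_measurable.
have indE (x : R) : 0 < x -> 1 / 2 + (1 + - (x / 2)) * x^-1 = 1 / x.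
  by move=> x0'; field; rewrite gt_eqF.
rewrite -(indE _ delta_pos).
exact: uvarM (uvar_sqrt (@uvar_id R)) (uvar_comp uT uvar_kk koo).
Qed.

(** For delta > 2 the tail is comparable with k / sqrt D(k), and D(k(r)) is about r. *)
Lemma tail_lesssim_k : 2 < delta -> lesssim_oo U kk.
Proof.
move=> d2; have r1 : - (delta / 2) < -1 by lra.
have [M HM] := ln_Tail_le lphi mphi uphi Ip r1.
have [M1 HM1] := ln_Tail_ge lphi mphi uphi Ip.
have [N N0 HN] := lnD_kk.
apply: (@lesssim_ln _ _ _ (M + N)); near=> r.
have r0 : 0 < r by near: r; exact: nbhs_pinfty_gt.
have k1 : 1 <= kk r by near: r; exact: pinfty_ge koo.
have k0 : 0 < kk r by lra.
have h : `|ln r - ln (D (kk r))| <= N by near: r.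
have [T0 _] := HM1 _ k1.
have hT : ln (Tail phi (kk r)) <= ln (kk r) + ln (phi (kk r)) + M.
  by near: r; exact: (pinfty_near koo HM).
split => //; first by rewrite mulr_gt0 ?sqrtr_gt0.
rewrite /U lnM ?posrE ?sqrtr_gt0// ln_sqrt//.
move: h hT; rewrite (lndensityE k1) ler_norml => /andP[_ ?]; lra.
Unshelve. all: by end_near. Qed.

End tail_bound.

(** * The balance point lies in the middle phase *)

Section middle_phase.
Hypothesis hC : hypC dl dphi cl cphi delta gamma.

Let Ip : (\int[@lebesgue_measure R]_(s in `[1%R, +oo[) (phi s)%:E = +oo)%E.
Proof. by case: hC. Qed.

Let tC_gt0 t : 1 <= t -> 0 < t * C t.
Proof. by move=> t1; rewrite mulr_gt0 ?C_gt0//; lra. Qed.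

Let tC_D : exists2 M, 0 <= M & forall t, 1 <= t -> ln t + ln (C t) <= ln (D t) + M.
Proof.
have [_ H _ _] := hC; have [M M0 HM] := ln_lesssim_on tC_gt0 D_gt0 H; exists M => // t t1.
by have := HM t t1; rewrite lnM ?posrE ?C_gt0//; lra.
Qed.

Let dl_tC : exists2 M, 0 <= M & forall t, 1 <= t -> - ln (dl t) <= ln t + ln (C t) + M.
Proof.
have [H _ _ _] := hC.
have dV t : 1 <= t -> 0 < (dl t)^-1 by move=> t1; rewrite invr_gt0 dl_gt0.
have [M M0 HM] := ln_lesssim_on dV tC_gt0 H; exists M => // t t1.
have t0 : 0 < t by lra.
by have := HM t t1; rewrite (lnV (dl_gt0 t1)) (@lnM _ t) ?posrE ?C_gt0.
Qed.

Let bphi : intb phi := intb_density.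
Let F t := Int phi 1 t.
Let Foo : F t @[t --> +oo] --> +oo. Proof. exact: Int_pinfty bphi Ip. Qed.
Let uF : uvar F (1 - delta / 2). Proof. exact: (uvar_Int lphi mphi uphi Foo). Qed.

Let delta2 : delta <= 2.
Proof.
rewrite leNgt; apply/negP => h; have r1 : - (delta / 2) < -1 by lra.
by have := integral_lty_of_index lphi mphi uphi r1; rewrite Ip ltxx.
Qed.

Let rho := 2 - delta + 2 * gamma.

Let rho_gt0 : 0 < rho.
Proof.
have [_ _ _ hne] := hC; have g0 := gamma_ge0; have d2 := delta2.
rewrite lt_neqAle; apply/andP; split; last by rewrite /rho; lra.
apply/eqP => E; apply: hne.
have gE : gamma = 0 by rewrite /rho in E; lra.
have dE : delta = 2 by rewrite /rho in E; lra.
by rewrite gE dE.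
Qed.

Let f0 t := t ^+ 2 * C t ^+ 2 / D t.
Let f1 t := (C t * Int phi 1 t) ^+ 2.

Let uf0 : uvar f0 rho.
Proof.
have u1 := uvarM (@uvar_id R) uvar_C.
have := uvarM (uvarM (uvarM (@uvar_id R) (@uvar_id R)) (uvarM uvar_C uvar_C))
  (uvarV uvar_D).
by congr uvar; rewrite /rho; ring.
Qed.

Let lf0 : locbd f0.
Proof.
exact: locbdM (locbdM (locbdM (@locbd_id R) (@locbd_id R)) (locbdM locbd_C locbd_C))
  (locbdV locbd_D).
Qed.

Let mf0 : measurable_fun I1 f0.
Proof.
apply: measurable_funM; last exact: measurable_posV D_gt0 mD.
by apply: measurable_funM; apply: measurable_funX => //; exact: mC.
Qed.

Let uf1 : uvar f1 rho.
Proof.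
have u1 := uvarM uvar_C uF.
by refine (uvar_eqind _ (uvarM u1 u1)); rewrite /rho; field.
Qed.

Let mf1 : measurable_fun I1 f1.
Proof.
apply: measurable_funX; apply: measurable_funM; [exact: mC|exact: Int_measurable].
Qed.

Let ln_f0 t : 1 <= t -> ln (f0 t) = 2 * ln t + 2 * ln (C t) - ln (D t).
Proof.
move=> t1; have t0 : 0 < t by lra.
have Ct := C_gt0 t1; have Dt := D_gt0 t1.
have p1 : 0 < t ^+ 2 by rewrite exprn_gt0.
have p2 : 0 < C t ^+ 2 by rewrite exprn_gt0.
rewrite /f0 (@ln_div _ (t ^+ 2 * C t ^+ 2)) ?posrE ?mulr_gt0//.
by rewrite (@lnM _ (t ^+ 2)) ?posrE// !lnXn//; ring.
Qed.

Let ln_f1 t : 1 <= t -> 0 < F t -> ln (f1 t) = 2 * ln (C t) + 2 * ln (F t).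
Proof.
move=> t1 Ft; have Ct := C_gt0 t1.
by rewrite /f1 lnXn ?mulr_gt0// lnM ?posrE//; rewrite /F; ring.
Qed.

Lemma f0_inverse_ex : exists f0m : R -> R, asymptotic_inverse f0 f0m.
Proof. exact: asymptotic_inverse_ex rho_gt0 lf0 uf0 mf0. Qed.

(** The function f1 vanishes at 1, which [locbd] excludes; the inverse is constructed for the asymptotic
    function obtained by adding 1 to the integral. *)
Lemma f1_inverse_ex : exists f1m : R -> R, asymptotic_inverse f1 f1m.
Proof.
pose F' t := 1 + F t.
have F'1 t : 1 <= F' t by rewrite /F' lerDl Int_ge0.
have lF' : locbd F'.
  split=> [t _|X]; first by have := F'1 t; lra.
  exists (ln (F' (Num.max 1 X))) => t /andP[t1 tX].
  have h : F' t <= F' (Num.max 1 X).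
    by rewrite lerD2l; apply: Int_mono => //; rewrite le_max tX orbT.
  have p u : 0 < F' u by exact: lt_le_trans (F'1 u).
  by rewrite ger0_norm ?ln_ge0// ler_ln ?posrE.
have F0 : \forall t \near +oo, 0 < F t.
  by apply: filterS (pinfty_ge 1 Foo) => t; lra.
have sim : ln (F t) - ln (F' t) @[t --> +oo] --> 0.
  apply/cvgrPdist_le => e e0; near=> t.
  have Ft : 0 < F t by near: t.
  have Fe : e^-1 <= F t by near: t; exact: pinfty_ge Foo.
  have F't : 0 < F' t by have := F'1 t; lra.
  have h1 : ln (F t) <= ln (F' t) by rewrite ler_ln ?posrE// /F'; lra.
  have h2 : ln (F' t) - ln (F t) <= (F t)^-1.
    rewrite -ln_div ?posrE//; have -> : F' t / F t = 1 + (F t)^-1.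
      by rewrite /F'; field; rewrite gt_eqF.
    apply: le_ln1Dx; have : 0 < (F t)^-1 by rewrite invr_gt0.
    lra.
  have h3 : (F t)^-1 <= e by rewrite -[e]invrK lef_pV2 ?posrE ?invr_gt0.
  by rewrite sub0r ler_norml; apply/andP; split; lra.
have sim' : ln (F' t) - ln (F t) @[t --> +oo] --> 0.
  rewrite (_ : (fun t => ln (F' t) - _) = (fun t => - (ln (F t) - ln (F' t)))); last first.
    by apply/funext => t; rewrite opprB.
  by rewrite -oppr0; exact: cvgN sim.
have F'0 : \forall t \near +oo, 0 < F' t.
  by near=> t; exact: lt_le_trans (F'1 t).
have uF' : uvar F' (1 - delta / 2) by exact: uvar_close uF F'0 sim'.
pose a' t := (C t * F' t) * (C t * F' t).
have ua' : uvar a' rho.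
  have u1 := uvarM uvar_C uF'.
  by by refine (uvar_eqind _ (uvarM u1 u1)); rewrite /rho; field.
have la' : locbd a'.
  have l1 := locbdM locbd_C lF'.
  exact: (locbdM l1 l1).
have mF' : measurable_fun I1 F'.
  by apply: measurable_funD; [exact: measurable_cst|exact: Int_measurable].
have ma' : measurable_fun I1 a'.
  by apply: measurable_funM; apply: measurable_funM => //; exact: mC.
have [b inv] := asymptotic_inverse_ex rho_gt0 la' ua' ma'.
exists b; apply: (asymptotic_inverse_sim rho_gt0 uf1 ua' mf1 _ inv).
have : (ln (F t) - ln (F' t)) + (ln (F t) - ln (F' t)) @[t --> +oo] --> 0.
  by rewrite -[0]addr0; exact: (cvgD sim sim).
apply: cvg_trans; apply: near_eq_cvg.
near=> t; have t1 : 1 <= t by near: t; exact: near_ge.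
have Ft : 0 < F t by near: t.
have F't : 0 < F' t by have := F'1 t; lra.
have Ct := C_gt0 t1.
rewrite ln_f1// /a' (@lnM _ (C t * F' t)) ?posrE ?mulr_gt0//.
by rewrite (@lnM _ (C t)) ?posrE//; ring.
Unshelve. all: by end_near. Qed.

Section inverses.
Variables (f0m f1m : R -> R).
Hypothesis inv0 : asymptotic_inverse f0 f0m.
Hypothesis inv1 : asymptotic_inverse f1 f1m.

(** The solution t of f0(t) = r lies between k(r) and h(r) up to constants, by the two comparisons in
    the hypothesis, and there gint(t, r) is at least a multiple of sqrt r t / sqrt D(t) = r / C(t). *)
Lemma f0_lesssim_Binf : lesssim_oo (fun r => r / C (f0m r)) Bi.
Proof.
have [oo0 _ sol _] := asymptotic_inverseP rho_gt0 uf0 inv0.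
have [M1 M10 HM1] := dl_tC; have [M2 M20 HM2] := tC_D.
have [c c0 Hc] := gint_mid_ge (2 * M1 + 2 * M2 + 1).
have [c2 c20 Hc2] := Binf_ge.
pose m := Num.min 1 (c * expR (- 2^-1)).
have m0 : 0 < m by rewrite lt_min ltr01/= mulr_gt0// expR_gt0.
have aux (lt lC lD ld lr : R) : - ld <= lt + lC + M1 -> lt + lC <= lD + M2 ->
   - 1 <= 2 * lt + 2 * lC - lD - lr -> 2 * lt + 2 * lC - lD - lr <= 1 ->
   [/\ lr <= lD + (2 * M1 + 2 * M2 + 1),
       - lD - 2 * ld <= lr + (2 * M1 + 2 * M2 + 1) &
       - 2^-1 + (lr - lC) <= lt + (lr / 2 + - lD / 2)] by move=> *; split; lra.
apply: (@lesssim_near _ _ _ (c2 * m)^-1); first by rewrite invr_gt0 mulr_gt0.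
near=> r; have r0 : 0 < r by near: r; exact: nbhs_pinfty_gt.
have t2 : 2 <= f0m r by near: r; exact: pinfty_ge oo0.
have : `|0 - (ln (f0 (f0m r)) - ln r)| <= 1.
  by near: r; move/cvgrPdist_le : sol; exact.
move: t2; set t := f0m r => t2.
have t1 : 1 <= t by lra.
have t0 : 0 < t by lra.
have Ct := C_gt0 t1; have pt := density_gt0 t1.
have sr : 0 < Num.sqrt r by rewrite sqrtr_gt0.
rewrite sub0r normrN ln_f0// ler_norml => /andP[s1 s2].
have [a1 a2 a3] := aux _ _ _ _ _ (HM1 t t1) (HM2 t t1) s1 s2.
have lq : ln (quot t) = - ln (D t) - 2 * ln (dl t).
  by rewrite lnquotE// lnDE//; ring.
have g := Hc r t r0 t2 a1; rewrite lq in g; have {}g := g a2.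
have q0 : 0 < r / C t by rewrite divr_gt0.
rewrite ler_pdivlMl ?mulr_gt0// -mulrA; apply: (Hc2 r t) => //.
- by rewrite mulr_gt0.
- apply: le_trans g; rewrite -mulrA.
  apply: (@le_trans _ _ (c * (expR (- 2^-1) * (r / C t)))).
    by rewrite [leRHS]mulrA ler_pM2r// ge_min lexx orbT.
  rewrite ler_pM2l//.
  have -> : r / C t = expR (ln r - ln (C t)) by rewrite expRB !lnK.
  have -> : t * (Num.sqrt r * phi t) = expR (ln t + (ln r / 2 + - ln (D t) / 2)).
    by rewrite !expRD -(lndensityE t1) -ln_sqrt// !lnK.
  by rewrite -expRD ler_expR.
- by rewrite ler_piMl ?(ltW q0)// ge_min lexx.
Unshelve. all: by end_near. Qed.

Local Notation tau := (fun r => fine (Order.min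
  (Order.max (f1m r)%:E (kfun r)) (hfun r))).

(** Which of the three points is attained; when h(r) is attained it is finite, and then
    the quotient at h(r) is comparable with r. *)
Let tau_spec r := [\/ f1m r <= kk r /\ tau r = kk r,
  [/\ kk r <= f1m r, ((f1m r)%:E <= hfun r)%E & tau r = f1m r] |
  [/\ kk r <= hh r, hh r <= f1m r, tau r = hh r, hfun r = (hh r)%:E &
    `|ln r - ln (quot (hh r))| <= 1]].

Let tauP : \forall r \near +oo, 1 <= f1m r /\ tau_spec r.
Proof.
have [oo1 _ _ _] := asymptotic_inverseP rho_gt0 uf1 inv1.
have h_alt : \forall r \near +oo, hfun r = +oo%E \/
    (hfun r = (hh r)%:E /\ `|ln r - ln (quot (hh r))| <= 1).
  have [hoo|ub] := hh_cases; first by apply: filterS hoo; left.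
  by apply: filterS2 (hfun_fin ub) (lnquot_hh ub) => r; right.
near=> r; have r0 : 0 < r by near: r; exact: nbhs_pinfty_gt.
have kE : kfun r = (kk r)%:E by near: r; exact: kfun_fin.
have kh : ((kk r)%:E <= hfun r)%E by rewrite -kE; exact: k_le_h.
split; first by near: r; exact: pinfty_ge oo1.
rewrite /tau_spec kE; have [fk|/ltW kf] := leP (f1m r) (kk r).
  apply: Or31; split => //.
  by rewrite max_r ?lee_fin// min_l.
rewrite max_l ?lee_fin//.
have [fh|/ltW hf] := leP (f1m r)%:E (hfun r).
  by apply: Or32; split.
apply: Or33.
have [E|[E hq]] : hfun r = +oo%E \/
  (hfun r = (hh r)%:E /\ `|ln r - ln (quot (hh r))| <= 1) by near: r.
  by move: hf; rewrite E leye_eq.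
split => //; first by rewrite -lee_fin -E.
by rewrite -lee_fin -E.
Unshelve. all: by end_near. Qed.

Lemma Binf_lesssim_tau : lesssim_oo Bi (fun r => Bf (tau r) r).
Proof.
apply: (@lesssim_near _ _ _ 1) => //; near=> r; rewrite mul1r.
have r0 : 0 < r by near: r; exact: nbhs_pinfty_gt.
have k1 : 1 <= kk r by near: r; exact: pinfty_ge kk_pinfty.
apply: Binf_le => //.
have [fge1 [[_ ->]|[_ _ ->]|[kh _ -> _ _]]] : 1 <= f1m r /\ tau_spec r.
  by near: r; exact: tauP.
- by [].
- by [].
- exact: le_trans kh.
Unshelve. all: by end_near. Qed.

(** This is the equation f1(t) = r in a different form. *)
Let sqrt_Int_le : \forall r \near +oo, Num.sqrt r * F (f1m r) <= expR 1 * (r / C (f1m r)).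
Proof.
have [oo1 _ sol _] := asymptotic_inverseP rho_gt0 uf1 inv1.
have aux (lr lC lF : R) : - 1 <= 2 * lC + 2 * lF - lr <= 1 -> lr / 2 + lF <= lr - lC + 1.
  by move=> /andP[? ?]; lra.
near=> r; have r0 : 0 < r by near: r; exact: nbhs_pinfty_gt.
have t1 : 1 <= f1m r by near: r; exact: pinfty_ge oo1.
have Ft : 0 < F (f1m r).
  by apply: lt_le_trans ltr01 _; near: r; exact: pinfty_near oo1 (pinfty_ge 1 Foo).
have s : `|0 - (ln (f1 (f1m r)) - ln r)| <= 1.
  by near: r; move/cvgrPdist_le : sol; exact.
have sr : 0 < Num.sqrt r by rewrite sqrtr_gt0.
have Ct := C_gt0 t1; have W0 : 0 < r / C (f1m r) by rewrite divr_gt0.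
have sF : 0 < Num.sqrt r * F (f1m r) by exact: mulr_gt0.
rewrite ler_expRM// (@lnM _ (Num.sqrt r)) ?posrE// (@ln_div _ r) ?posrE// ln_sqrt//.
by move: s; rewrite ln_f1// sub0r normrN ler_norml; exact: aux.
Unshelve. all: by end_near. Qed.

Let k_le_rC : exists2 c, 0 < c & \forall r \near +oo, kk r <= c * (r / C (kk r)).
Proof.
have [M M0 HM] := tC_D; have [N N0 HN] := lnD_kk.
have aux (lr lk lD lC : R) : lk + lC <= lD + M -> lr - lD >= - N -> lk <= lr - lC + (M + N).
  by move=> *; lra.
exists (expR (M + N)); [exact: expR_gt0|near=> r].
have r0 : 0 < r by near: r; exact: nbhs_pinfty_gt.
have k1 : 1 <= kk r by near: r; exact: pinfty_ge kk_pinfty.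
have k0 : 0 < kk r by exact: lt_le_trans k1.
have Ck := C_gt0 k1; have W0 : 0 < r / C (kk r) by rewrite divr_gt0.
have : `|ln r - ln (D (kk r))| <= N by near: r.
rewrite ler_norml => /andP[h _].
by rewrite ler_expRM// (@ln_div _ r) ?posrE//; exact: aux (HM _ k1) h.
Unshelve. all: by end_near. Qed.

(** If h(r) cuts off the balance point, then r / C(h(r)) is still controlled, because 1 / dl is at most a
    multiple of t C(t). *)
Let rC_h_le : exists2 c, 0 < c & \forall r \near +oo, 2 <= hh r ->
  `|ln r - ln (quot (hh r))| <= 1 -> r / C (hh r) <= c * (Num.sqrt r * F (hh r)).
Proof.
have [M M0 HM] := dl_tC; have [A HA] := ln_Int_ge lphi mphi uphi.
have aux (lr ll lp lh lC lF : R) : - ll <= lh + lC + M ->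
  lh + - (- ll - lp) / 2 <= lF + A -> lr - (lp - ll) <= 1 ->
  lr - lC <= lr / 2 + lF + (M + A + 1) by move=> *; lra.
exists (expR (M + A + 1)); [exact: expR_gt0|near=> r => h2 hq].
have r0 : 0 < r by near: r; exact: nbhs_pinfty_gt.
have h1 : 1 <= hh r by apply: le_trans h2; rewrite ler1n.
have h0 : 0 < hh r by exact: lt_le_trans h1.
have Ch := C_gt0 h1; have W0 : 0 < r / C (hh r) by rewrite divr_gt0.
have sr : 0 < Num.sqrt r by rewrite sqrtr_gt0.
have [Fh hF] : 0 < F (hh r) /\ _ := HA _ h2.
have sF : 0 < Num.sqrt r * F (hh r) by exact: mulr_gt0.
rewrite ler_expRM// (@lnM _ (Num.sqrt r)) ?posrE// ln_sqrt// (@ln_div _ r) ?posrE//.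
move: hF hq; rewrite (lndensityE h1) (lnDE h1) (lnquotE h1) ler_norml.
by move=> hF /andP[_ hq]; exact: aux (HM _ h1) hF hq.
Unshelve. all: by end_near. Qed.

Let gint_le : exists2 c, 0 < c & \forall r \near +oo, forall t, kk r <= t ->
  (t%:E <= hfun r)%E -> gint t r <= c * (Num.sqrt r * F t).
Proof.
have [M M0 HM] := gint_mid_le; have [c c0 Hc] := kk_le_Int.
exists (M * c + 1); first by rewrite ltr_wpDl// mulr_ge0// ltW.
near=> r => t kt th; have r0 : 0 < r by near: r; exact: nbhs_pinfty_gt.
have k1 : 1 <= kk r by near: r; exact: pinfty_ge kk_pinfty.
have sr : 0 < Num.sqrt r by rewrite sqrtr_gt0.
have H : forall t, kk r <= t -> (t%:E <= hfun r)%E ->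
  gint t r <= M * kk r + Num.sqrt r * Int phi (kk r) t by near: r.
have hk : kk r <= c * (Num.sqrt r * F (kk r)) by near: r.
apply: le_trans (H t kt th) _; rewrite mulrDl mul1r; apply: lerD; last first.
  by rewrite (ler_pM2l sr); apply: Int_monol.
rewrite -(mulrA M); apply: (ler_wpM2l M0); apply: (le_trans hk).
by rewrite (ler_pM2l c0) (ler_pM2l sr); exact: Int_mono.
Unshelve. all: by end_near. Qed.

(** If the balance point of the middle phase lies before k(r), the bound r / C(k(r)) suffices because C is
    almost monotone; if it lies between k(r) and h(r), both terms are about r / C; if it lies after h(r),
    both terms at h(r) are bounded by the middle integral. *)
Lemma tau_lesssim_f1 : lesssim_oo (fun r => Bf (tau r) r) (fun r => r / C (f1m r)).
Proof.
have [M M0 HM] := gint_k_le; have [c1 c10 Hc1] := k_le_rC.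
have [c2 c20 Hc2] := rC_h_le; have [c3 c30 Hc3] := gint_le.
have [B B0 HB] := C_almost_mono; have eB : 0 < expR B by exact: expR_gt0.
have [oo1 _ _ _] := asymptotic_inverseP rho_gt0 uf1 inv1.
have auxB (a b c : R) : a <= b + B -> c - b <= c - a + B by move=> *; lra.
pose e := expR 1 : R; have e0 : 0 < e by exact: expR_gt0.
pose K1 := M * (c1 * expR B); pose K2 := c2 * e; pose K3 := c3 * e.
have K10 : 0 <= K1 by rewrite mulr_ge0// mulr_ge0// ltW.
have K20 : 0 <= K2 by rewrite mulr_ge0// ltW.
have K30 : 0 <= K3 by rewrite mulr_ge0// ltW.
pose K := K1 + K2 + K3 + expR B + 1.
have [L0 [L1 L2 L3 LB]] : 0 < K /\ [/\ K1 <= K, K2 <= K, K3 <= K & expR B <= K].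
  by rewrite /K; do !split; lra.
have L4 : 1 <= K by rewrite /K; lra.
clearbody K; apply: (lesssim_near L0); near=> r.
have r0 : 0 < r by near: r; exact: nbhs_pinfty_gt.
have sr : 0 < Num.sqrt r by rewrite sqrtr_gt0.
have k2 : 2 <= kk r by near: r; exact: pinfty_ge kk_pinfty.
have k1 : 1 <= kk r by near: r; exact: pinfty_ge kk_pinfty.
have [t1 cases] : 1 <= f1m r /\ tau_spec r by near: r; exact: tauP.
have FW : Num.sqrt r * F (f1m r) <= e * (r / C (f1m r)) by near: r; exact: sqrt_Int_le.
have gk : gint (kk r) r <= M * kk r by near: r.
have kC : kk r <= c1 * (r / C (kk r)) by near: r.
have hC' : 2 <= hh r -> `|ln r - ln (quot (hh r))| <= 1 ->
  r / C (hh r) <= c2 * (Num.sqrt r * F (hh r)) by near: r.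
have gF : forall t, kk r <= t -> (t%:E <= hfun r)%E -> gint t r <= c3 * (Num.sqrt r * F t).
  by near: r.
have W0 : 0 < r / C (f1m r) by rewrite divr_gt0// C_gt0.
have leK (c x : R) : c <= K -> x <= c * (r / C (f1m r)) -> x <= K * (r / C (f1m r)).
  by move=> cK h; apply: le_trans h _; rewrite (ler_pM2r W0).
have below (c x t : R) : 0 < c -> 1 <= t -> t <= f1m r -> x <= c * (Num.sqrt r * F t) ->
    x <= c * e * (r / C (f1m r)).
  move=> c0 s1 tf h; apply: (le_trans h); rewrite -mulrA (ler_pM2l c0); apply: le_trans FW.
  by rewrite (ler_pM2l sr); exact: Int_mono.
case: cases => [[fk ->]|[kf fh ->]|[kh hf -> hE hq]]; rewrite /Bfun ge_max; apply/andP; split.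
- apply: (leK K1) => //; apply: (le_trans gk); rewrite /K1 -mulrA; apply: (ler_wpM2l M0).
  apply: (le_trans kC); rewrite -mulrA (ler_pM2l c10).
  rewrite ler_expRM ?divr_gt0 ?C_gt0// !(@ln_div _ r) ?posrE ?C_gt0//.
  exact: auxB (HB _ _ t1 fk).
- apply: (leK (expR B)) => //.
  rewrite ler_expRM ?divr_gt0 ?C_gt0// !(@ln_div _ r) ?posrE ?C_gt0//.
  exact: auxB (HB _ _ t1 fk).
- by apply: (leK K3) => //; apply: (below _ _ (f1m r)) => //; exact: gF.
- by rewrite ler_peMl// ltW.
- apply: (leK K3) => //; apply: (below _ _ (hh r)) => //; first exact: le_trans kh.
  by apply: gF; rewrite ?hE.
apply: (leK K2) => //; apply: (below _ _ (hh r)) => //; first exact: le_trans kh.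
by apply: hC' => //; exact: le_trans kh.
Unshelve. all: by end_near. Qed.

Let indE (d g : R) : 0 < 2 - d + 2 * g ->
  1 - g * (2 - d + 2 * g)^-1 = (2 - d + g) / (2 - d + 2 * g).
Proof. by move=> h; field; rewrite gt_eqF. Qed.

Lemma rv_f0_bound : regularly_varying (fun r => r / C (f0m r))
  ((2 - delta + gamma) / (2 - delta + 2 * gamma)).
Proof.
have [oo0 u0 _ [x0 m0]] := asymptotic_inverseP rho_gt0 uf0 inv0.
by rewrite -indE//; exact: (rv_div_C u0 oo0 m0).
Qed.

Lemma rv_f1_bound : regularly_varying (fun r => r / C (f1m r))
  ((2 - delta + gamma) / (2 - delta + 2 * gamma)).
Proof.
have [oo1 u1 _ [x0 m1]] := asymptotic_inverseP rho_gt0 uf1 inv1.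
by rewrite -indE//; exact: (rv_div_C u1 oo1 m1).
Qed.

(** For delta < 2 the integral in f1 is comparable with t / sqrt D(t), so that f1 is at most a multiple of
    f0, and the inverses compare in the opposite order. *)
Lemma f1_lesssim_f0 : delta < 2 ->
  lesssim_oo (fun r => r / C (f1m r)) (fun r => r / C (f0m r)).
Proof.
move=> d2; have r1 : -1 < - (delta / 2) by lra.
have [M HM] := ln_Int_le lphi mphi uphi r1 Foo.
have ff : lesssim_oo f1 f0.
  apply: (@lesssim_ln _ _ _ (2 * M)); near=> t.
  have t1 : 1 <= t by near: t; exact: near_ge.
  have Ft1 : 1 <= F t by near: t; exact: pinfty_ge Foo.
  have Ft : 0 < F t by lra.
  have hF : ln (F t) <= ln t + ln (phi t) + M by near: t.
  split; first by rewrite exprn_gt0// mulr_gt0// C_gt0.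
    by case: lf0 => + _; exact.
  by rewrite ln_f1// ln_f0//; rewrite (lndensityE t1) in hF; lra.
have [M' HM'] := inverse_le rho_gt0 rho_gt0 uf1 uf0 inv1 inv0 ff.
have [N HN] := lnC_le M'.
have [oo0 _ _ _] := asymptotic_inverseP rho_gt0 uf0 inv0.
have [oo1 _ _ _] := asymptotic_inverseP rho_gt0 uf1 inv1.
apply: (@lesssim_ln _ _ _ N); near=> r.
have r0 : 0 < r by near: r; exact: nbhs_pinfty_gt.
have a0 : 1 <= f0m r by near: r; exact: pinfty_ge oo0.
have a1 : 1 <= f1m r by near: r; exact: pinfty_ge oo1.
have h : ln (f0m r) <= ln (f1m r) + M' by near: r.
have C0 := C_gt0 a0; have C1 := C_gt0 a1.
rewrite !divr_gt0//; split => //.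
have := HN _ _ a0 a1 h; rewrite !(@ln_div _ r) ?posrE//; lra.
Unshelve. all: by end_near. Qed.

End inverses.

End middle_phase.

(** * The last phase dominates *)

Section last_phase.
Hypothesis hD : hypD dl dphi cl cphi.

Let Ip : (\int[@lebesgue_measure R]_(s in `[1%R, +oo[) (phi s)%:E = +oo)%E.
Proof. by case: hD. Qed.

Let Id : (\int[@lebesgue_measure R]_(s in `[1%R, +oo[) (dl s)%:E < +oo)%E.
Proof. by case: hD. Qed.

Let tC_dl : exists2 M, 0 <= M & forall t, 1 <= t -> ln t + ln (C t) <= - ln (dl t) + M.
Proof.
have [H _ _] := hD.
have tC0 t : 1 <= t -> 0 < t * C t by move=> t1; rewrite mulr_gt0 ?C_gt0//; lra.
have dV t : 1 <= t -> 0 < (dl t)^-1 by move=> t1; rewrite invr_gt0 dl_gt0.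
have [M M0 HM] := ln_lesssim_on tC0 dV H; exists M => // t t1.
have t0 : 0 < t by lra.
by have := HM t t1; rewrite (lnV (dl_gt0 t1)) (@lnM _ t) ?posrE ?C_gt0.
Qed.

Let bphi : intb phi := intb_density.
Let bdl : intb dl := intb_dl.
Let F t := Int phi 1 t.
Let Foo : F t @[t --> +oo] --> +oo. Proof. exact: Int_pinfty bphi Ip. Qed.

(** If dphi <= M dl, then 1 / sqrt D = sqrt (dphi dl) would be at most a multiple of dl and hence
    integrable. *)
Let quot_exceeds (M : R) : ~ (forall t, 1 <= t -> quot t <= M).
Proof.
move=> H; have q1 := quot_gt0 (lexx 1).
have M0 : 0 < M by apply: lt_le_trans q1 (H 1 _).
pose c := expR (ln M / 2); have c0 : 0 < c by exact: expR_gt0.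
have h s : 1 <= s -> phi s <= c * dl s.
  move=> s1; have := H s s1; have qs := quot_gt0 s1.
  rewrite -ler_ln ?posrE// (lnquotE s1) => hq.
  rewrite -ler_ln ?posrE ?mulr_gt0 ?dl_gt0 ?density_gt0// (@lnM _ c) ?posrE ?dl_gt0//.
  by rewrite expRK (lndensityE s1) (lnDE s1); lra.
have /nearyP[X X1 HX] := pinfty_ge (c * Tail dl 1 + 1) Foo.
have := HX X (lexx X); have : F X <= c * Int dl 1 X.
  rewrite -Int_scale//; apply: Int_le => //; first exact: intb_scale (ltW c0) bdl.
  by move=> s /andP[s1 _]; exact: h.
have : c * Int dl 1 X <= c * Tail dl 1.
  by rewrite ler_pM2l//; exact: (Int_le_Tail ldl mdl Id).
lra.
Qed.

Lemma quot_not_bounded : ~ [bounded dphi t / dl t | t in `[1, +oo[].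
Proof.
move=> [M [_ HM]]; apply: (@quot_exceeds (`|M| + 1)) => t t1.
have := HM (`|M| + 1) ltac:(by have := ler_norm M; lra) t.
by rewrite /= in_itv/= andbT => /(_ t1); exact: le_trans (ler_norm _).
Qed.

Let ub : unbounded quot.
Proof.
move=> M; apply: contrapT => H; apply: (@quot_exceeds M) => t t1.
by rewrite leNgt; apply/negP => h; apply: H; exists t.
Qed.

Let hoo := hh_pinfty ub.

Let low r := r * hh r * dl (hh r).
Let U r := Num.sqrt r * Int phi 1 (hh r) + r * Tail dl (hh r).

(** At h(r) the quotient dphi / dl is about r, which makes the middle and the last expression of the
    integrand comparable. *)
Let balance : \forall r \near +oo,
  `|ln (r * dl (hh r)) - ln (Num.sqrt r * phi (hh r))| <= 2^-1.
Proof.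
have aux (lr ll lp : R) : - 1 <= lr - (lp - ll) <= 1 ->
    - 2^-1 <= lr + ll - (lr / 2 + - (- ll - lp) / 2) <= 2^-1.
  by move=> /andP[? ?]; apply/andP; split; lra.
near=> r; have r0 : 0 < r by near: r; exact: nbhs_pinfty_gt.
have h1 : 1 <= hh r by near: r; exact: pinfty_ge hoo.
have : `|ln r - ln (quot (hh r))| <= 1 by near: r; exact: lnquot_hh ub.
rewrite (lnquotE h1) ler_norml => /aux.
rewrite ler_norml (@lnM _ r) ?posrE ?dl_gt0//.
by rewrite (@lnM _ (Num.sqrt r)) ?posrE ?sqrtr_gt0 ?density_gt0// ln_sqrt// (lndensityE h1) (lnDE h1).
Unshelve. all: by end_near. Qed.

(** At h(r) the integral is at least a multiple of h(r) times the integrand, and r / C(h(r)) is at least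
    as large because t C(t) is at most a multiple of 1 / dl(t). *)
Lemma h_lesssim_Binf : lesssim_oo low Bi.
Proof.
have [M1 M10 HM1] := tC_dl.
have [c c0 Hc] := gint_mid_ge 1.
have [c2 c20 Hc2] := Binf_ge.
pose m := Num.min (expR (- M1)) (c * expR (- 2^-1)).
have m0 : 0 < m by rewrite lt_min expR_gt0/= mulr_gt0// expR_gt0.
have aux (lr ll lp : R) : - 1 <= lr - (lp - ll) <= 1 -> lp <= 0 ->
    lr <= - ll - lp + 1 /\ lp - ll <= lr + 1.
  by move=> /andP[? ?] ?; split; lra.
have aux3 (lr ll lh lC : R) : lh + lC <= - ll + M1 -> - M1 + (lr + lh + ll) <= lr - lC.
  by move=> ?; lra.
apply: (@lesssim_near _ _ _ (c2 * m)^-1); first by rewrite invr_gt0 mulr_gt0.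
near=> r; have r0 : 0 < r by near: r; exact: nbhs_pinfty_gt.
have h2 : 2 <= hh r by near: r; exact: pinfty_ge hoo.
have h1 : 1 <= hh r by near: r; exact: pinfty_ge hoo.
have h0 : 0 < hh r by exact: lt_le_trans h1.
have dh := dl_gt0 h1; have ph := density_gt0 h1; have Ch := C_gt0 h1.
have dph := dphi_gt0 h1.
have lp0 : ln (dphi (hh r)) <= 0 by apply: ln_le0; exact: (dphi_le1 st).
have : `|ln r - ln (quot (hh r))| <= 1 by near: r; exact: lnquot_hh ub.
rewrite (lnquotE h1) ler_norml => /aux/(_ lp0)[a1 a2].
have := Hc r (hh r) r0 h2; rewrite (lnDE h1) (lnquotE h1) => /(_ a1 a2) g.
have low0 : 0 < low r by rewrite /low !mulr_gt0.
rewrite ler_pdivlMl ?mulr_gt0// -mulrA; apply: (Hc2 r (hh r)) => //.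
- exact: mulr_gt0.
- apply: le_trans g.
  apply: (@le_trans _ _ (c * expR (- 2^-1) * low r)).
    by rewrite ler_pM2r// ge_min lexx orbT.
  rewrite -!mulrA ler_pM2l// /low [in leLHS](mulrC r) -!mulrA mulrCA ler_pM2l//.
  have : `|ln (r * dl (hh r)) - ln (Num.sqrt r * phi (hh r))| <= 2^-1 by near: r.
  rewrite ler_norml => /andP[_ b2].
  have sp : 0 < Num.sqrt r * phi (hh r) by rewrite mulr_gt0 ?sqrtr_gt0.
  have rd : 0 < r * dl (hh r) by rewrite mulr_gt0.
  rewrite -[r * dl (hh r)]lnK// -[leRHS]lnK// -expRD ler_expR.
  by rewrite addrC lerBlDr -lerBlDl.
- apply: (@le_trans _ _ (expR (- M1) * low r)).
    by rewrite ler_pM2r// ge_min lexx.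
  have -> : r / C (hh r) = expR (ln r - ln (C (hh r))) by rewrite expRB !lnK.
  have -> : low r = expR (ln r + ln (hh r) + ln (dl (hh r))) by rewrite !expRD !lnK.
  by rewrite -expRD ler_expR; exact: aux3 (HM1 _ h1).
Unshelve. all: by end_near. Qed.

Let U_gt0 : \forall r \near +oo, [/\ 2 <= hh r, 0 < Int phi 1 (hh r) & 0 < Tail dl (hh r)].
Proof.
have [A HA] := ln_Int_ge lphi mphi uphi.
have [B HB] := ln_Tail_ge ldl mdl udl Id.
near=> r; have h2 : 2 <= hh r by near: r; exact: pinfty_ge hoo.
have h1 : 1 <= hh r by near: r; exact: pinfty_ge hoo.
by split => //; [have [] := HA _ h2|have [] := HB _ h1].
Unshelve. all: by end_near. Qed.

(** The integral of the integrand over the whole half-line, the first phase being absorbed by the middle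
    one. *)
Lemma Binf_lesssim_h : lesssim_oo Bi U.
Proof.
have [M M0 HM] := gint_hi_le; have [c c0 Hc] := kk_le_Int.
have Mc0 : 0 <= M * c := mulr_ge0 M0 (ltW c0).
have K0 : 0 < M * c + 1 by rewrite ltr_wpDl.
have aux (x y z : R) : 0 <= z -> x <= M * c * y -> x + y + z <= (M * c + 1) * (y + z).
  move=> z0 h; have : 0 <= M * c * z by rewrite mulr_ge0.
  lra.
apply: (lesssim_near K0); near=> r.
have r0 : 0 < r by near: r; exact: nbhs_pinfty_gt.
have sr : 0 < Num.sqrt r by rewrite sqrtr_gt0.
have k1 : 1 <= kk r by near: r; exact: pinfty_ge kk_pinfty.
have hE : hfun r = (hh r)%:E by near: r; exact: hfun_fin ub.
have kE : kfun r = (kk r)%:E by near: r; exact: kfun_fin.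
have kh : kk r <= hh r by rewrite -lee_fin -kE -hE k_le_h.
have h1 : 1 <= hh r by exact: le_trans kh.
have [h2 Fh Th] : [/\ 2 <= hh r, 0 < Int phi 1 (hh r) & 0 < Tail dl (hh r)] by near: r.
have H : forall h t, hfun r = h%:E -> h <= t ->
  gint t r <= M * kk r + Num.sqrt r * Int phi (kk r) h + r * Int dl h t by near: r.
have hk : kk r <= c * (Num.sqrt r * Int phi 1 (kk r)) by near: r.
have U0 : 0 < U r by rewrite /U addr_gt0 ?mulr_gt0.
apply: (Binf_le_limit (T := hh r)) => //; first exact: mulr_gt0.
move=> t ht; apply: le_trans (H _ t hE ht) _.
apply: (@le_trans _ _ (M * kk r + Num.sqrt r * Int phi 1 (hh r) + r * Tail dl (hh r))).
  apply: lerD; last by rewrite ler_pM2l//; exact: (Int_le_Tail ldl mdl Id).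
  by rewrite lerD2l ler_pM2l//; exact: Int_monol.
apply: aux; first by rewrite mulr_ge0 ?ltW.
rewrite -(mulrA M c); apply: (ler_wpM2l M0); apply: (le_trans hk).
apply: (ler_wpM2l (ltW c0)); apply: (ler_wpM2l (ltW sr)); exact: Int_mono.
Unshelve. all: by end_near. Qed.

Lemma rv_h_bounds : deltaphi < deltal ->
  regularly_varying low ((1 - deltaphi) / (deltal - deltaphi)) /\
  regularly_varying U ((1 - deltaphi) / (deltal - deltaphi)).
Proof.
move=> dd; have [uh [x0 mh]] := hh_rv dd.
have d0 : 0 < deltal - deltaphi by lra.
have uF := uvar_Int lphi mphi uphi Foo.
have uT := uvar_Tail ldl mdl udl Id.
have e1 (x y : R) : 0 < x - y -> 1 + (x - y)^-1 + - x * (x - y)^-1 = (1 - y) / (x - y).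
  by move=> h; field; rewrite gt_eqF.
have e2 (x y : R) : 0 < x - y ->
    1 / 2 + (1 + - ((x + y) / 2)) * (x - y)^-1 = (1 - y) / (x - y).
  by move=> h; field; rewrite gt_eqF.
have e3 (x y : R) : 0 < x - y -> 1 + (1 + - x) * (x - y)^-1 = (1 - y) / (x - y).
  by move=> h; field; rewrite gt_eqF.
have [x1 m1] := measurable_comp_pinfty mdl mh hoo.
have [x2 m2] := measurable_comp_pinfty (Int_measurable bphi) mh hoo.
have [x3 m3] := measurable_comp_pinfty (Tail_measurable ldl mdl Id) mh hoo.
pose x := Num.max (Num.max x0 x1) (Num.max x2 x3).
have sub (y : R) (f : R -> R) : y <= x -> measurable_fun `[y, +oo[ f -> measurable_fun `[x, +oo[ f.
  move=> yx; apply: measurable_funS => // z /=.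
  by rewrite !in_itv/= !andbT; exact: le_trans.
split.
  apply: (@uvar_rv _ _ _ x).
    by rewrite -e1//; exact: uvarM (uvarM (@uvar_id R) uh) (uvar_comp udl uh hoo).
  apply: measurable_funM; last by apply: sub m1; rewrite /x !le_max lexx orbT.
  by apply: measurable_funM => //; apply: sub mh; rewrite /x !le_max lexx.
apply: (@uvar_rv _ _ _ x).
  apply: uvarD.
    by rewrite -e2//; exact: uvarM (uvar_sqrt (@uvar_id R)) (uvar_comp uF uh hoo).
  by rewrite -e3//; exact: uvarM (@uvar_id R) (uvar_comp uT uh hoo).
apply: measurable_funD.
  apply: measurable_funM; first exact: sqrt_measurable.
  by apply: sub m2; rewrite /x !le_max lexx !orbT.
by apply: measurable_funM => //; apply: sub m3; rewrite /x !le_max lexx !orbT.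
Qed.

(** Neither of the two integrals is critical, so both are comparable with h(r) times the common size of
    the integrand at h(r). *)
Lemma h_bounds_match : delta < 2 -> 1 < deltal -> lesssim_oo U low.
Proof.
move=> d2 d1; have r1 : -1 < - (delta / 2) by lra.
have r2 : - deltal < -1 by lra.
have [M HM] := ln_Int_le lphi mphi uphi r1 Foo.
have [N HN] := ln_Tail_le ldl mdl udl Id r2.
have aux1 (lF lh lphi lrd lsp ls : R) : lF <= lh + lphi + M -> lsp = ls + lphi ->
   lrd - lsp >= - 2^-1 -> ls + lF <= M + 2^-1 + (lh + lrd) by move=> *; lra.
have aux2 (lT lh ld lr : R) : lT <= lh + ld + N -> lr + lT <= N + (lh + (lr + ld)).
  by move=> *; lra.
apply: (@lesssim_near _ _ _ (expR (M + 2^-1) + expR N)); first by rewrite addr_gt0 ?expR_gt0.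
near=> r; have r0 : 0 < r by near: r; exact: nbhs_pinfty_gt.
have sr : 0 < Num.sqrt r by rewrite sqrtr_gt0.
have [h2 Fh Th] : [/\ 2 <= hh r, 0 < Int phi 1 (hh r) & 0 < Tail dl (hh r)] by near: r.
have h1 : 1 <= hh r by near: r; exact: pinfty_ge hoo.
have h0 : 0 < hh r by exact: lt_le_trans h1.
have dh := dl_gt0 h1; have ph := density_gt0 h1.
have hM : ln (Int phi 1 (hh r)) <= ln (hh r) + ln (phi (hh r)) + M.
  by near: r; exact: (pinfty_near hoo HM).
have hN : ln (Tail dl (hh r)) <= ln (hh r) + ln (dl (hh r)) + N.
  by near: r; exact: (pinfty_near hoo HN).
have : `|ln (r * dl (hh r)) - ln (Num.sqrt r * phi (hh r))| <= 2^-1 by near: r.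
rewrite ler_norml => /andP[b1 _].
have rd : 0 < r * dl (hh r) by rewrite mulr_gt0.
have low0 : 0 < low r by rewrite /low !mulr_gt0.
have lowE : ln (low r) = ln (hh r) + ln (r * dl (hh r)).
  by rewrite /low (mulrC r) -mulrA (@lnM _ (hh r)).
rewrite mulrDl /U; apply: lerD.
  rewrite -ler_ln ?posrE ?mulr_gt0 ?expR_gt0// (@lnM _ (expR _)) ?posrE ?expR_gt0//.
  rewrite (@lnM _ (Num.sqrt r)) ?posrE// expRK lowE.
  by apply: aux1 hM _ b1; rewrite (@lnM _ (Num.sqrt r)).
rewrite -ler_ln ?posrE ?mulr_gt0 ?expR_gt0// (@lnM _ (expR _)) ?posrE ?expR_gt0//.
rewrite (@lnM _ r) ?posrE// expRK lowE (@lnM _ r) ?posrE//; exact: aux2 hN.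
Unshelve. all: by end_near. Qed.

End last_phase.

End problem.

(** * Independence of the density in the logarithmic regime *)

(** The supremum is finite by the assumption on D, and positive alpha follows from D > 0. *)
Lemma alpha_spec (R : realType) (dl dphi cl cphi : R -> R)
    (deltal deltaphi gammal gammaphi alpha : R) :
  standing dl dphi cl cphi deltal deltaphi gammal gammaphi ->
  hypA dl dphi cl cphi ->
  4 * sup [set bigD dl dphi t / (t * bigC cl cphi t) | t in `[1, +oo[] <= alpha ->
  0 < alpha /\ forall t, 1 <= t -> 4 * bigD dl dphi t <= alpha * (t * bigC cl cphi t).
Proof.
move=> st [c c0 H] h; set A := [set _ | t in _] in h.
have tC0 t : 1 <= t -> 0 < t * bigC cl cphi t.
  by move=> t1; rewrite mulr_gt0 ?(C_gt0 st)//; lra.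
have ubA : has_ubound A.
  exists c => _ [t /= t1 <-]; move: (t1); rewrite in_itv/= andbT => t1'.
  by rewrite ler_pdivrMr ?tC0//; exact: H.
have key t : 1 <= t -> 4 * bigD dl dphi t <= alpha * (t * bigC cl cphi t).
  move=> t1; rewrite -ler_pdivrMr ?tC0// -mulrA; apply: le_trans h.
  by rewrite ler_pM2l//; apply: ub_le_sup => //; exists t => //=; rewrite in_itv/= t1.
split => //; have := key 1 (lexx 1); have := D_gt0 st (lexx 1); have := tC0 1 (lexx 1).
by move=> a b le; rewrite -(pmulr_lgt0 _ a); apply: lt_le_trans le; rewrite mulr_gt0.
Qed.

Section density_independence.
Context {R : realType}.
Variables (dl dphi dl' dphi' cl cphi : R -> R).
Variables (deltal deltaphi deltal' deltaphi' gammal gammaphi : R).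
Hypothesis st : standing dl dphi cl cphi deltal deltaphi gammal gammaphi.
Hypothesis st' : standing dl' dphi' cl cphi deltal' deltaphi' gammal gammaphi.
Local Notation C := (bigC cl cphi).
Local Notation gamma := ((gammal + gammaphi) / 2).

(** By [balance_asymp_log] the functions f of both densities are comparable with t C(t) ln t, hence so
    are their inverses, and C at these inverses. *)
Lemma Binf_indep_density : hypA dl dphi cl cphi -> hypA dl' dphi' cl cphi ->
  deltal + deltaphi < 1 + gamma -> deltal' + deltaphi' < 1 + gamma ->
  asymp_oo (Binf dl dphi cl cphi) (Binf dl' dphi' cl cphi).
Proof.
move=> hA hA' d1 d2.
have [a0 ha] := alpha_spec st hA (lexx _); have [a0' ha'] := alpha_spec st' hA' (lexx _).
have g1 : 0 < 1 + gamma by have := gamma_ge0 st; lra.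
have [fm inv] := balance_inverse_ex st a0 ha.
have [fm' inv'] := balance_inverse_ex st' a0' ha'.
have uf := uvar_balance st a0 ha; have uf' := uvar_balance st' a0' ha'.
have [B1 B2 _] := Binf_asymp_balance st a0 ha inv.
have [B1' B2' _] := Binf_asymp_balance st' a0' ha' inv'.
have ff := asymp_trans (balance_asymp_log st a0 d1) (asymp_sym (balance_asymp_log st' a0' d2)).
have [foo _ _ _] := asymptotic_inverseP g1 uf inv.
have [foo' _ _ _] := asymptotic_inverseP g1 uf' inv'.
have [M HM] := inverse_le g1 g1 uf uf' inv inv' ff.1.
have [M' HM'] := inverse_le g1 g1 uf' uf inv' inv ff.2.
have [N HN] := lnC_le st M; have [N' HN'] := lnC_le st M'.
apply: asymp_trans (asymp_trans B1 B2) _.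
apply: asymp_trans _ (asymp_sym (asymp_trans B1' B2')).
apply: (@asymp_div_C _ _ _ _ _ _ _ _ _ st _ _ (Num.max N N')); near=> r.
have f1 : 1 <= fm r by near: r; exact: pinfty_ge foo.
have f1' : 1 <= fm' r by near: r; exact: pinfty_ge foo'.
split => //.
have e1 : ln (fm' r) <= ln (fm r) + M by near: r.
have e2 : ln (fm r) <= ln (fm' r) + M' by near: r.
have h2 := HN _ _ f1' f1 e1; have h1 := HN' _ _ f1 f1' e2.
 have : N <= Num.max N N' by rewrite le_max lexx.
have : N' <= Num.max N N' by rewrite le_max lexx orbT.
by rewrite ler_norml => ? ?; apply/andP; split; lra.
Unshelve. all: by end_near. Qed.

End density_independence.

(** * The theorem *)

Theorem theorem4p1 (R : realType) (dl dphi cl cphi : R -> R)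
    (deltal deltaphi gammal gammaphi : R)
    (hst : standing dl dphi cl cphi deltal deltaphi gammal gammaphi) :
  let D := bigD dl dphi in
  let C := bigC cl cphi in
  let delta := deltal + deltaphi in
  let gamma := (gammal + gammaphi) / 2 in
  let k := fun r => fine (kfun dl dphi r) in
  let h := fun r => fine (hfun dl dphi r) in
  let B2 := Bfun dl dphi cl cphi in
  let B := Binf dl dphi cl cphi in
  [/\ (* (A) *)
      hypA dl dphi cl cphi ->
      (forall alpha : R,
        4 * sup [set D t / (t * C t) | t in `[1, +oo[] <= alpha ->
        let f := fun t => t * C t * ln (alpha * (t * C t / D t)) in
        [/\ exists fm : R -> R, asymptotic_inverse f fm,
            forall fm : R -> R, asymptotic_inverse f fm ->
              let tau := fun r => fm (alpha^-1 * r) in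
              [/\ asymp_oo B (fun r => B2 (tau r) r),
                  asymp_oo (fun r => B2 (tau r) r) (fun r => r / C (fm r)) &
                  regularly_varying (fun r => r / C (fm r)) (1 / (1 + gamma))] &
            delta < 1 + gamma -> asymp_oo f (fun t => t * C t * ln t)]) /\
      (delta < 1 + gamma ->
        forall (dl' dphi' : R -> R) (deltal' deltaphi' : R),
          standing dl' dphi' cl cphi deltal' deltaphi' gammal gammaphi ->
          hypA dl' dphi' cl cphi ->
          deltal' + deltaphi' < 1 + gamma ->
          asymp_oo B (Binf dl' dphi' cl cphi)),
      (* (B) *)
      hypB dl dphi cl cphi deltal deltaphi gamma ->
      let upper := fun r => Num.sqrt r *
        \int[lebesgue_measure]_(s in `[k r, +oo[) (Num.sqrt (D s))^-1 in
      [/\ lesssim_oo k B,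
          lesssim_oo B upper,
          regularly_varying k (1 / delta),
          regularly_varying upper (1 / delta) &
          2 < delta ->
          [/\ asymp_oo k B,
              asymp_oo B upper &
              forall (cl' cphi' : R -> R) (gammal' gammaphi' : R),
                standing dl dphi cl' cphi' deltal deltaphi gammal' gammaphi' ->
                hypB dl dphi cl' cphi' deltal deltaphi
                  ((gammal' + gammaphi') / 2) ->
                asymp_oo B (Binf dl dphi cl' cphi')]],
      (* (C) *)
      hypC dl dphi cl cphi delta gamma ->
      let f0 := fun t => t ^+ 2 * C t ^+ 2 / D t in
      let f1 := fun t => (C t *
        \int[lebesgue_measure]_(s in `[1, t]) (Num.sqrt (D s))^-1) ^+ 2 in
      [/\ exists f0m : R -> R, asymptotic_inverse f0 f0m,
          exists f1m : R -> R, asymptotic_inverse f1 f1m &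
          forall f0m f1m : R -> R,
            asymptotic_inverse f0 f0m -> asymptotic_inverse f1 f1m ->
            (* [hfun] may be infinite here, but the minimum is finite *)
            let tau := fun r => fine (Order.min
              (Order.max (f1m r)%:E (kfun dl dphi r)) (hfun dl dphi r)) in
            let lower := fun r => r / C (f0m r) in
            let upper := fun r => r / C (f1m r) in
            let index := (2 - delta + gamma) / (2 - delta + 2 * gamma) in
            [/\ [/\ lesssim_oo lower B,
                    lesssim_oo B (fun r => B2 (tau r) r) &
                    lesssim_oo (fun r => B2 (tau r) r) upper],
                regularly_varying lower index,
                regularly_varying upper index &
                delta < 2 ->
                [/\ asymp_oo lower B,
                    asymp_oo B (fun r => B2 (tau r) r) &
                    asymp_oo (fun r => B2 (tau r) r) upper]]] &
      (* (D) *)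
      hypD dl dphi cl cphi ->
      let lower := fun r => r * h r * dl (h r) in
      let upper := fun r =>
        Num.sqrt r *
          \int[lebesgue_measure]_(s in `[1, h r]) (Num.sqrt (D s))^-1 +
        r * \int[lebesgue_measure]_(s in `[h r, +oo[) dl s in
      let index := (1 - deltaphi) / (deltal - deltaphi) in
      [/\ ~ [bounded dphi t / dl t | t in `[1, +oo[],
          lesssim_oo lower B,
          lesssim_oo B upper,
          deltaphi < deltal ->
            regularly_varying lower index /\ regularly_varying upper index &
          delta < 2 -> 1 < deltal ->
            asymp_oo lower B /\ asymp_oo B upper]].
Proof.
move=> D C delta gamma k h B2 B; split.
- move=> hA; split; last first.
    move=> d dl' dphi' deltal' deltaphi' hst' hA' d'.
    exact: (Binf_indep_density hst hst' hA hA' d d').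
  move=> alpha ha f; have [a0 Ha] := alpha_spec hst hA ha; split.
  + exact: (balance_inverse_ex hst a0 Ha).
  + exact: (Binf_asymp_balance hst a0 Ha).
  + exact: (balance_asymp_log hst a0).
- move=> hB upper; have lo := k_lesssim_Binf hst hB; have up := Binf_lesssim_tail hst hB.
  split => //; [exact: (rv_kk hst)|exact: (rv_sqrt_tail hst hB)|].
  move=> d2; have sh := tail_lesssim_k hst hB d2.
  have kB : asymp_oo k B by split => //; exact: lesssim_trans up sh.
  split => //; first by split => //; exact: lesssim_trans sh lo.
  move=> cl' cphi' gammal' gammaphi' hst' hB'; apply: asymp_trans (asymp_sym kB) _.
  have up' := Binf_lesssim_tail hst' hB'.
  by split; [exact: (k_lesssim_Binf hst' hB')|exact: lesssim_trans up' sh].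
- move=> hC f0 f1; split; [exact: (f0_inverse_ex hst hC)|exact: (f1_inverse_ex hst hC)|].
  move=> f0m f1m inv0 inv1 tau lower upper index.
  have lo := f0_lesssim_Binf hst hC inv0; have ta := Binf_lesssim_tau hst hC inv1.
  have up := tau_lesssim_f1 hst hC inv1.
  split => //; [exact: (rv_f0_bound hst hC inv0)|exact: (rv_f1_bound hst hC inv1)|].
  move=> d2; have sh := f1_lesssim_f0 hst hC inv0 inv1 d2.
  split; split => //.
  + exact: lesssim_trans ta (lesssim_trans up sh).
  + exact: lesssim_trans up (lesssim_trans sh lo).
  + exact: lesssim_trans sh (lesssim_trans lo ta).
- move=> hD lower upper index.
  have lo := h_lesssim_Binf hst hD; have up := Binf_lesssim_h hst hD.
  split => //; [exact: (quot_not_bounded hst hD)|exact: (rv_h_bounds hst hD)|].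
  move=> d2 d1; have sh := h_bounds_match hst hD d2 d1.
  split; split => //; first exact: lesssim_trans up sh.
  exact: lesssim_trans sh lo.
Qed.
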